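(* Let $\Omega=(0,1)$, let $\Theta\subset\mathbb{R}^p$ be a compact domain, let $s\ge 1$ and $r\ge 0$ be integers, and let $\Theta\ni\boldsymbol{\mu}\mapsto u_{\boldsymbol{\mu}}\in H^s(\Omega)$ be a (possibly nonlinear) operator that is $r$-times continuously Fréchet differentiable. Then there exists a constant $C>0$, depending only on $\Theta$ and on the operator $\boldsymbol{\mu}\mapsto u_{\boldsymbol{\mu}}$ (thus also on $s,r,p$), such that the following holds. For any positive integer $k$, let $h=2^{-k}$, $N_h=2^k+1$, and let $x_j=(j-1)h$, $j=1,\dots,N_h$, be the uniform grid of stepsize $h$. For any $0<\varepsilon<1/2$ there exists a deep neural network $\Phi:\mathbb{R}^p\to\mathbb{R}^{N_h}$ such that $$|u_{\boldsymbol{\mu}}(x_j)-\Phi_j(\boldsymbol{\mu})|<\varepsilon$$ for all $\boldsymbol{\mu}\in\Theta$ and all $j=1,\dots,N_h$, where $\Phi_j$ denotes the $j$th component of $\Phi$. Additionally, $\Phi$ can be defined as a composition $\Phi=\Psi\circ\phi$ of a fully connected network $\phi$ and a convolutional neural network $\Psi$, such that the overall architecture has at most (i) $C\log(1/\varepsilon)$ dense layers, with ReLU activation, and $C\log(1/h)$ convolutional layers, (ii) $C\varepsilon^{-2/(2s-1)}\left[\varepsilon^{-p/r}\log(1/\varepsilon)+\log(1/h)\right]$ active weights, (iii) $C\varepsilon^{-2/(2s-1)}$ channels in input and output (of the convolutional layers).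
   Context: $H^s(\Omega)$ is the Sobolev space of (real-valued) $s$-times weakly differentiable functions on $\Omega$ with square-integrable derivatives; its elements are identified with their continuous representatives on $[0,1]$, so point values (including at the endpoints) make sense. For $r=0$ the quantity $\varepsilon^{-p/r}$ is read as $+\infty$, so that (ii) is void in that case. Dense layer with activation $\rho:\mathbb{R}\to\mathbb{R}$: a map $\mathbf{x}\mapsto\rho(\mathbf{W}\mathbf{x}+\mathbf{b})$ from $\mathbb{R}^n$ to $\mathbb{R}^{n'}$, with $\mathbf{W}\in\mathbb{R}^{n'\times n}$, $\mathbf{b}\in\mathbb{R}^{n'}$ and $\rho$ acting componentwise. A fully connected (dense) network is a composition of dense layers. In a ReLU network the hidden layers have activation $\rho(x)=\max(x,0)$, while, as customary, the output layer carries no activation ($\rho=\mathrm{id}$). 1D convolutional layer with $m$ input channels, $m'$ output channels, grouping number $g$ (a common divisor of $m$ and $m'$), kernel size $s$, stride $t$, dilation $d$, activation $\rho$ (the letters $m,s$ here are local to this definition): for $\mathbf{X}\in\mathbb{R}^{m\times n}$ with rows $\mathbf{X}_k$, the output has rows $$\Phi(\mathbf{X})_{k'}=\rho\Big(\sum_k \mathbf{W}_{k',k-\gamma m/g}\otimes_{t,d}\mathbf{X}_k+\mathbf{B}_{k'}\Big),\quad 1\le k'\le m',$$ where $\gamma=\lfloor g(k'-1)/m'\rfloor$, the sum runs over $k=\gamma m/g+1,\dots,(\gamma+1)m/g$, $\mathbf{W}\in\mathbb{R}^{m'\times(m/g)\times s}$ is the weight tensor, $\mathbf{B}$ is the bias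 (same shape as the output), and $(\mathbf{w}\otimes_{t,d}\mathbf{x})_j=\sum_{i=1}^s w_i x_{(j-1)t+(i-1)d+1}$ for $1\le j\le\lfloor (n-d(s-1)-1)/t+1\rfloor$. A 1D transposed convolutional layer is defined in the same way, with weight tensor $\mathbf{W}\in\mathbb{R}^{(m/g)\times m'\times s}$ and $\otimes_{t,d}$ replaced by $(\mathbf{w}\otimes^{\top}_{t,d}\mathbf{x})_j=\sum w_a x_i$, the sum being over all $1\le a\le s$, $1\le i\le n$ with $(i-1)t+(a-1)d+1=j$, for $1\le j\le (n-1)t+d(s-1)+1$. ''Convolutional layers'' includes transposed ones. Defaults: $t=d=g=1$. A convolutional neural network (CNN) is any map that, up to reshaping operations, is a composition of (transposed) convolutional layers; a deep neural network (DNN) is any map that, up to reshaping operations, is a composition of dense layers. (Transposed) convolutional layers are particular dense layers, so every CNN is a DNN, and CNNs and DNNs may be composed to give DNNs. Reshaping operations are weightless maps that only rearrange the entries of a tensor (flattening, refilling into another shape, permuting axes), or discard (truncation) or repeat (padding by copies) entries. Active weights are the nonzero entries of the weight tensors/matrices and biases. *)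

(* Defs.v *)
From HB Require Import structures.
From mathcomp Require Import all_boot all_order all_algebra.
From mathcomp Require Import all_classical all_reals all_analysis.
From mathcomp Require Import measurable_realfun ring lra.
Import Order.TTheory GRing.Theory Num.Theory.
Import numFieldNormedType.Exports.

Set Implicit Arguments.
Unset Strict Implicit.
Unset Printing Implicit Defensive.

Local Open Scope classical_set_scope.
Local Open Scope ring_scope.

(* clin V W is the space L(V, W) of continuous linear maps, normed by the
   operator norm. *)
Section ContinuousLinear.
Context {R : realType} (V W : normedModType R).

Definition clin_pred : {pred V -> W} :=
  fun f => `[< linear f /\ continuous f >].

Record clin := Clin { clin_fun :> V -> W; clin_funP : clin_fun \in clin_pred }.

HB.instance Definition _ := [isSub for clin_fun].
HB.instance Definition _ := gen_eqMixin clin.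
HB.instance Definition _ := gen_choiceMixin clin.

Lemma clin_submod_closed : submod_closed clin_pred.
Proof.
split=> [|a f g /asboolP[fl fc] /asboolP[gl gc]]; apply/asboolP; split.
- by move=> a x y; rewrite /= scaler0 addr0.
- by move=> x; exact: cvg_cst.
- move=> b x y; rewrite !fctE fl gl !scalerDr !scalerA.
  by rewrite addrACA (mulrC a).
- by move=> x; apply: cvgD; [apply: cvgZl_tmp; exact: fc | exact: gc].
Qed.

HB.instance Definition _ :=
  GRing.isSubmodClosed.Build R (V -> W) clin_pred clin_submod_closed.
HB.instance Definition _ := [SubChoice_isSubLmodule of clin by <:].

Lemma clin_linear (f : clin) : linear f.
Proof. by case: f => f /= /asboolP[]. Qed.

HB.instance Definition _ (f : clin) :=
  GRing.isLinear.Build R V W _ (clin_fun f) (clin_linear f).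

Lemma clin_continuous (f : clin) : continuous f.
Proof. by case: f => f /= /asboolP[]. Qed.

Implicit Types f g : clin.

Definition clin_ball_img (f : clin) : set R :=
  [set `|f x| | x in [set x : V | `|x| <= 1]].

Definition clin_norm (f : clin) : R := sup (clin_ball_img f).

Lemma clin_ball_img_neq0 f : clin_ball_img f !=set0.
Proof. by exists `|f 0|, 0 => //=; rewrite normr0 ler01. Qed.

Lemma clin_ball_img_ub f : has_ubound (clin_ball_img f).
Proof.
have /continuous_linear_bounded : {for 0, continuous f} by exact: clin_continuous.
move=> /(_ 0)/bounded_funP/(_ 1)[M fM].
by exists M => _ [x x1 <-]; exact: fM.
Qed.

Lemma clin_norm_ub f x : `|x| <= 1 -> `|f x| <= clin_norm f.
Proof. by move=> x1; apply: ub_le_sup; [exact: clin_ball_img_ub | exists x]. Qed.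

Lemma clin_norm_ge0 f : 0 <= clin_norm f.
Proof.
by apply: le_trans (@clin_norm_ub f 0 _); rewrite ?normr0 ?ler01 ?normr_ge0.
Qed.

Lemma clin_normD f g : clin_norm (f + g) <= clin_norm f + clin_norm g.
Proof.
apply: ge_sup => [|_ [x /= x1 <-]]; first exact: clin_ball_img_neq0.
by apply: le_trans (ler_normD _ _) _; rewrite lerD// clin_norm_ub.
Qed.

Lemma clin_normZ_le a f : clin_norm (a *: f) <= `|a| * clin_norm f.
Proof.
apply: ge_sup => [|_ [x /= x1 <-]]; first exact: clin_ball_img_neq0.
by rewrite normrZ ler_wpM2l// clin_norm_ub.
Qed.

Lemma clin_normZ a f : clin_norm (a *: f) = `|a| * clin_norm f.
Proof.
apply/eqP; rewrite eq_le clin_normZ_le /=.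
have [->|a0] := eqVneq a 0; first by rewrite normr0 mul0r clin_norm_ge0.
rewrite -ler_pdivlMl ?normr_gt0// -normfV -{1}(scalerK a0 f).
exact: clin_normZ_le.
Qed.

Lemma clin_norm0_eq0 f : clin_norm f = 0 -> f = 0.
Proof.
move=> f0; apply/val_inj/funext => x /=.
have [->|x0] := eqVneq x 0; first exact: linear0.
have : `|f (`|x|^-1 *: x)| <= 0.
  rewrite -f0 clin_norm_ub// normrZ normfV normr_id mulVf ?normr_eq0//.
rewrite linearZ normrZ normfV normr_id pmulr_rle0 ?invr_gt0 ?normr_gt0//.
by rewrite normr_le0 => /eqP.
Qed.

HB.instance Definition _ :=
  Lmodule_isNormed.Build R clin clin_normD clin_normZ clin_norm0_eq0.

End ContinuousLinear.

(* f : V -> W is r times continuously Frechet differentiable on the open set U: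
   its derivative is regarded as a map df from V to L(V, W), and so on. *)
Fixpoint Cr {R : realType} (r : nat) (V W : normedModType R)
    (U : set V) (f : V -> W) : Prop :=
  if r is r'.+1 then
    exists df : V -> clin V W,
      (forall x, U x -> is_diff x f (df x)) /\ Cr r' U df
  else forall x, U x -> {for x, continuous f}.

(* On a set A that is not open, Frechet derivatives are not determined by the
   values on A; as usual, f is C^r on A when it is the restriction to A of a
   map that is C^r on an open neighbourhood of A. *)
Definition Cr_on {R : realType} (r : nat) (V W : normedModType R)
    (A : set V) (f : V -> W) : Prop :=
  exists (U : set V) (F : V -> W),
    [/\ open U, A `<=` U, (forall x, A x -> F x = f x) & Cr r U F].

Section Sobolev.
Context {R : realType}.
Notation mu := (@lebesgue_measure R).
Notation Omega := (`]0, 1[%classic : set R).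

Definition smooth (phi : R -> R) := forall n x, derivable (derive1n n phi) x 1.

Definition test_function (phi : R -> R) :=
  smooth phi /\
  exists a b : R, [/\ 0 < a, b < 1 &
    forall x, x \notin `[a, b] -> phi x = 0].

Definition square_integrable (f : R -> R) :=
  measurable_fun Omega f /\
  mu.-integrable Omega (EFin \o (fun x => f x ^+ 2)).

Definition is_weak_derivative (k : nat) (f g : R -> R) :=
  forall phi, test_function phi ->
    \int[mu]_(x in Omega) (f x * derive1n k phi x) =
    (-1) ^+ k * \int[mu]_(x in Omega) (g x * phi x).

Definition weak_derivatives (s : nat) (f : R -> R) : set (nat -> R -> R) :=
  [set g | (forall x, Omega x -> g 0%N x = f x) /\
    forall k, (k <= s)%N ->
      square_integrable (g k) /\ is_weak_derivative k f (g k)].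

(* An element of H^s(0,1), s >= 1, is represented by its continuous
   representative on [0,1], extended by 0 outside [0,1] so that equality in
   H^s is equality of functions. *)
Definition sobolev_pred (s : nat) : {pred R -> R} :=
  fun f => `[< [/\ forall x, x \notin `[0, 1] -> f x = 0,
    {within `[0, 1], continuous f} &
    weak_derivatives s f !=set0] >].

Definition energy (s : nat) (g : nat -> R -> R) : R :=
  \sum_(k < s.+1) \int[mu]_(x in Omega) (g k x ^+ 2).

Record sobolev (s : nat) :=
  Sobolev { sobolev_fun :> R -> R;
            sobolev_funP : sobolev_fun \in sobolev_pred s }.

Definition sobolev_energies (s : nat) (f : R -> R) : set R :=
  [set Num.sqrt (energy s g) | g in weak_derivatives s f].

(* Weak derivatives are unique almost everywhere, so sobolev_energies s f has
   exactly one element, the usual H^s norm of f; taking its infimum avoids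
   choosing representatives of the derivatives. *)
Definition sobolev_norm (s : nat) (f : sobolev s) : R :=
  inf (sobolev_energies s f).

Lemma mOmega : measurable Omega. Proof. exact: measurable_itv. Qed.

Lemma OintD f g :
  mu.-integrable Omega (EFin \o f) -> mu.-integrable Omega (EFin \o g) ->
  \int[mu]_(x in Omega) (f x + g x) =
  \int[mu]_(x in Omega) f x + \int[mu]_(x in Omega) g x.
Proof. by move=> fi gi; apply: RintegralD. Qed.

Lemma OintZ a f : mu.-integrable Omega (EFin \o f) ->
  \int[mu]_(x in Omega) (a * f x) = a * \int[mu]_(x in Omega) f x.
Proof. by move=> fi; apply: RintegralZl. Qed.

Lemma square_integrableD f g : square_integrable f -> square_integrable g ->
  square_integrable (fun x => f x + g x).
Proof.
move=> [mf If] [mg Ig]; split; first exact: measurable_funD.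
apply: (@le_integrable _ _ _ mu Omega mOmega _
  (EFin \o (fun x => 2 * f x ^+ 2 + 2 * g x ^+ 2))).
- by apply/measurable_EFinP; apply: measurable_funX; exact: measurable_funD.
- move=> x _ /=; rewrite lee_fin !ger0_norm ?sqr_ge0//; last first.
    by rewrite addr_ge0// mulr_ge0// sqr_ge0.
  by have := sqr_ge0 (f x - g x); nra.
- have -> : EFin \o (fun x => 2 * f x ^+ 2 + 2 * g x ^+ 2) =
     (fun x => 2%:E * (EFin \o (fun x => f x ^+ 2)%R) x)%E \+
     (fun x => 2%:E * (EFin \o (fun x => g x ^+ 2)%R) x)%E by [].
  apply: integrableD => //; apply: integrableZl => //.
Qed.

Lemma square_integrableZ a f : square_integrable f ->
  square_integrable (fun x => a * f x).
Proof.
move=> [mf If]; split; first exact: measurable_funM.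
have -> : EFin \o (fun x => (a * f x) ^+ 2) =
   (fun x => (a ^+ 2)%:E * (EFin \o (fun x => f x ^+ 2)%R) x)%E.
  by apply/funext => x /=; rewrite exprMn EFinM.
exact: integrableZl.
Qed.

Lemma square_integrableM f g : square_integrable f -> square_integrable g ->
  mu.-integrable Omega (EFin \o (fun x => f x * g x)).
Proof.
move=> [mf If] [mg Ig].
apply: (@le_integrable _ _ _ mu Omega mOmega _
  (EFin \o (fun x => f x ^+ 2 + g x ^+ 2))).
- by apply/measurable_EFinP; exact: measurable_funM.
- move=> x _ /=; rewrite lee_fin (ger0_norm (addr_ge0 _ _)) ?sqr_ge0//.
  rewrite ler_norml; apply/andP; split.
    by have := sqr_ge0 (f x + g x); have := sqr_ge0 (f x - g x); nra.
  by have := sqr_ge0 (f x - g x); have := sqr_ge0 (f x + g x); nra.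
- have -> : EFin \o (fun x => f x ^+ 2 + g x ^+ 2) =
     (EFin \o (fun x => f x ^+ 2)) \+ (EFin \o (fun x => g x ^+ 2)) by [].
  exact: integrableD.
Qed.

Lemma continuous_square_integrable (f : R -> R) :
  {within `[0, 1], continuous f} -> square_integrable f.
Proof.
move=> cf; split.
  have mf : measurable_fun `[(0 : R), 1]%classic f.
    apply: subspace_continuous_measurable_fun => //; exact: measurable_itv.
  by apply: measurable_funS mf; [exact: measurable_itv|exact: subset_itv_oo_cc].
apply: (@integrableS _ _ _ mu `[0, 1]%classic) => //.
  exact: subset_itv_oo_cc.
apply: continuous_compact_integrable; first exact: segment_compact.
move=> x; apply: cvgM; exact: cf.
Qed.

Lemma test_square_integrable k phi : test_function phi ->
  square_integrable (derive1n k phi).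
Proof.
move=> [sphi _]; apply: continuous_square_integrable.
apply: continuous_subspaceT => x.
by apply/differentiable_continuous/derivable1_diffP; exact: sphi.
Qed.

Lemma is_weak_derivativeD k f1 f2 g1 g2 :
  square_integrable f1 -> square_integrable f2 ->
  square_integrable g1 -> square_integrable g2 ->
  is_weak_derivative k f1 g1 -> is_weak_derivative k f2 g2 ->
  is_weak_derivative k (fun x => f1 x + f2 x) (fun x => g1 x + g2 x).
Proof.
move=> f1i f2i g1i g2i d1 d2 phi tphi.
have pk := test_square_integrable k tphi.
have p0 : square_integrable phi := test_square_integrable 0 tphi.
under eq_Rintegral do rewrite mulrDl.
under [in RHS]eq_Rintegral do rewrite mulrDl.
rewrite [LHS](OintD (square_integrableM f1i pk)
  (square_integrableM f2i pk)).
rewrite (OintD (square_integrableM g1i p0)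
  (square_integrableM g2i p0)).
by rewrite d1// d2// mulrDr.
Qed.

Lemma is_weak_derivativeZ k a f g :
  square_integrable f -> square_integrable g ->
  is_weak_derivative k f g ->
  is_weak_derivative k (fun x => a * f x) (fun x => a * g x).
Proof.
move=> fi gi d phi tphi.
have pk := test_square_integrable k tphi.
have p0 : square_integrable phi := test_square_integrable 0 tphi.
under eq_Rintegral do rewrite -mulrA.
under [in RHS]eq_Rintegral do rewrite -mulrA.
rewrite [LHS](OintZ _ (square_integrableM fi pk)).
rewrite (OintZ _ (square_integrableM gi p0)).
by rewrite d// mulrCA.
Qed.

Lemma sobolev_sqint s (f : R -> R) :
  f \in sobolev_pred s -> square_integrable f.
Proof. by move=> /asboolP[_ cf _]; exact: continuous_square_integrable. Qed.

Lemma weak_derivativesD s f1 f2 g1 g2 :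
  square_integrable f1 -> square_integrable f2 ->
  weak_derivatives s f1 g1 -> weak_derivatives s f2 g2 ->
  weak_derivatives s (f1 + f2) (g1 + g2).
Proof.
move=> i1 i2 [z1 d1] [z2 d2]; split=> [x xO|k ks].
  by rewrite !fctE z1// z2.
have [[s1 w1] [s2 w2]] := (d1 k ks, d2 k ks).
by split; [exact: square_integrableD|exact: is_weak_derivativeD].
Qed.

Lemma weak_derivativesZ s a f g : square_integrable f ->
  weak_derivatives s f g ->
  weak_derivatives s (a *: f) (fun k x => a * g k x).
Proof.
move=> i [z d]; split=> [x xO|k ks].
  by rewrite !fctE z.
have [s1 w1] := d k ks.
by split; [exact: square_integrableZ|exact: is_weak_derivativeZ].
Qed.

Lemma sobolev_submod_closed s : submod_closed (sobolev_pred s).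
Proof.
split=> [|a f1 f2 F1 F2].
  apply/asboolP; split => //.
    by apply: continuous_subspaceT => x; exact: cvg_cst.
  exists (fun _ _ => 0); split => // k ks; split.
    apply: continuous_square_integrable.
    by apply: continuous_subspaceT => x; exact: cvg_cst.
  move=> phi _; under eq_Rintegral do rewrite mul0r.
  under [in RHS]eq_Rintegral do rewrite mul0r.
  by rewrite !Rintegral_cst ?mul0r ?mulr0//; exact: mOmega.
have [i1 i2] := (sobolev_sqint F1, sobolev_sqint F2).
move: F1 F2 => /asboolP[z1 c1 [g1 d1]] /asboolP[z2 c2 [g2 d2]].
apply/asboolP; split.
- by move=> x x01; rewrite !fctE z1// z2// addr0 scaler0.
- by move=> x; apply: cvgD; [apply: cvgZl_tmp; exact: c1|exact: c2].
- exists ((fun k x => a * g1 k x) + g2).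
  apply: weak_derivativesD => //; last exact: weak_derivativesZ.
  exact: square_integrableZ.
Qed.

HB.instance Definition _ s := [isSub for @sobolev_fun s].
HB.instance Definition _ s := gen_eqMixin (sobolev s).
HB.instance Definition _ s := gen_choiceMixin (sobolev s).
HB.instance Definition _ s := GRing.isSubmodClosed.Build R (R -> R)
  (sobolev_pred s) (sobolev_submod_closed s).
HB.instance Definition _ s := [SubChoice_isSubLmodule of sobolev s by <:].

Lemma energy_ge0 s g : 0 <= energy s g.
Proof. by apply: sumr_ge0 => k _; apply: Rintegral_ge0 => x _; exact: sqr_ge0. Qed.

Lemma energyZ s a g : (forall k, (k <= s)%N -> square_integrable (g k)) ->
  energy s (fun k x => a * g k x) = a ^+ 2 * energy s g.
Proof.
move=> ig; rewrite /energy big_distrr /=; apply: eq_bigr => k _.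
have [_ gk] := ig k (ltn_ord k).
under eq_Rintegral do rewrite exprMn.
by rewrite (OintZ _ gk).
Qed.

Lemma energy_line s g h t :
  (forall k, (k <= s)%N -> square_integrable (g k)) ->
  (forall k, (k <= s)%N -> square_integrable (h k)) ->
  energy s (fun k x => g k x + t * h k x) = energy s g +
   t * (\sum_(k < s.+1) \int[mu]_(x in Omega) (g k x * h k x)) *+ 2 +
   t ^+ 2 * energy s h.
Proof.
move=> ig ih; rewrite /energy !big_distrr -sumrMnl -!big_split /=.
apply: eq_bigr => k _.
have [gk hk] := (ig k (ltn_ord k), ih k (ltn_ord k)).
have thk := square_integrableZ t hk.
have gth := square_integrableM gk thk.
under eq_Rintegral do rewrite sqrrD.
rewrite (OintD _ thk.2); last first.
  have -> : EFin \o (fun x => g k x ^+ 2 + g k x * (t * h k x) *+ 2) =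
    (EFin \o (fun x => g k x ^+ 2)) \+ ((EFin \o (fun x => g k x * (t * h k x)))
     \+ (EFin \o (fun x => g k x * (t * h k x)))) by [].
  by apply: integrableD gk.2 _ => //; exact: integrableD.
rewrite (OintD gk.2); last first.
  have -> : EFin \o (fun x => g k x * (t * h k x) *+ 2) =
    (EFin \o (fun x => g k x * (t * h k x)))
     \+ (EFin \o (fun x => g k x * (t * h k x))) by [].
  exact: integrableD.
congr (_ + _ + _).
  under eq_Rintegral do rewrite mulr2n.
  rewrite (OintD gth gth) -mulr2n.
  under eq_Rintegral do rewrite mulrCA.
  by rewrite (OintZ _ (square_integrableM gk hk)).
under eq_Rintegral do rewrite exprMn.
by rewrite (OintZ _ hk.2).
Qed.

Lemma sqrt_energyD s g h :
  (forall k, (k <= s)%N -> square_integrable (g k)) ->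
  (forall k, (k <= s)%N -> square_integrable (h k)) ->
  Num.sqrt (energy s (g + h)) <= Num.sqrt (energy s g) + Num.sqrt (energy s h).
Proof.
move=> ig ih.
set b := \sum_(k < s.+1) \int[mu]_(x in Omega) (g k x * h k x).
have line t : 0 <= energy s g + t * b *+ 2 + t ^+ 2 * energy s h.
  by rewrite -energy_line// energy_ge0.
have -> : energy s (g + h) = energy s g + b *+ 2 + energy s h.
  rewrite -[b]mul1r -[energy s h]mul1r -[X in X * energy s h](expr1n _ 2).
  rewrite -energy_line//; congr energy.
  by apply/funext => k; apply/funext => x; rewrite !fctE mul1r.
clearbody b; move: line (energy_ge0 s g) (energy_ge0 s h).
move: (energy s g) (energy s h) => a c line a0 c0.
have bac : b ^+ 2 <= a * c.
  have [c00|cn0] := eqVneq c 0.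
    have [->|bn0] := eqVneq b 0; first by rewrite expr0n/= mulr_ge0.
    have := line (- (a + 1) / (b *+ 2)).
    rewrite c00 mulr0 addr0 -mulrnAr divfK ?mulrn_eq0//.
    by rewrite opprD addrA subrr sub0r oppr_ge0 ler10.
  have cgt0 : 0 < c by rewrite lt_def cn0.
  have := line (- b / c).
  have -> : a + - b / c * b *+ 2 + (- b / c) ^+ 2 * c = (a * c - b ^+ 2) / c.
    by field.
  by rewrite pmulr_lge0 ?invr_gt0// subr_ge0.
have bs : b <= Num.sqrt a * Num.sqrt c.
  rewrite -sqrtrM//; apply: le_trans (ler_norm b) _.
  by rewrite -sqrtr_sqr ler_wsqrtr.
have abc0 : 0 <= a + b *+ 2 + c by have := line 1; rewrite mul1r expr1n mul1r.
rewrite -ler_sqr ?nnegrE ?addr_ge0 ?sqrtr_ge0// sqr_sqrtr// sqrrD !sqr_sqrtr//.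
by rewrite lerD2r lerD2l lerMn2r.
Qed.

Lemma sobolev_energies_neq0 s (f : sobolev s) : sobolev_energies s f !=set0.
Proof.
have /asboolP[_ _ [g gf]] := sobolev_funP f.
by exists (Num.sqrt (energy s g)), g.
Qed.

Lemma sobolev_energies_lb s f : lbound (sobolev_energies s f) 0.
Proof. by move=> _ [g _ <-]; exact: sqrtr_ge0. Qed.

Lemma sobolev_energies_has_inf s (f : sobolev s) : has_inf (sobolev_energies s f).
Proof.
by split; [exact: sobolev_energies_neq0|exists 0; exact: sobolev_energies_lb].
Qed.

Lemma sobolev_norm_le s (f : sobolev s) g : weak_derivatives s f g ->
  sobolev_norm f <= Num.sqrt (energy s g).
Proof.
by move=> gf; apply: ge_inf; [exists 0; exact: sobolev_energies_lb|exists g].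
Qed.

Lemma sobolev_norm_ge0 s (f : sobolev s) : 0 <= sobolev_norm f.
Proof.
apply: lb_le_inf; first exact: sobolev_energies_neq0.
exact: sobolev_energies_lb.
Qed.

Lemma sobolev_norm_adherent s (f : sobolev s) e : 0 < e ->
  exists2 g, weak_derivatives s f g & Num.sqrt (energy s g) < sobolev_norm f + e.
Proof.
move=> e0.
have [_ [g gf <-] ge] := inf_adherent e0 (sobolev_energies_has_inf f).
by exists g.
Qed.

Lemma sobolev_normD s (f1 f2 : sobolev s) :
  sobolev_norm (f1 + f2) <= sobolev_norm f1 + sobolev_norm f2.
Proof.
apply/ler_addgt0Pr => e e0; have e20 : 0 < e / 2 by rewrite divr_gt0.
have [g1 d1 l1] := sobolev_norm_adherent f1 e20.
have [g2 d2 l2] := sobolev_norm_adherent f2 e20.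
have d12 : weak_derivatives s (f1 + f2)%R (g1 + g2).
  by apply: weak_derivativesD => //; apply: sobolev_sqint; exact: sobolev_funP.
apply: le_trans (sobolev_norm_le d12) _.
apply: le_trans (sqrt_energyD _ _) _.
- by move=> k ks; have [] := d1.2 k ks.
- by move=> k ks; have [] := d2.2 k ks.
- by rewrite [e]splitr addrACA lerD// ltW.
Qed.

Lemma sobolev_normZ_le s a (f : sobolev s) :
  sobolev_norm (a *: f) <= `|a| * sobolev_norm f.
Proof.
apply/ler_addgt0Pr => e e0.
have a10 : 0 < `|a| + 1 by rewrite ltr_wpDl.
have [g d l] := sobolev_norm_adherent f (divr_gt0 e0 a10).
have ad : weak_derivatives s (a *: f) (fun k x => a * g k x).
  by apply: weak_derivativesZ => //; apply: sobolev_sqint; exact: sobolev_funP.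
apply: le_trans (sobolev_norm_le ad) _.
rewrite energyZ; last by move=> k ks; have [] := d.2 k ks.
rewrite sqrtrM ?sqr_ge0// sqrtr_sqr.
apply: (@le_trans _ _ (`|a| * (sobolev_norm f + e / (`|a| + 1)))).
  by rewrite ler_wpM2l// ltW.
rewrite mulrDr lerD2l mulrCA ger_pMr// ler_pdivrMr// mul1r.
by rewrite lerDl.
Qed.

Lemma sobolev_normZ s a (f : sobolev s) :
  sobolev_norm (a *: f) = `|a| * sobolev_norm f.
Proof.
apply/eqP; rewrite eq_le sobolev_normZ_le /=.
have [->|a0] := eqVneq a 0; first by rewrite normr0 mul0r sobolev_norm_ge0.
rewrite -ler_pdivlMl ?normr_gt0// -normfV -{1}(scalerK a0 f).
exact: sobolev_normZ_le.
Qed.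

Lemma sobolev_norm0_eq0 s (f : sobolev s) : sobolev_norm f = 0 -> f = 0.
Proof.
move=> f0; have /asboolP[fout fc fd] := sobolev_funP f.
have fi : square_integrable f by exact: sobolev_sqint (sobolev_funP f).
have If0 : \int[mu]_(x in Omega) (f x ^+ 2) <= 0.
  apply/ler_addgt0Pr => e e0; rewrite add0r.
  have se0 : 0 < Num.sqrt e by rewrite sqrtr_gt0.
  have [g [gf gd]] := sobolev_norm_adherent f se0.
  rewrite f0 add0r ltr_sqrt// => /ltW; apply: le_trans.
  rewrite /energy big_ord_recl -[leLHS]addr0 lerD//.
    rewrite le_eqVlt; apply/orP; left; apply/eqP/eq_Rintegral => x.
    by rewrite inE => xO; rewrite gf.
  by apply: sumr_ge0 => k _; apply: Rintegral_ge0 => x _; exact: sqr_ge0.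
apply/val_inj/funext => x /=.
have [x01|] := boolP (x \in `[(0 : R), 1]); last exact: fout.
apply/eqP; apply: contraT => fx0.
have fxp : 0 < `|f x| / 2 by rewrite divr_gt0// normr_gt0.
have /subspace_continuousP/(_ x x01)/cvgrPdist_lt/(_ _ fxp) := fc.
rewrite near_withinE => /nbhs_ballP[d /= d0 xd].
pose a := Num.max 0 (x - d); pose b := Num.min 1 (x + d).
have [x0 x1] : 0 <= x /\ x <= 1 by move: x01; rewrite in_itv/= => /andP[].
have ab : a < b.
  by rewrite lt_min !gt_max ltr01 /=; apply/and3P; split; lra.
have abO : `]a, b[ `<=` Omega.
  move=> y /=; rewrite !in_itv/= gt_max lt_min => /andP[/andP[y0 _] /andP[y1 _]].
  by rewrite y0 y1.
pose c := (`|f x| / 2) ^+ 2.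
have c0 : 0 < c by rewrite exprn_gt0.
have cf y : `]a, b[%classic y -> c <= f y ^+ 2.
  move=> yab; have := abO _ yab; move: yab => /=.
  rewrite !in_itv/= gt_max lt_min => /andP[/andP[y0 yx] /andP[y1 xy]] _.
  have : `|f x - f y| < `|f x| / 2.
    apply: xd; last by rewrite /= in_itv/= !ltW.
    by rewrite /ball/= ltr_distlC; apply/andP; split; lra.
  move=> fxy; rewrite -(real_normK (num_real (f y))) ler_sqr ?nnegrE ?normr_ge0 ?(ltW fxp)//.
  by have := lerB_dist (f x) (f y); lra.
have : (0 < \int[mu]_(x in Omega) (f x ^+ 2)%:E)%E.
  apply: (@lt_le_trans _ _ (\int[mu]_(x in `]a, b[) c%:E)%E).
    rewrite integral_cst//= lebesgue_measure_itv/= lte_fin ab.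
    by rewrite -EFinD -EFinM lte_fin mulr_gt0// subr_gt0.
  apply: (@le_trans _ _ (\int[mu]_(x in `]a, b[) (f x ^+ 2)%:E)%E).
    apply: ge0_le_integral => //.
    - by move=> y _; rewrite lee_fin ltW.
    - apply/measurable_EFinP/measurable_funX.
      by apply: measurable_funS fi.1 => //; exact: measurable_itv.
  apply: ge0_subset_integral => //.
    by apply/measurable_EFinP/measurable_funX; exact: fi.1.
  by move=> y _; rewrite lee_fin sqr_ge0.
have -> : (\int[mu]_(x in Omega) (f x ^+ 2)%:E =
  (\int[mu]_(x in Omega) (f x ^+ 2))%:E)%E.
  by rewrite /Rintegral fineK//; exact: integrable_fin_num fi.2.
by rewrite lte_fin ltNge If0.
Qed.

HB.instance Definition _ s := Lmodule_isNormed.Build R (sobolev s)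
  (@sobolev_normD s) (@sobolev_normZ s) (@sobolev_norm0_eq0 s).

End Sobolev.

Arguments sobolev R s : clear implicits.

Section Networks.
Context (R : realType).

Definition relu (x : R) : R := Num.max x 0.

Record conv_params (m m' : nat) := ConvParams {
  groups : nat; ksize : nat; stride : nat; dilation : nat;
  conv_paramsP : [&& 0 < groups, groups %| m, groups %| m',
                     0 < ksize, 0 < stride & 0 < dilation]%N }.

Section Convolution.
Variables (m m' n : nat) (c : conv_params m m').

(* floor((n - d(s-1) - 1)/t + 1); the truncated subtraction makes
   the output empty when the dilated kernel is longer than the input. *)
Definition conv_size : nat :=
  ((n + stride c - (dilation c * (ksize c).-1).+1) %/ stride c)%N.

Definition tconv_size : nat :=
  (n.-1 * stride c + dilation c * (ksize c).-1 + 1)%N.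

(* k is the l-th input channel of the group to which the output channel k'
   belongs (all indices start at 0). *)
Definition in_group (k' : 'I_m') (l : 'I_(m %/ groups c)) (k : 'I_m) : bool :=
  k == (groups c * k' %/ m' * (m %/ groups c) + l)%N :> nat.

Definition conv (rho : R -> R)
    (W : 'I_m' -> 'I_(m %/ groups c) -> 'I_(ksize c) -> R)
    (B : 'M[R]_(m', conv_size)) (X : 'M[R]_(m, n)) : 'M[R]_(m', conv_size) :=
  \matrix_(k', j) rho (\sum_(k < m) \sum_(l | in_group k' l k)
    \sum_(a < ksize c)
      \sum_(i < n | i == (j * stride c + a * dilation c)%N :> nat)
        W k' l a * X k i + B k' j).

Definition tconv (rho : R -> R)
    (W : 'I_(m %/ groups c) -> 'I_m' -> 'I_(ksize c) -> R)
    (B : 'M[R]_(m', tconv_size)) (X : 'M[R]_(m, n)) : 'M[R]_(m', tconv_size) :=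
  \matrix_(k', j) rho (\sum_(k < m) \sum_(l | in_group k' l k)
    \sum_(a < ksize c)
      \sum_(i < n | (i * stride c + a * dilation c)%N == j :> nat)
        W l k' a * X k i + B k' j).

End Convolution.

(* A layer maps 'M_(m, n) to 'M_(m', n'): m channels of length n for
   convolutional layers, column vectors for dense ones. A reshaping fills each
   output entry with a copy of some input entry; this covers flattening,
   refilling, permutation of axes, truncation and padding by copies, and hence
   also passing through tensors of higher order. *)
Inductive layer : nat -> nat -> nat -> nat -> Type :=
| Dense n n' (rho : R -> R) (W : 'M[R]_(n', n)) (b : 'cV[R]_n') :
    layer n 1 n' 1
| Conv m m' n (c : conv_params m m') (rho : R -> R)
    (W : 'I_m' -> 'I_(m %/ groups c) -> 'I_(ksize c) -> R)
    (B : 'M[R]_(m', conv_size n c)) : layer m n m' (conv_size n c)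
| TConv m m' n (c : conv_params m m') (rho : R -> R)
    (W : 'I_(m %/ groups c) -> 'I_m' -> 'I_(ksize c) -> R)
    (B : 'M[R]_(m', tconv_size n c)) : layer m n m' (tconv_size n c)
| Reshape m n m' n' (sigma : 'I_m' -> 'I_n' -> 'I_m * 'I_n) :
    layer m n m' n'.

Definition layer_eval m n m' n' (L : layer m n m' n') :
    'M[R]_(m, n) -> 'M[R]_(m', n') :=
  match L in layer m n m' n' return 'M[R]_(m, n) -> 'M[R]_(m', n') with
  | Dense _ _ rho W b => fun x => map_mx rho (W *m x + b)
  | Conv _ _ _ _ rho W B => conv rho W B
  | TConv _ _ _ _ rho W B => tconv rho W B
  | Reshape _ _ _ _ sigma =>
      fun X => \matrix_(i, j) X (sigma i j).1 (sigma i j).2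
  end.

Definition is_dense m n m' n' (L : layer m n m' n') : bool :=
  if L is Dense _ _ _ _ _ then true else false.

Definition is_conv m n m' n' (L : layer m n m' n') : bool :=
  match L with Conv _ _ _ _ _ _ _ | TConv _ _ _ _ _ _ _ => true | _ => false end.

Definition is_reshape m n m' n' (L : layer m n m' n') : bool :=
  if L is Reshape _ _ _ _ _ then true else false.

Definition activation m n m' n' (L : layer m n m' n') : option (R -> R) :=
  match L with
  | Dense _ _ rho _ _ | Conv _ _ _ _ rho _ _ | TConv _ _ _ _ rho _ _ => Some rho
  | Reshape _ _ _ _ _ => None
  end.

Definition nonzero (I : finType) (F : I -> R) : nat := #|[pred i | F i != 0]|.

Definition layer_weights m n m' n' (L : layer m n m' n') : nat :=
  match L with
  | Dense _ _ _ W b =>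
      nonzero (fun i => W i.1 i.2) + nonzero (fun i => b i.1 i.2)
  | Conv _ _ _ _ _ W B =>
      nonzero (fun i => W i.1.1 i.1.2 i.2) + nonzero (fun i => B i.1 i.2)
  | TConv _ _ _ _ _ W B =>
      nonzero (fun i => W i.1.1 i.1.2 i.2) + nonzero (fun i => B i.1 i.2)
  | Reshape _ _ _ _ _ => 0
  end%N.

Definition layer_channels m n m' n' (L : layer m n m' n') : nat :=
  if is_conv L then maxn m m' else 0%N.

Inductive network : nat -> nat -> nat -> nat -> Type :=
| NNil m n : network m n m n
| NCons m n m1 n1 m2 n2 (L : layer m n m1 n1) (N : network m1 n1 m2 n2) :
    network m n m2 n2.

Fixpoint net_eval m n m' n' (N : network m n m' n') :
    'M[R]_(m, n) -> 'M[R]_(m', n') :=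
  match N in network m n m' n' return 'M[R]_(m, n) -> 'M[R]_(m', n') with
  | NNil _ _ => id
  | NCons _ _ _ _ _ _ L N' => net_eval N' \o layer_eval L
  end.

Fixpoint all_layers (P : forall m n m' n', layer m n m' n' -> Prop)
    m n m' n' (N : network m n m' n') : Prop :=
  match N with
  | NNil _ _ => True
  | NCons _ _ _ _ _ _ L N' => P _ _ _ _ L /\ all_layers P N'
  end.

Fixpoint num_dense m n m' n' (N : network m n m' n') : nat :=
  if N is NCons _ _ _ _ _ _ L N' then (is_dense L + num_dense N')%N else 0%N.

Fixpoint num_conv m n m' n' (N : network m n m' n') : nat :=
  if N is NCons _ _ _ _ _ _ L N' then (is_conv L + num_conv N')%N else 0%N.

Fixpoint active_weights m n m' n' (N : network m n m' n') : nat :=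
  if N is NCons _ _ _ _ _ _ L N'
  then (layer_weights L + active_weights N')%N else 0%N.

Fixpoint max_channels m n m' n' (N : network m n m' n') : nat :=
  if N is NCons _ _ _ _ _ _ L N'
  then maxn (layer_channels L) (max_channels N') else 0%N.

Definition is_nil m n m' n' (N : network m n m' n') : bool :=
  if N is NNil _ _ then true else false.

Definition is_dnn p q (f : 'cV[R]_p -> 'cV[R]_q) : Prop :=
  exists N : network p 1 q 1,
    all_layers (fun _ _ _ _ L => is_dense L || is_reshape L) N /\
    net_eval N = f.

(* Fully connected ReLU network: at least one layer, all layers are dense, the
   hidden ones have activation relu and the output layer has none. *)
Fixpoint relu_fully_connected m n m' n' (N : network m n m' n') : Prop :=
  if N is NCons _ _ _ _ _ _ L N' then
    is_dense L /\
    (if is_nil N' then activation L = Some id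
     else activation L = Some relu /\ relu_fully_connected N')
  else False.

(* The activation of each convolutional layer is relu or the identity: with
   unrestricted activations R -> R, a bound on the number of weights would say
   nothing about the complexity of the network. *)
Definition is_cnn m n m' n' (N : network m n m' n') : Prop :=
  all_layers (fun _ _ _ _ L => is_reshape L \/
    is_conv L /\ (activation L = Some relu \/ activation L = Some id)) N.

End Networks.

(* Main.v *)
(* Idea. On a dyadic cell of width t ~ eps^(2/(2s-1)), a function f in H^s is
   within C t^(s-1/2) of its interpolation polynomial of degree < s: the error is
   a functional \sum_i w i * f (x i) killing polynomials of degree < s, so it
   equals the integral of the weak derivative of order s against a spline, which
   is seen by testing against mollified splines. The coefficients of these
   polynomials are bounded linear functionals of u_mu, hence uniformly C^r in mu;
   replacing them by local Taylor polynomials glued with a partition of unity made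
   of tensor products of hats leaves products of clipped affine functions of mu,
   which ReLU networks compute up to eps with depth O(log (1/eps)) by means of the
   sawtooth approximation of the square. Finally a pointwise convolution followed
   by an interleaving sends the coefficients of the polynomial of each cell to
   those of its restrictions to the two halves of the cell, and iterating this
   down to the step h evaluates the polynomials at all grid points. *)

Require Import Defs.
From HB Require Import structures.
From mathcomp Require Import all_boot all_order all_algebra.
From mathcomp Require Import all_classical all_reals all_analysis.
From mathcomp Require Import measurable_realfun ring lra zify.
Import Order.TTheory GRing.Theory Num.Theory.
Import numFieldNormedType.Exports.

Set Implicit Arguments.
Unset Strict Implicit.
Unset Printing Implicit Defensive.

Local Open Scope classical_set_scope.
Local Open Scope ring_scope.

(** * ReLU networks as programs on finite state spaces *)

(** The weight bound adds [ln (1 / eps)] and the number [q] of outputs of [phi] instead of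
    multiplying them. The products of hats and clipped coordinates do not depend on the output, so
    one bank of product units serves all outputs, each costing one more row of the last layer. As
    [q] counts the coefficients of all cells, it is of order eps^(-2/(2s-1)). No constant may depend
    on [k]. The level of the coarse cells is therefore the smaller of [k] and a level [l0] fixed by
    [eps]. If [k] is the smaller one, the cells may be too wide for the interpolation estimate, but
    then every grid point is the left end of a cell, where interpolation is exact. The coefficient
    functionals vary with [eps], so Taylor's formula is needed with constants uniform over all
    functionals of a given norm. Their norms are bounded because point evaluation on H^s is, which
    follows from the same kernel estimate as the interpolation error. *)

Section StateNetworks.
Context {R : realType}.

(** Active weights are counted by covering the support with the image of a finite type. As [f] need
    not be injective, [K] can be any type of convenient cardinality. *)
Lemma nonzero_le_card (I K : finType) (F : I -> R) (f : K -> I) :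
  (forall i, F i != 0 -> exists k, f k = i) -> (nonzero F <= #|K|)%N.
Proof.
move=> Ff; apply: leq_trans (leq_image_card f K).
apply: subset_leq_card; apply/fintype.subsetP => i; rewrite inE => /Ff[k <-].
by rewrite map_f ?mem_enum.
Qed.

Lemma nonzero_eq0 (I : finType) (F : I -> R) : (forall i, F i = 0) -> nonzero F = 0%N.
Proof. by move=> F0; apply: eq_card0 => i; rewrite inE F0 eqxx. Qed.

Lemma relu_fully_connected_cons m n m' n' (N : network R m n m' n') :
  relu_fully_connected N -> is_nil N = false.
Proof. by case: N. Qed.

Definition realizes n q (d w : nat) (G : ('I_n -> R) -> 'I_q -> R) : Prop :=
  exists N : network R n 1 q 1,
    [/\ relu_fully_connected N, num_dense N = d, (active_weights N <= w)%N &
        forall x o, net_eval N x o 0 = G (fun i => x i 0) o].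

Lemma realizes_output n q (K : finType) (f : K -> 'I_q * 'I_n)
    (A : 'I_q -> 'I_n -> R) :
  (forall o i, A o i != 0 -> exists k, f k = (o, i)) ->
  realizes 1 #|K| (fun v o => \sum_i A o i * v i).
Proof.
move=> Af; pose W := \matrix_(o, i) A o i.
exists (NCons (Dense id W 0) (NNil R q 1)); split => //=.
- rewrite addn0 [X in (_ + X)%N]nonzero_eq0 ?addn0; last by move=> i; rewrite mxE.
  by apply: (@nonzero_le_card _ _ _ f); case=> o i /=; rewrite mxE; exact: Af.
- by move=> x o; rewrite !mxE addr0; apply: eq_bigr => i _; rewrite mxE.
Qed.

(** Networks grow backwards from the output, because the last layer is the one without
    activation. *)
Lemma realizes_cons n n' q d w (K : finType) (f : K -> 'I_n * 'I_n')
    (G : ('I_n -> R) -> 'I_q -> R) (A : 'I_n -> 'I_n' -> R) (b : 'I_n -> R) :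
  (forall i j, A i j != 0 -> exists k, f k = (i, j)) ->
  realizes d w G ->
  realizes d.+1 (#|K| + n + w)
    (fun v => G (fun i => relu (\sum_j A i j * v j + b i))).
Proof.
move=> Af [N [Nr Nd Nw NE]]; pose W := \matrix_(i, j) A i j.
exists (NCons (Dense (@relu R) W (\col_i b i)) N); split => /=.
- by rewrite (relu_fully_connected_cons Nr).
- by rewrite Nd.
- apply: leq_add => //; apply: leq_add.
    by apply: (@nonzero_le_card _ _ _ f); case=> o i /=; rewrite mxE; exact: Af.
  by apply: leq_trans (max_card _) _; rewrite card_prod !card_ord muln1.
- move=> x o; rewrite NE; congr (G _ o); apply/funext => i.
  by rewrite !mxE; congr (relu (_ + _)); apply: eq_bigr => j _; rewrite mxE.
Qed.

(** The inputs are registers named by an arbitrary finite type; [enum_rank] hides their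
    numbering. *)
Definition srealizes (S : finType) q d w (G : (S -> R) -> 'I_q -> R) :=
  realizes d w (fun v : 'I_#|S| -> R => G (fun s => v (enum_rank s))).

Lemma sum_enum_val (S : finType) (F : S -> R) (v : 'I_#|S| -> R) :
  \sum_j F (enum_val j) * v j = \sum_s F s * v (enum_rank s).
Proof.
rewrite (reindex (@enum_rank S)) /=; last first.
  by exists enum_val => s _; rewrite ?enum_rankK ?enum_valK.
by apply: eq_bigr => s _; rewrite enum_rankK.
Qed.

Lemma srealizes_output (S K : finType) q (f : K -> 'I_q * S) (A : 'I_q -> S -> R) :
  (forall o s, A o s != 0 -> exists k, f k = (o, s)) ->
  srealizes 1 #|K| (fun st o => \sum_s A o s * st s).
Proof.
move=> Af; have := @realizes_output _ q K (fun k => ((f k).1, enum_rank (f k).2))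
  (fun a i => A a (enum_val i)).
case=> [a i /Af[k fk]|N [N1 N2 N3 N4]].
  by exists k; rewrite fk enum_valK.
by exists N; split => // x o; rewrite N4 sum_enum_val.
Qed.

Lemma srealizes_cons (S S' K : finType) q d w (f : K -> S * S')
    (G : (S -> R) -> 'I_q -> R) (A : S -> S' -> R) (b : S -> R) :
  (forall s t, A s t != 0 -> exists k, f k = (s, t)) ->
  srealizes d w G ->
  srealizes d.+1 (#|K| + #|S| + w)
    (fun st => G (fun s => relu (\sum_t A s t * st t + b s))).
Proof.
move=> Af GN; have := @realizes_cons #|S| #|S'| q d w K
  (fun k => (enum_rank (f k).1, enum_rank (f k).2)) _
  (fun i j => A (enum_val i) (enum_val j)) (fun i => b (enum_val i)) _ GN.
case=> [i j /Af[k fk]|N [N1 N2 N3 N4]].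
  by exists k; rewrite fk !enum_valK.
exists N; split => // x o; rewrite N4; congr (G _ o); apply/funext => s.
by rewrite sum_enum_val enum_rankK.
Qed.

Lemma realizes_scons (S K : finType) p q d w (f : K -> S * 'I_p)
    (G : (S -> R) -> 'I_q -> R) (A : S -> 'I_p -> R) (b : S -> R) :
  (forall s t, A s t != 0 -> exists k, f k = (s, t)) ->
  srealizes d w G ->
  realizes d.+1 (#|K| + #|S| + w)
    (fun st => G (fun s => relu (\sum_t A s t * st t + b s))).
Proof.
move=> Af GN; have := @realizes_cons #|S| p q d w K
  (fun k => (enum_rank (f k).1, (f k).2)) _
  (fun i j => A (enum_val i) j) (fun i => b (enum_val i)) _ GN.
case=> [i j /Af[k fk]|N [N1 N2 N3 N4]].
  by exists k; rewrite fk !enum_valK.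
exists N; split => // x o; rewrite N4; congr (G _ o); apply/funext => s.
by rewrite enum_rankK.
Qed.

End StateNetworks.

Section Programs.
Context {R : realType}.

(** The coefficients are existential so that a layer can be checked by closure rules, without
    writing its matrix. *)
Definition affine1 (S : finType) (f : (S -> R) -> R) :=
  exists a b, forall st, f st = \sum_t a t * st t + b.

Lemma affine1_cst (S : finType) (c : R) : affine1 (fun _ : S -> R => c).
Proof.
exists (fun _ => 0), c => st; rewrite big1 ?add0r// => t _; exact: mul0r.
Qed.

Lemma affine1_proj (S : finType) (s : S) : affine1 (fun st => st s).
Proof.
exists (fun t => (t == s)%:R), 0 => st; rewrite addr0 (bigD1 s)//= eqxx mul1r.
by rewrite big1 ?addr0// => t /negbTE ->; rewrite mul0r.
Qed.

Lemma affine1D (S : finType) (f g : (S -> R) -> R) :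
  affine1 f -> affine1 g -> affine1 (fun st => f st + g st).
Proof.
move=> [a [b fE]] [a' [b' gE]]; exists (fun t => a t + a' t), (b + b') => st.
rewrite fE gE addrACA -big_split; congr (_ + _); apply: eq_bigr => t _.
by rewrite mulrDl.
Qed.

Lemma affine1Z (S : finType) k (f : (S -> R) -> R) :
  affine1 f -> affine1 (fun st => k * f st).
Proof.
move=> [a [b fE]]; exists (fun t => k * a t), (k * b) => st.
rewrite fE mulrDr big_distrr /=; congr (_ + _); apply: eq_bigr => t _.
by rewrite mulrA.
Qed.

Lemma affine1N (S : finType) (f : (S -> R) -> R) :
  affine1 f -> affine1 (fun st => - f st).
Proof.
move=> /(affine1Z (-1))[a [b fE]]; exists a, b => st.
by rewrite -fE mulN1r.
Qed.

Lemma affine1Zr (S : finType) k (f : (S -> R) -> R) :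
  affine1 f -> affine1 (fun st => f st * k).
Proof.
by move=> /(affine1Z k)[a [b fE]]; exists a, b => st; rewrite -fE mulrC.
Qed.

(** The copies do not communicate: only the diagonal blocks of the weight matrix are nonzero, so the
    cost is linear and not quadratic in [#|I|]. *)
Lemma srealizes_block (I S S' : finType) q d w (G : (I * S -> R) -> 'I_q -> R)
    (L : I -> (S' -> R) -> S -> R) :
  (forall i s, affine1 (L i ^~ s)) ->
  srealizes d w G ->
  srealizes d.+1 (#|I| * (#|S| * #|S'| + #|S|) + w)
   (fun st : I * S' -> R =>
     G (fun x => relu (L x.1 (fun t => st (x.1, t)) x.2))).
Proof.
move=> aL GN.
have /boolp.choice[A A_] (x : I * S) : exists ab : (S' -> R) * R, forall st,
    L x.1 st x.2 = \sum_t ab.1 t * st t + ab.2.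
  by have [a [b ab]] := aL x.1 x.2; exists (a, b).
have := @srealizes_cons R (I * S)%type (I * S')%type (I * (S * S'))%type q d w
  (fun k => ((k.1, k.2.1), (k.1, k.2.2))) G
  (fun x y => if x.1 == y.1 then (A x).1 y.2 else 0) (fun x => (A x).2).
have -> : (#|{: I * (S * S')}| + #|{: I * S}| + w =
           #|I| * (#|S| * #|S'| + #|S|) + w)%N.
  by rewrite !card_prod mulnDr.
case/(_ _ GN)=> [[i s] [j t] /=|N [N1 N2 N3 N4]].
  by have [->|_] := eqVneq i j; rewrite ?eqxx// => _; exists (j, (s, t)).
exists N; split => // x a; rewrite N4; congr (G _ a); apply/funext => -[i s].
rewrite A_ /=; congr (relu (_ + _)).
rewrite (eq_bigr (fun t => (if i == t.1 then (A (i, s)).1 t.2 else 0) *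
   x (enum_rank (t.1, t.2)) 0)); last by case.
rewrite -(pair_bigA _ (fun j t => (if i == j then (A (i, s)).1 t else 0) *
   x (enum_rank (j, t)) 0)) /= (bigD1 i)//= eqxx [X in _ + X]big1 ?addr0//.
move=> j /negbTE ji; rewrite big1// => t _; rewrite eq_sym ji; exact: mul0r.
Qed.

(* prog d P: P is a block of d ReLU layers on the state space T; I copies of
   it, running in parallel, can be put in front of any network. *)
Definition prog (T : finType) d (P : (T -> R) -> T -> R) :=
  forall (I : finType) q d' w (G : (I * T -> R) -> 'I_q -> R),
  srealizes d' w G ->
  srealizes (d + d') (d * (#|I| * (#|T| * #|T| + #|T|)) + w)
   (fun st : I * T -> R => G (fun x => P (fun t => st (x.1, t)) x.2)).

Lemma prog_layer (T : finType) (L : (T -> R) -> T -> R) :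
  (forall t, affine1 (L ^~ t)) -> prog 1 (fun st t => relu (L st t)).
Proof.
move=> aL I q d w G GN; rewrite add1n mul1n.
exact: (@srealizes_block I T T q d w G (fun=> L)).
Qed.

Lemma prog_id (T : finType) : prog 0 (fun st : T -> R => st).
Proof.
move=> I q d w G GN; rewrite mul0n !add0n.
congr (srealizes _ _): GN; apply/funext => st; congr (G _).
by apply/funext => -[].
Qed.

Lemma prog_comp (T : finType) d1 d2 (P1 P2 : (T -> R) -> T -> R) :
  prog d1 P1 -> prog d2 P2 -> prog (d1 + d2) (fun st => P2 (P1 st)).
Proof.
move=> p1 p2 I q d w G GN; have := p1 I q _ _ _ (p2 I q _ _ _ GN).
by rewrite !addnA -mulnDl.
Qed.

End Programs.

(** * Approximate products *)

Section ApproximateProduct.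
Context {R : realType}.
Implicit Types (a b x y : R).

(** A single [relu] suffices: on [0, 1] the summand [x] is nonnegative, hence crosses a ReLU layer
    unchanged. *)
Definition tent (x : R) : R := 2 * x - 4 * relu (x - 2^-1).

Lemma relu_id x : 0 <= x -> relu x = x.
Proof. by move=> x0; rewrite /relu; apply/max_idPl. Qed.

Lemma relu_neg x : x <= 0 -> relu x = 0.
Proof. by move=> x0; rewrite /relu; apply/max_idPr. Qed.

Lemma relu_ge0 x : 0 <= relu x.
Proof. by rewrite /relu le_max lexx orbT. Qed.

Lemma reluP x : (x <= 0 /\ relu x = 0) \/ (0 <= x /\ relu x = x).
Proof.
case/orP: (le_total x 0) => h; [left|right]; split => //.
  exact: relu_neg.
exact: relu_id.
Qed.

Lemma tent_itv x : 0 <= x <= 1 -> 0 <= tent x <= 1.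
Proof. by move=> /andP[x0 x1]; rewrite /tent; case: (reluP (x - 2^-1)) => -[? ->]; lra. Qed.

Lemma iter_tent_itv n x : 0 <= x <= 1 -> 0 <= iter n tent x <= 1.
Proof. by move=> x01; elim: n => //= n; exact: tent_itv. Qed.

(* The functional equation e(x) = (tent x + e(tent x)) / 4 of e(x) = x - x^2,
   whose iteration approximates x^2 by sums of iterated tents. *)
Lemma tent_square x : x - x ^+ 2 = (tent x + (tent x - tent x ^+ 2)) / 4.
Proof. by rewrite /tent; case: (reluP (x - 2^-1)) => -[_ ->]; field. Qed.

(** On [0, 1] this is the piecewise linear interpolant of the square at the multiples of 2^-n. *)
Definition sq n x := x - \sum_(k < n) iter k.+1 tent x / 4 ^+ k.+1.

Lemma sqS n x : sq n.+1 x = sq n x - iter n.+1 tent x / 4 ^+ n.+1.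
Proof. by rewrite /sq big_ord_recr /= opprD addrA. Qed.

Lemma sqE n x : sq n x - x ^+ 2 = (iter n tent x - iter n tent x ^+ 2) / 4 ^+ n.
Proof.
elim: n => [|n IHn]; first by rewrite /sq big_ord0 expr0 /=; field.
have -> : sq n.+1 x - x ^+ 2 = sq n x - x ^+ 2 - iter n.+1 tent x / 4 ^+ n.+1.
  by rewrite sqS; ring.
rewrite IHn tent_square iterS (exprS 4); field.
by rewrite expf_neq0 ?pnatr_eq0.
Qed.

Lemma sq_bounds n x : 0 <= x <= 1 -> 0 <= sq n x - x ^+ 2 <= (4 ^+ n)^-1.
Proof.
move=> /(iter_tent_itv n); rewrite sqE; set t := iter _ _ _ => t01.
have p4 : 0 <= (4 ^+ n)^-1 :> R by rewrite invr_ge0 exprn_ge0.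
have /andP[e0 e1] : 0 <= t - t ^+ 2 <= 1 by apply/andP; split; nra.
by rewrite mulr_ge0//= ler_piMl.
Qed.

Lemma sq_ge0 n x : 0 <= x <= 1 -> 0 <= sq n x.
Proof.
by move=> /(sq_bounds n) /andP[+ _]; rewrite subr_ge0; apply: le_trans; exact: sqr_ge0.
Qed.

Lemma sq_le n x : 0 <= x <= 1 -> sq n x <= x.
Proof.
move=> x01; rewrite /sq gerBl; apply: sumr_ge0 => k _.
by rewrite divr_ge0 ?exprn_ge0//; have /andP[] := iter_tent_itv k.+1 x01.
Qed.

(** Polarization a b = ((a + b) / 2)^2 - ((a - b) / 2)^2, the halves keeping both arguments in
    [0, 1]. Both squares are overestimated by at most 4^-n, so their difference is off by no more
    than that, and [relu] keeps the result nonnegative. *)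
Definition mulapp n a b := relu (sq n ((a + b) / 2) - sq n (`|a - b| / 2)).

Lemma half_itv a b : 0 <= a <= 1 -> 0 <= b <= 1 ->
  0 <= (a + b) / 2 <= 1 /\ 0 <= `|a - b| / 2 <= 1.
Proof. by move=> ? ?; split; [|have [] := ler0P (a - b); have [] := ger0P (a - b) => *]; lra. Qed.

Lemma mulapp_itv n a b : 0 <= a <= 1 -> 0 <= b <= 1 -> 0 <= mulapp n a b <= 1.
Proof.
move=> a01 b01; have [u v] := half_itv a01 b01.
rewrite /mulapp relu_ge0 /=.
have := sq_le n u; have := sq_ge0 n v.
by case: (reluP (sq n ((a + b) / 2) - sq n (`|a - b| / 2))) => -[_ ->]; lra.
Qed.

Lemma mulapp_err n a b : 0 <= a <= 1 -> 0 <= b <= 1 ->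
  `|mulapp n a b - a * b| <= (4 ^+ n)^-1.
Proof.
move=> a01 b01; have [u v] := half_itv a01 b01.
have /andP[u0 u1] := sq_bounds n u; have /andP[v0 v1] := sq_bounds n v.
have E : a * b = ((a + b) / 2) ^+ 2 - (`|a - b| / 2) ^+ 2.
  by rewrite !expr_div_n real_normK ?num_real//; field.
have ab0 : 0 <= a * b by rewrite mulr_ge0//; lra.
rewrite ler_norml /mulapp.
move: E ab0 u0 u1 v0 v1; set A := sq _ _; set B := sq n (`|_| / 2).
set p := a * b; set c := _^-1; set U := _ ^+ 2; set V := _ ^+ 2 => E p0 *.
by case: (reluP (A - B)) => -[? ->]; lra.
Qed.

(** The half sum and the absolute half difference coincide, so the two approximate squares cancel
    exactly. This exactness is what makes distant cells contribute nothing. *)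
Lemma mulapp0l n b : 0 <= b -> mulapp n 0 b = 0.
Proof.
move=> b0; rewrite /mulapp add0r sub0r normrN ger0_norm// subrr.
by rewrite relu_id.
Qed.

Lemma mulapp0r n a : 0 <= a -> mulapp n a 0 = 0.
Proof.
move=> a0; rewrite /mulapp addr0 subr0 ger0_norm// subrr.
by rewrite relu_id.
Qed.

Definition prodapp n (I : Type) (y : I -> R) l a :=
  foldl (fun a j => mulapp n a (y j)) a l.

Section Prodapp.
Context (n : nat) (I : eqType) (y : I -> R) (y01 : forall j, 0 <= y j <= 1).

Lemma prod_itv l : 0 <= \prod_(j <- l) y j <= 1.
Proof.
elim: l => [|j l IHl]; first by rewrite big_nil ler01 lexx.
by rewrite big_cons; have := y01 j; nra.
Qed.

(** Factors in [0, 1] do not amplify the errors already made, which therefore add up. *)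
Lemma prodapp_err l a : 0 <= a <= 1 ->
  `|prodapp n y l a - a * \prod_(j <- l) y j| <= (size l)%:R * (4 ^+ n)^-1.
Proof.
elim: l a => [|j l IHl] a a01.
  by rewrite /= big_nil mulr1 subrr normr0 mul0r.
rewrite big_cons /=; have := IHl _ (mulapp_itv n a01 (y01 j)).
have := mulapp_err n a01 (y01 j); have := prod_itv l.
set P := \prod_(_ <- _) _ => P01 E1 E2.
apply: le_trans (ler_distD (mulapp n a (y j) * P) _ _) _.
rewrite -natr1 mulrDl mul1r; apply: lerD; first exact: E2.
rewrite mulrA -mulrBl normrM (ger0_norm (x := P)); last by lra.
by apply: le_trans E1; rewrite ler_piMr//; lra.
Qed.

Lemma prodapp0 l : prodapp n y l 0 = 0.
Proof. by elim: l => //= j l IHl; rewrite mulapp0l//; have := y01 j; lra. Qed.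

Lemma prodapp_eq0 l a j : 0 <= a <= 1 -> j \in l -> y j = 0 ->
  prodapp n y l a = 0.
Proof.
elim: l a => //= i l IHl a a01; rewrite inE => /predU1P[->|jl] yj.
  by rewrite yj mulapp0r ?prodapp0//; lra.
exact: IHl (mulapp_itv n a01 (y01 i)) jl yj.
Qed.

End Prodapp.
End ApproximateProduct.

Section ProductNetwork.
Context {R : realType} (M : nat).

(* Registers: two squaring units (for the half sum and the half difference of
   the factors), each holding the tent iterate t (None), relu (t - 1/2)
   (Some true) and the approximate square (Some false); the accumulated
   product; the factors. *)
Notation reg := ((bool * option bool) + option 'I_M)%type.
Implicit Types (st : reg -> R) (j : 'I_M).

(** The half difference is loaded with both signs, the second in the register [Some true], which is
    still free. After the [relu] the two add up to |a - b| / 2, which [load_squares] forms. That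
    layer also puts this number in [Some false], as [sq 0] is the identity. *)
Definition load_sums j st (t : reg) : R :=
  match t with
  | inl (true, None) => (st (inr None) + st (inr (Some j))) / 2
  | inl (false, None) => (st (inr None) - st (inr (Some j))) / 2
  | inl (false, Some true) => (st (inr (Some j)) - st (inr None)) / 2
  | inl _ => 0
  | inr t' => st (inr t')
  end.

Definition load_squares st (t : reg) : R :=
  match t with
  | inl (b, Some true) => st (inl (b, None)) + st (inl (b, Some true)) - 2^-1
  | inl (b, _) => st (inl (b, None)) + st (inl (b, Some true))
  | inr t' => st (inr t')
  end.

Definition square_step k st (t : reg) : R :=
  match t with
  | inl (b, i) =>
      let x := 2 * st (inl (b, None)) - 4 * st (inl (b, Some true)) in
      match i with
      | None => x
      | Some true => x - 2^-1
      | Some false => st (inl (b, Some false)) - x / 4 ^+ k.+1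
      end
  | inr t' => st (inr t')
  end.

Definition store_product st (t : reg) : R :=
  match t with
  | inl _ => 0
  | inr None => st (inl (true, Some false)) - st (inl (false, Some false))
  | inr t' => st (inr t')
  end.

Definition relu_layer (S T : Type) (L : (S -> R) -> T -> R) (v : S -> R) t := relu (L v t).

Fixpoint square_steps n st :=
  if n is m.+1 then relu_layer (square_step m) (square_steps m st) else st.

Definition mul_prog n j st := relu_layer store_product
  (square_steps n (relu_layer load_squares (relu_layer (load_sums j) st))).

Fixpoint prod_prog n l st :=
  if l is j :: l' then prod_prog n l' (mul_prog n j st) else st.

Ltac affine := rewrite /=; repeat first [exact: affine1_cst | exact: affine1_proj |
  apply: affine1D | apply: affine1N | apply: affine1Z | apply: affine1Zr].

Lemma prog_square_steps n : prog n (square_steps n).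
Proof.
elim: n => [|n IHn]; first exact: prog_id.
have p1 : prog 1 (relu_layer (square_step n)).
  by apply: prog_layer => -[[b [[]|]]|t]; affine.
by have := prog_comp IHn p1; rewrite addn1.
Qed.

Lemma prog_mul n j : prog (n + 3) (mul_prog n j).
Proof.
have p1 : prog 1 (relu_layer (load_sums j)).
  by apply: prog_layer => -[[[] [[]|]]|t]; affine.
have p2 : prog 1 (relu_layer load_squares).
  by apply: prog_layer => -[[b [[]|]]|t]; affine.
have p3 : prog 1 (relu_layer store_product).
  by apply: prog_layer => -[[b i]|[t|]]; affine.
have := prog_comp (prog_comp (prog_comp p1 p2) (prog_square_steps n)) p3.
by rewrite (_ : 1 + 1 + n + 1 = n + 3)%N//; lia.
Qed.

Lemma prog_prod n l : prog (size l * (n + 3)) (prod_prog n l).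
Proof.
elim: l => [|j l IHl]; first exact: prog_id.
by rewrite mulSn; exact: (prog_comp (prog_mul n j) IHl).
Qed.

Definition square_state (u : bool -> R) n a (y : 'I_M -> R) (t : reg) : R :=
  match t with
  | inl (b, None) => iter n tent (u b)
  | inl (b, Some true) => relu (iter n tent (u b) - 2^-1)
  | inl (b, Some false) => sq n (u b)
  | inr None => a
  | inr (Some j) => y j
  end.

(** All quantities of the invariant are nonnegative, so the [relu] of a layer changes only the
    register of t - 1/2, where it is wanted. *)
Lemma square_steps_state u n a y :
  (forall b, 0 <= u b <= 1) -> 0 <= a -> (forall j, 0 <= y j) ->
  square_steps n (square_state u 0 a y) = square_state u n a y.
Proof.
move=> u01 a0 y0; elim: n => //= n ->; apply/funext => -[[b i]|[j|]];
  rewrite /relu_layer; [|exact: (relu_id (y0 j))|exact: (relu_id a0)].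
have /andP[t0 _] := iter_tent_itv n.+1 (u01 b).
have E : 2 * iter n tent (u b) - 4 * relu (iter n tent (u b) - 2^-1) =
  iter n.+1 tent (u b) by [].
case: i => [[]|]; rewrite [square_step _ _ _]/= E //.
- by rewrite -sqS relu_id// sq_ge0.
- by rewrite relu_id.
Qed.

Lemma mul_progE n j st a y :
  st (inr None) = a -> (forall j', st (inr (Some j')) = y j') ->
  0 <= a <= 1 -> (forall j', 0 <= y j' <= 1) ->
  mul_prog n j st (inr None) = mulapp n a (y j) /\
  forall j', mul_prog n j st (inr (Some j')) = y j'.
Proof.
move=> sta sty a01 y01.
pose u (b : bool) := if b then (a + y j) / 2 else `|a - y j| / 2.
have u01 b : 0 <= u b <= 1.
  by have [] := half_itv a01 (y01 j); rewrite /u; case: b.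
have a0 : 0 <= a by case/andP: a01.
have y0 i : 0 <= y i by case/andP: (y01 i).
have -> : mul_prog n j st = relu_layer store_product (square_state u n a y).
  rewrite /mul_prog -square_steps_state//; congr (relu_layer _ (square_steps n _)).
  apply/funext => -[[b i]|[i|]]; rewrite /relu_layer; first last.
  - by rewrite /= sta !(relu_id a0).
  - by rewrite /= sty !relu_id ?y0.
  have uE : relu (load_sums j st (inl (b, None))) +
            relu (load_sums j st (inl (b, Some true))) = u b.
    case: b; rewrite /= sta sty /u.
      by rewrite relu_id ?(relu_id (lexx 0)) ?addr0// divr_ge0// addr_ge0.
    case: (reluP ((a - y j) / 2)) => -[? ->]; case: (reluP ((y j - a) / 2)) => -[? ->];
      case: (ger0P (a - y j)) => ?; lra.
  have /andP[ub0 _] := u01 b.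
  by case: i => [[]|]; rewrite [load_squares _ _]/= uE [RHS]/= // relu_id// /sq big_ord0 subr0.
by split => [|j'] //=; rewrite /relu_layer /= relu_id.
Qed.

Lemma prod_progE n l st y a :
  st (inr None) = a -> (forall j', st (inr (Some j')) = y j') ->
  0 <= a <= 1 -> (forall j', 0 <= y j' <= 1) ->
  prod_prog n l st (inr None) = prodapp n y l a.
Proof.
move=> + + + y01; elim: l st a => //= j l IHl st a sta sty a01.
have [ma my] := mul_progE n j sta sty a01 y01.
exact: (IHl _ _ ma my (mulapp_itv n a01 (y01 j))).
Qed.

(** Truncation to [0, 1], as a difference of two [relu]: it takes one ReLU layer followed by a
    linear map. *)
Definition clip (z : R) : R := relu z - relu (z - 1).

Lemma clip_homo (z z' : R) : z <= z' -> clip z <= clip z'.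
Proof.
rewrite /clip; case: (reluP z) => -[? ->]; case: (reluP z') => -[? ->];
case: (reluP (z - 1)) => -[? ->]; case: (reluP (z' - 1)) => -[? ->]; lra.
Qed.

Lemma clip_itv z : 0 <= clip z <= 1.
Proof.
rewrite /clip; case: (reluP z) => -[? ->];
case: (reluP (z - 1)) => -[? ->]; lra.
Qed.

Lemma clip_id z : 0 <= z <= 1 -> clip z = z.
Proof.
by move=> /andP[z0 z1]; rewrite /clip relu_id// relu_neg ?subr0// subr_le0.
Qed.

Lemma clip0 z : z <= 0 -> clip z = 0.
Proof. by move=> z0; rewrite /clip !relu_neg ?subrr//; lra. Qed.

Lemma clip1 z : 1 <= z -> clip z = 1.
Proof. by move=> z1; rewrite /clip !relu_id; lra. Qed.

(** [c] precedes [q], [I] and [n] because the registers of one copy depend on [M] only. The order of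
    the two clips makes each factor nonnegative, so that it survives later ReLU layers. The 3 extra
    layers truncate the affine inputs, form the factors, and sum the products. *)
Lemma product_network p : exists c : nat, forall q (I : finType) n
    (z : I -> 'I_M -> bool -> ('I_p -> R) -> R) (C : 'I_q -> I -> R),
  (forall i j b, affine1 (z i j b)) ->
  (forall i j x, clip (z i j false x) <= clip (z i j true x)) ->
  realizes (M * (n + 3) + 3) (c * (#|I| * n.+1) + q * #|I|)
    (fun x a => \sum_i C a i *
      prodapp n (fun j => clip (z i j true x) - clip (z i j false x))
        (enum 'I_M) 1).
Proof.
(* For each factor, the first boolean selects one of the two clips and the second one of the two
   [relu] of that clip. *)
pose S0 := ('I_M * (bool * bool))%type : finType.
pose cT := (2 * 3 + M.+1)%N; pose c0 := (M * (2 * 2))%N.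
pose cp := (cT * cT + cT)%N.
exists (M * cp * 3 + cT * c0 + cT + c0 * p + c0)%N => q I n z C az zle.
have G1 : @srealizes R (I * reg)%type q 1 (q * #|I|)
    (fun v a => \sum_i C a i * v (i, inr None)).
  have := @srealizes_output R (I * reg)%type ('I_q * I)%type q
    (fun k => (k.1, (k.2, inr None)))
    (fun a x => if x.2 == inr None then C a x.1 else 0).
  rewrite card_prod card_ord; case=> [a [i t] /=|N [N1 N2 N3 N4]].
    by have [->|_] := eqVneq t (inr None); rewrite ?eqxx// => _; exists (a, i).
  exists N; split => // x a; rewrite N4.
  rewrite (eq_bigr (fun k => (if k.2 == inr None then C a k.1 else 0) *
    x (enum_rank (k.1, k.2)) 0)); last by case.
  rewrite -(pair_bigA _ (fun i t => (if t == inr None then C a i else 0) *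
    x (enum_rank (i, t)) 0)) /=; apply: eq_bigr => i _.
  rewrite (bigD1 (inr None))//= [X in _ + X]big1 ?addr0//.
  by move=> t /negbTE ->; rewrite mul0r.
have G2 := @prog_prod n (enum 'I_M) I q _ _ _ G1.
pose L (_ : I) (v : S0 -> R) (t : reg) : R :=
  match t with
  | inl _ => 0
  | inr None => 1
  | inr (Some j) => (v (j, (true, false)) - v (j, (true, true))) -
                    (v (j, (false, false)) - v (j, (false, true)))
  end.
have aL i t : affine1 (L i ^~ t).
  by case: t => [t|[j|]]; affine.
have G3 := srealizes_block aL G2.
have /boolp.choice[A A_] (x : I * S0) : exists ab : ('I_p -> R) * R, forall v,
    z x.1 x.2.1 x.2.2.1 v - x.2.2.2%:R = \sum_t ab.1 t * v t + ab.2.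
  have [a [b ab]] := affine1D (az x.1 x.2.1 x.2.2.1) (affine1_cst _ (- x.2.2.2%:R)).
  by exists (a, b).
have := @realizes_scons R (I * S0)%type (I * S0 * 'I_p)%type p q _ _ id _
  (fun x => (A x).1) (fun x => (A x).2) _ G3.
case=> [s t _|N [N1 N2 N3 N4]]; first by exists (s, t).
exists N; split => //.
- by rewrite N2 size_enum_ord; lia.
- apply: leq_trans N3 _; rewrite size_enum_ord.
  rewrite !(card_prod, card_sum, card_option, card_bool, card_ord) -/cT -/c0 -/cp.
  move: cT c0 cp => ct c0' cp'; clear.
  set e := #|I|; rewrite !addnA leq_add2r.
  rewrite (_ : _ + _ = e * (c0' * p + c0' + (ct * c0' + ct) + M * (n + 3) * cp'))%N; last by ring.
  rewrite mulnCA leq_mul2l; apply/orP; right.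
  have : (M * (n + 3) * cp' <= M * cp' * 3 * n.+1)%N.
    by rewrite mulnAC -[leqRHS]mulnA leq_mul2l; apply/orP; right; lia.
  by nia.
- move=> x a; rewrite N4; apply: eq_bigr => i _; congr (_ * _).
  apply: prod_progE.
  + by rewrite /= relu_id.
  + move=> j; rewrite /= -!A_ /= !subr0 relu_id //.
    by rewrite subr_ge0; exact: zle.
  + by rewrite ler01 lexx.
  + move=> j; have := zle i j (fun i => x i 0).
    have := clip_itv (z i j true (fun i => x i 0)).
    by have := clip_itv (z i j false (fun i => x i 0)); lra.
Qed.

End ProductNetwork.

(** * Uniform Taylor polynomials *)

Section UniformBounds.
Context {R : realType} {V : normedModType R}.

(** Compactness is applied with the filter at +oo: a single large parameter serves as the bound and
    as the inverse of the radius. *)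
Lemma compact_uniform (Theta : set V) (P : R -> V -> V -> Prop) :
  compact Theta ->
  (forall x, Theta x -> exists d M : R, 0 < d /\
     forall M' x' y, M <= M' -> `|x - x'| <= d -> `|x - y| <= d -> P M' x' y) ->
  exists2 d : R, 0 < d & exists2 M : R, 0 < M &
    forall x y, Theta x -> `|x - y| <= d -> P M x y.
Proof.
move=> /compact_near_coveringP cT TP.
have := cT R (pinfty_nbhs R)
  (fun M x => forall y, `|x - y| <= M^-1 -> P M x y).
case=> [x Tx|M0 [M0r H]].
  have [d [M [d0 H]]] := TP x Tx.
  have d20 : 0 < d / 2 by rewrite divr_gt0.
  exists (ball x (d / 2), [set M' | Num.max M (d / 2)^-1 < M']) => /=.
    split; first exact: nbhsx_ballx.
    exists (Num.max M (d / 2)^-1); split => //; exact: num_real.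
  move=> [x' M'] /= [xx' M'M] y x'y.
  move: M'M; rewrite gt_max => /andP[MM' dM'].
  have M'0 : 0 < M' by apply: lt_trans dM'; rewrite invr_gt0.
  have xx'd : `|x - x'| <= d / 2 by move: xx'; rewrite -ball_normE => /ltW.
  apply: H; first exact: ltW.
  - by apply: le_trans xx'd _; lra.
  - apply: le_trans (ler_distD x' _ _) _; rewrite [d]splitr lerD//.
    by apply: le_trans x'y _; rewrite -[leRHS]invrK lef_pV2 ?ltW// posrE invr_gt0.
pose M := Num.max M0 0 + 1.
have M0' : 0 < M by rewrite ltr_wpDl// le_max lexx orbT.
exists M^-1; first by rewrite invr_gt0.
exists M => // x y Tx xy; apply: (H M) => //.
by rewrite ltr_pwDr// le_max lexx.
Qed.

Context {W : normedModType R}.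

(** [y] ranges over a whole neighbourhood of [Theta], because Taylor expansions follow segments that
    may leave [Theta]. *)
Lemma compact_locally_bounded (Theta U : set V) (f : V -> W) :
  compact Theta -> open U -> Theta `<=` U ->
  (forall x, U x -> {for x, continuous f}) ->
  exists2 d : R, 0 < d & exists2 M : R, 0 < M &
    forall x y, Theta x -> `|x - y| <= d -> U y /\ `|f y| <= M.
Proof.
move=> cT oU TU cf; apply: (compact_uniform cT (P := fun M x y => U y /\ `|f y| <= M)).
move=> x /TU Ux; have /cvgrPdist_lt/(_ 1 ltr01) fx := cf x Ux.
have : \forall y \near x, U y by exact: open_nbhs_nbhs.
move=> Uy; have : \forall y \near x, U y /\ `|f x - f y| < 1 by near=> y; split; near: y.
move=> /nbhs_ballP[d /= d0 xd]; exists (d / 2), (`|f x| + 1).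
split=> [|M' x' y MM' _ xy]; first by rewrite divr_gt0.
have [|Uy' fxy] := xd y.
  by rewrite -ball_normE /=; apply: le_lt_trans xy _; rewrite gtr_pMr// invf_lt1// ltr1n.
split=> //; apply: le_trans MM'.
rewrite -[f y](subrK (f x)) addrC; apply: le_trans (ler_normD _ _) _.
by rewrite lerD2l distrC ltW.
Unshelve. all: by end_near. Qed.

Lemma compact_uniform_continuity (Theta U : set V) (f : V -> W) (e : R) :
  compact Theta -> Theta `<=` U -> 0 < e ->
  (forall x, U x -> {for x, continuous f}) ->
  exists2 d : R, 0 < d &
    forall x y, Theta x -> `|x - y| <= d -> `|f x - f y| <= e.
Proof.
move=> cT TU e0 cf.
suff [d d0 [M _ H]] : exists2 d : R, 0 < d & exists2 M : R, 0 < M &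
  forall x y, Theta x -> `|x - y| <= d -> `|f x - f y| <= e by exists d.
apply: (compact_uniform cT (P := fun _ x y => `|f x - f y| <= e)).
move=> x /TU Ux; have e20 : 0 < e / 2 by rewrite divr_gt0.
have /cvgrPdist_lt/(_ _ e20) := cf x Ux.
move=> /nbhs_ballP[d /= d0 xd]; exists (d / 2), 0.
split=> [|M' x' y _ xx' xy]; first by rewrite divr_gt0.
have dd : d / 2 < d by lra.
apply: le_trans (ler_distD (f x) _ _) _; rewrite [e]splitr lerD//.
  by rewrite distrC ltW//; apply: xd; rewrite -ball_normE /=; exact: le_lt_trans xx' dd.
by rewrite ltW//; apply: xd; rewrite -ball_normE /=; exact: le_lt_trans xy dd.
Qed.

Lemma Cr_continuous r (U : set V) (f : V -> W) : Cr r U f ->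
  forall x, U x -> {for x, continuous f}.
Proof.
case: r => //= r [df [fdf _]] x Ux; have fx := fdf x Ux.
exact: differentiable_continuous.
Qed.

(** Testing with functionals of norm at most 1 reduces Taylor's formula in [W] to real functions of
    one variable. *)
Lemma is_derive_line (l : W -> R) (f : V -> W) (df : V -> W) (x h : V) (t : R) :
  linear (l : W -> R^o) -> (forall w, `|l w| <= `|w|) ->
  is_diff (x + t *: h) f df ->
  is_derive t 1 (fun t => l (f (x + t *: h))) (l (df h)).
Proof.
move=> ll lb fdf.
pose lin := GRing.isLinear.Build R W R^o *:%R l ll.
pose L : {linear W -> R^o} := HB.pack l lin.
have cL : continuous L.
  move=> w; apply/cvgrPdist_lt => e e0; apply/nbhs_ballP; exists e => //= w'.
  rewrite -ball_normE /= => ww'.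
  have -> : L w - L w' = L (w - w') by rewrite linearB.
  exact: le_lt_trans (lb _) ww'.
have dL : is_diff (f (x + t *: h)) L L.
  by apply: DiffDef; [exact: linear_differentiable|exact: diff_lin].
have dp : is_diff t (fun t : R^o => x + t *: h) (fun t : R^o => t *: h).
  have := is_diffD (is_diff_cst x t) (is_diff_scalel t h).
  by move/is_diff_eq; apply; apply/funext => k; rewrite !fctE add0r.
have [dc dcE] := is_diff_comp (is_diff_comp dp fdf) dL.
apply: DeriveDef; first exact: (@diff_derivable _ _ _ _ t 1 dc).
by rewrite [LHS](@deriveE _ _ _ _ t 1 dc) dcE /= scale1r.
Qed.

End UniformBounds.

Section Taylor.
Context {R : realType} (p : nat).
Notation V := 'cV[R]_p.

(* Polynomials of degree < r in h; c [:: i1; ...; ik] is the coefficient of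
   h_i1 * ... * h_ik. *)
Fixpoint mpol r (c : seq 'I_p -> R) (h : V) : R :=
  if r is r'.+1 then
    c [::] + \sum_i h i 0 * mpol r' (fun al => c (i :: al)) h
  else 0.

Lemma is_derive_sumr n (F : 'I_n -> R -> R) (dF : 'I_n -> R) (t : R) :
  (forall i, is_derive t 1 (F i) (dF i)) ->
  is_derive t 1 (fun u => \sum_i F i u) (\sum_i dF i).
Proof.
move=> H; rewrite (_ : (fun _ => _) = \sum_i F i); first exact: is_derive_sum.
by apply/funext => u; rewrite fct_sumE.
Qed.

(** Termwise integration along a line: a monomial of degree k, multiplied by t^n, has a primitive of
    degree n + k + 1 in t. The exponent [n] is there for the induction. *)
Lemma is_derive_mpol r n (c : seq 'I_p -> R) (h : V) (t : R) :
  is_derive t 1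
    (fun t => t ^+ n.+1 * mpol r (fun al => c al / (size al + n.+1)%:R) (t *: h))
    (t ^+ n * mpol r c (t *: h)).
Proof.
elim: r n c => [|r IHr] n c /=.
  rewrite mulr0 (_ : (fun _ => _) = cst 0); first exact: is_derive_cst.
  by apply/funext => u; rewrite mulr0.
have -> : (fun u : R => u ^+ n.+1 * (c [::] / (0 + n.+1)%:R + \sum_i (u *: h) i 0 *
    mpol r (fun al => c (i :: al) / ((size al).+1 + n.+1)%:R) (u *: h))) =
  (fun u : R => (c [::] / n.+1%:R) * u ^+ n.+1) +
  (fun u : R => \sum_i h i 0 * (u ^+ n.+2 *
    mpol r (fun al => c (i :: al) / (size al + n.+2)%:R) (u *: h))).
  apply/funext => u; rewrite add0n [RHS]/= mulrDr mulrC big_distrr /=.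
  congr (_ + _); apply: eq_bigr => i _; rewrite mxE (exprSr u n.+1).
  rewrite [in LHS](_ : (fun _ => _) = (fun al => c (i :: al) / (size al + n.+2)%:R)).
    by rewrite !mulrA; congr (_ * _); ring.
  by apply/funext => al; rewrite addSnnS.
rewrite mulrDr big_distrr /=.
have D1 i : is_derive t 1 (fun u : R => h i 0 * (u ^+ n.+2 *
    mpol r (fun al => c (i :: al) / (size al + n.+2)%:R) (u *: h)))
    (t ^+ n * ((t *: h) i 0 * mpol r (fun al => c (i :: al)) (t *: h))).
  apply: (is_derive_eq (is_deriveZ (h i 0) (IHr n.+1 (fun al => c (i :: al))))).
  rewrite mxE (exprSr t n) /GRing.scale /=.
  by ring.
have D0 : is_derive t 1 (fun u : R => c [::] / n.+1%:R * u ^+ n.+1) (t ^+ n * c [::]).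
  have -> : (fun u : R => c [::] / n.+1%:R * u ^+ n.+1) =
            (c [::] / n.+1%:R) \*: (id ^+ n.+1 : R -> R).
    by apply/funext => u; rewrite /= exprfctE.
  apply: (is_derive_eq (is_deriveZ (c [::] / n.+1%:R) (is_deriveX n.+1 (is_derive_id t 1)))).
  by rewrite /GRing.scale /= mulr1 mulrA divfK ?pnatr_eq0// mulrC.
exact: (is_deriveD D0 (is_derive_sumr D1)).
Qed.

Lemma ler_coord (h : V) i : `|h i 0| <= `|h|.
Proof.
rewrite [leRHS]/Num.Def.normr /= mx_normrE; apply/bigmax_geP; right => /=.
by exists (i, 0).
Qed.

Lemma delta_norm_le1 i : `|delta_mx i 0 : V| <= 1.
Proof.
rewrite [leLHS]/Num.Def.normr /= mx_normrE; apply/bigmax_leP; split => // -[j k] _.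
by rewrite mxE /=; case: (_ && _); rewrite ?normr1 ?normr0.
Qed.

(** The constants come before the functional [l] and the point [x]. The induction applies to the
    derivative, a map to [clin V W], tested with g => l (g e_i); these functionals again have norm
    at most 1, since the basis vectors have norm at most 1. *)
Theorem taylor r (W : normedModType R) (f : V -> W) (U Theta : set V) :
  compact Theta -> open U -> Theta `<=` U -> Cr r U f ->
  exists2 d : R, 0 < d & exists2 M : R, 0 < M &
    forall l : W -> R, linear (l : W -> R^o) -> (forall w, `|l w| <= `|w|) ->
    forall x, Theta x -> exists c : seq 'I_p -> R,
      (forall al, `|c al| <= M) /\
      forall h, `|h| <= d -> `|l (f (x + h)) - mpol r c h| <= M * `|h| ^+ r.
Proof.
move=> cT oU TU; elim: r W f => [|r IHr] W f Cf.
  have [d d0 [M M0 H]] := compact_locally_bounded cT oU TU (Cr_continuous Cf).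
  exists d => //; exists M => // l ll lb x Tx; exists (fun=> 0).
  split=> [_|h hd /=]; first by rewrite normr0 ltW.
  rewrite subr0 expr0 mulr1; apply: le_trans (lb _) _.
  have [] // := H x (x + h) Tx.
  by rewrite opprD addNKr normrN.
have [d2 d20 [M2 M20 H2]] := compact_locally_bounded cT oU TU (Cr_continuous Cf).
move: Cf => [df [fdf /IHr[d1 d10 [M1 M10 H1]]]] {IHr}.
exists (Num.min d1 d2); first by rewrite lt_min d10.
(* The terms serve the nonconstant coefficients, the constant one [l (f x)], and the remainder,
   which is a sum over [p] coordinates. *)
pose M := M1 + M2 + p%:R * M1.
exists M; first by rewrite ltr_pwDl ?mulr_ge0 ?addr_gt0// ltW.
move=> l ll lb x Tx.
pose li (i : 'I_p) (g : clin V W) := l (g (delta_mx i 0)).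
have lil (i : 'I_p) : linear (li i : _ -> R^o).
  by move=> a g1 g2; rewrite /li -ll.
have lib (i : 'I_p) g : `|li i g| <= `|g|.
  apply: le_trans (lb _) _; apply: clin_norm_ub; exact: delta_norm_le1.
have /boolp.choice[c H] (i : 'I_p) := H1 (li i) (lil i) (lib i) x Tx.
pose c' (al : seq 'I_p) : R :=
  if al is i :: al' then c i al' / (size al' + 1)%:R else l (f x).
exists c'; split.
  case=> [|i al] /=.
    apply: le_trans (lb _) _; have [|_] := H2 x x Tx.
      by rewrite subrr normr0 ltW.
    move/le_trans; apply; rewrite /M -addrA addrCA lerDl addr_ge0 ?mulr_ge0//; exact: ltW.
  rewrite normrM normfV [X in _ / X]ger0_norm// ler_pdivrMr ?ltr0n ?addn1//.
  have [+ _] := H i => /(_ al) h1; apply: (le_trans h1).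
  apply: (@le_trans _ _ M); first by rewrite /M -addrA lerDl addr_ge0 ?mulr_ge0// ltW.
  by rewrite ler_peMr ?ler1n// addr_ge0 ?mulr_ge0 ?addr_ge0// ltW.
move=> h; rewrite le_min => /andP[hd1 hd2].
(* What is subtracted is the primitive of the polynomials of the partial derivatives, so the
   derivative of [psi] is small by induction and the mean value theorem concludes. *)
pose psi (t : R) := l (f (x + t *: h)) -
  \sum_i h i 0 * (t ^+ 1 * mpol r (fun al => c i al / (size al + 1)%:R) (t *: h)).
pose dpsi (t : R) := l (df (x + t *: h) h) -
  \sum_i h i 0 * (t ^+ 0 * mpol r (c i) (t *: h)).
have th_le (t : R) : 0 <= t <= 1 -> `|t *: h| <= `|h|.
  by move=> /andP[t0 t1]; rewrite normrZ ger0_norm// ler_piMl.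
have dpsiP (t : R) : 0 <= t <= 1 -> is_derive t 1 psi (dpsi t).
  move=> t01; rewrite /psi /dpsi.
  have Ut : U (x + t *: h).
    have [] // := H2 x (x + t *: h) Tx.
    by rewrite opprD addNKr normrN; apply: le_trans hd2; exact: th_le.
  have D0 := is_derive_line ll lb (fdf _ Ut).
  have D1 i := is_deriveZ (h i 0) (is_derive_mpol r 0 (c i) h t).
  exact: (is_deriveB D0 (is_derive_sumr D1)).
have [t||t t01] := @MVT_segment R psi dpsi 0 1 ler01.
- by rewrite in_itv /= => /andP[t0 t1]; apply: dpsiP; rewrite !ltW.
- apply: derivable_within_continuous => t; rewrite in_itv => t01.
  by have [] := dpsiP t t01.
have {}t01 : 0 <= t <= 1 by move: t01; rewrite in_itv.
have psi0 : psi 0 = l (f x).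
  rewrite /psi scale0r addr0 big1 ?subr0// => i _.
  by rewrite expr1 mul0r mulr0.
have psi1 : psi 1 = l (f (x + h)) - \sum_i h i 0 * mpol r (fun al => c' (i :: al)) h.
  rewrite /psi scale1r; congr (_ - _); apply: eq_bigr => i _.
  by rewrite expr1 mul1r.
rewrite subr0 mulr1 psi0 psi1 => dpsiE.
have -> : l (f (x + h)) - mpol r.+1 c' h = dpsi t.
  by rewrite -dpsiE /= opprD addrA addrAC.
have -> : dpsi t = \sum_i h i 0 * (li i (df (x + t *: h)) - mpol r (c i) (t *: h)).
  rewrite /dpsi.
  have -> : l (df (x + t *: h) h) = \sum_i h i 0 * li i (df (x + t *: h)).
    have hE : h = \sum_i h i 0 *: delta_mx i 0.
      by rewrite {1}(matrix_sum_delta h); apply: eq_bigr => i _; rewrite big_ord1.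
    rewrite [X in clin_fun _ X]hE linear_sum; pose lin := GRing.isLinear.Build R W R^o *:%R l ll.
    pose L : {linear W -> R^o} := HB.pack l lin.
    rewrite -[LHS]/(L _) linear_sum; apply: eq_bigr => i _.
    by rewrite !linearZ.
  by rewrite -sumrB; apply: eq_bigr => i _; rewrite expr0 mul1r mulrBr.
apply: le_trans (ler_norm_sum _ _ _) _.
apply: (@le_trans _ _ (\sum_(i < p) `|h| * (M1 * `|h| ^+ r))).
  apply: ler_sum => i _; rewrite normrM; apply: ler_pM => //; first exact: ler_coord.
  have [_ Hi] := H i; apply: le_trans (Hi _ _) _.
    by apply: le_trans hd1; exact: th_le.
  by rewrite ler_wpM2l ?(ltW M10)// lerXn2r ?nnegrE// th_le.
rewrite sumr_const card_ord -mulr_natl [X in _ * X]mulrCA -exprS mulrA.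
by rewrite ler_wpM2r ?exprn_ge0// /M lerDr addr_ge0// ltW.
Qed.

End Taylor.

(** * Partitions of unity and local approximation *)

Section Monomials.
Context {R : realType} (p : nat).
Notation V := 'cV[R]_p.

Lemma big_ffun_recl (A : finType) d (F : {ffun 'I_d.+1 -> A} -> R) :
  \sum_f F f =
  \sum_a \sum_(g : {ffun 'I_d -> A})
    F [ffun j => if unlift ord0 j is Some j' then g j' else a].
Proof.
pose cons (x : A * {ffun 'I_d -> A}) : {ffun 'I_d.+1 -> A} :=
  [ffun j => if unlift ord0 j is Some j' then x.2 j' else x.1].
pose uncons (f : {ffun 'I_d.+1 -> A}) := (f ord0, [ffun j => f (lift ord0 j)]).
rewrite pair_bigA /= (reindex cons) //=; exists uncons => [[a g]|f] _.
  rewrite /uncons /cons; congr (_, _); first by rewrite ffunE unlift_none.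
  by apply/ffunP => j; rewrite !ffunE liftK.
apply/ffunP => j; rewrite !ffunE; case: unliftP => [j' ->|->]; by rewrite ?ffunE.
Qed.

Lemma big_optionE (A : finType) (F : option A -> R) :
  \sum_a F a = F None + \sum_i F (Some i).
Proof.
rewrite (bigD1 None) //=; congr (_ + _).
rewrite (reindex_omap Some id) //=; last by case.
by apply: eq_bigl => i; rewrite eqxx.
Qed.

Definition coord1 (h : V) (a : option 'I_p) : R := if a is Some i then h i 0 else 1.

(** Monomials of degree at most [d] are padded with factors 1 (index [None]) to exactly [d] factors,
    so that all product units have the same length. *)
Lemma mpol_ffun d M (c : seq 'I_p -> R) : (forall al, `|c al| <= M) ->
  exists c' : {ffun 'I_d -> option 'I_p} -> R, (forall al, `|c' al| <= M) /\
    forall h, mpol d.+1 c h = \sum_al c' al * \prod_j coord1 h (al j).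
Proof.
elim: d c => [|d IHd] c cM.
  exists (fun=> c [::]); split=> // h.
  rewrite /= big1 ?addr0; last by move=> i _; rewrite mulr0.
  rewrite (big_pred1 [ffun j => None]) ?big_ord0 ?mulr1// => al.
  by apply/esym/eqP/ffunP => -[].
have /boolp.choice[c' H] (i : 'I_p) := IHd (fun al => c (i :: al)) (fun al => cM _).
(* After a leading [None], only the tail made of [None] carries the constant term, which is thus
   counted once. *)
exists (fun al => if al ord0 is Some i then c' i [ffun j => al (lift ord0 j)]
  else if [ffun j => al (lift ord0 j)] == [ffun _ => None] then c [::] else 0).
split=> [al|h].
  case: (al ord0) => [i|]; first by have [] := H i.
  by case: ifP => _ //; rewrite normr0; exact: le_trans (cM [::]).
have tl a (g : {ffun 'I_d -> option 'I_p}) : [ffun j => [ffun j =>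
    if unlift ord0 j is Some j' then g j' else a] (lift ord0 j)] = g.
  by apply/ffunP => j; rewrite !ffunE liftK.
have hd a (g : {ffun 'I_d -> option 'I_p}) : [ffun j =>
    if unlift ord0 j is Some j' then g j' else a] ord0 = a.
  by rewrite ffunE unlift_none.
have prodE a (g : {ffun 'I_d -> option 'I_p}) : \prod_j coord1 h ([ffun j =>
    if unlift ord0 j is Some j' then g j' else a] j) =
    coord1 h a * \prod_j coord1 h (g j).
  rewrite big_ord_recl hd; congr (_ * _); apply: eq_bigr => j _.
  by rewrite ffunE liftK.
rewrite big_ffun_recl big_optionE /=; congr (_ + _).
  rewrite (bigD1 [ffun _ => None]) //= [X in _ + X]big1 ?addr0; last first.
    by move=> g /negbTE gN; rewrite hd tl gN mul0r.
  rewrite hd tl eqxx prodE /= mul1r big1 ?mulr1// => j _; exact: (congr1 (coord1 h) (ffunE _ j)).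
apply: eq_bigr => i _; have [_ /(_ h) /= ->] := H i; rewrite big_distrr /=.
by apply: eq_bigr => g _; rewrite hd tl prodE /= mulrCA.
Qed.

(* For |h| <= w the coordinate h_i is w times the difference of the two
   clipped functions clip (h_i / w) and clip (- h_i / w). *)
Definition signed_coord (w : R) (h : V) (a : option 'I_p) (b : bool) : R :=
  if a is Some i then (-1) ^+ (~~ b) * (h i 0 / w) else 1.

Definition sign_weight (w : R) (a : option 'I_p) (b : bool) : R :=
  if a is Some i then (-1) ^+ (~~ b) * w else b%:R.

Lemma coord1_clip w h a : 0 < w -> `|h| <= w ->
  coord1 h a = \sum_(b : bool) sign_weight w a b * clip (signed_coord w h a b).
Proof.
move=> w0 hw; rewrite big_bool /=; case: a => [i|] /=; last first.
  by rewrite clip1// mul0r addr0 mulr1.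
have := le_trans (ler_coord h i) hw.
rewrite expr0 expr1 !mul1r !mulN1r.
have [h0|h0] := leP 0 (h i 0) => hi.
  have q0 : 0 <= h i 0 / w by rewrite divr_ge0// ltW.
  rewrite clip_id; last by rewrite q0 ler_pdivrMr// mul1r -(ger0_norm h0).
  by rewrite clip0 ?oppr_le0// mulr0 addr0 mulrC divfK// gt_eqF.
have q0 : h i 0 / w < 0 by rewrite pmulr_llt0 ?invr_gt0.
rewrite clip0 1?ltW// clip_id; last first.
  by rewrite oppr_ge0 ltW//= -mulNr ler_pdivrMr// mul1r -(ltr0_norm h0).
by rewrite mulr0 add0r mulrNN mulrC divfK// gt_eqF.
Qed.

Lemma prod_coord1_clip w h d (al : {ffun 'I_d -> option 'I_p}) :
  0 < w -> `|h| <= w ->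
  \prod_j coord1 h (al j) = \sum_(b : {ffun 'I_d -> bool})
    (\prod_j sign_weight w (al j) (b j)) *
    \prod_j clip (signed_coord w h (al j) (b j)).
Proof.
move=> w0 hw; under eq_bigr do rewrite (coord1_clip _ w0 hw).
by rewrite bigA_distr_bigA; apply: eq_bigr => b _; rewrite big_split.
Qed.

Lemma sign_weight_prod_le w d (al : {ffun 'I_d -> option 'I_p}) (b : {ffun 'I_d -> bool}) :
  0 < w -> w <= 2 -> `|\prod_j sign_weight w (al j) (b j)| <= 2 ^+ d.
Proof.
move=> w0 w2; rewrite normr_prod.
apply: (@le_trans _ _ (\prod_(j < d) 2)); last by rewrite prodr_const card_ord.
apply: ler_prod => j _; rewrite normr_ge0 /=; case: (al j) => [i|] /=.
  by rewrite normrM normrX normrN1 expr1n mul1r gtr0_norm.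
by case: (b j); rewrite ?normr1 ?normr0// ler1n.
Qed.

End Monomials.

Section Hats.
Context {R : realType}.
Implicit Types v w : R.

Definition hat v : R := clip (v + 1) - clip v.

Lemma hat_ge0 v : 0 <= hat v.
Proof. by rewrite subr_ge0; apply: clip_homo; rewrite lerDl. Qed.

Lemma hat_support v : hat v != 0 -> `|v| < 1.
Proof.
move=> hv; rewrite ltr_norml; apply/andP; split; rewrite ltNge; apply/negP => h;
  move/eqP: hv; apply; rewrite /hat.
  by rewrite !clip0 ?subrr//; lra.
by rewrite !clip1 ?subrr//; lra.
Qed.

Lemma sum_hat_telescope K w : \sum_(m < K) hat (w - m%:R) =
  clip (w + 1) - clip (w - K%:R + 1).
Proof.
elim: K => [|K IHK]; first by rewrite big_ord0 subr0 subrr.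
have -> : w - K.+1%:R + 1 = w - K%:R by rewrite -natr1; ring.
by rewrite big_ord_recr /= IHK /hat addrA subrK.
Qed.

Lemma sum_hat K w : 0 <= w -> w <= K%:R -> \sum_(m < K.+1) hat (w - m%:R) = 1.
Proof.
move=> w0 wK; rewrite sum_hat_telescope clip1; last by rewrite lerDr.
by rewrite clip0 ?subr0// -natr1; lra.
Qed.

(** The sum of three consecutive hats is 1 wherever the middle one is nonzero, and each of the three
    resulting sums telescopes to at most 1. *)
Lemma sum_hat_neq0 K w : \sum_(m < K) (hat (w - m%:R) != 0)%:R <= 3 :> R.
Proof.
have step v : (hat v != 0)%:R <= hat (v + 1) + hat v + hat (v - 1).
  have [|v0] := boolP (hat v != 0); last first.
    by apply: addr_ge0; [apply: addr_ge0|]; exact: hat_ge0.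
  move=> /hat_support; rewrite ltr_norml => /andP[v1 v2].
  rewrite /hat subrK [X in _ <= X](_ : _ = clip (v + 1 + 1) - clip (v - 1)); last by ring.
  by rewrite clip1 ?clip0 ?subr0//; lra.
apply: (@le_trans _ _ (\sum_(m < K) (hat (w + 1 - m%:R) + hat (w - m%:R) + hat (w - 1 - m%:R)))).
  apply: ler_sum => m _; apply: le_trans (step _) _.
  by rewrite ![_ - m%:R + _]addrAC lexx.
rewrite 2!big_split /= !sum_hat_telescope.
have := clip_itv (w + 1 + 1); have := clip_itv (w + 1); have := clip_itv (w - 1 + 1).
have := clip_itv (w + 1 - K%:R + 1); have := clip_itv (w - K%:R + 1).
have := clip_itv (w - 1 - K%:R + 1); lra.
Qed.

(** Take n close to the logarithm of A / eps in base 4. As eps < 1/2, [ln (1 / eps)] is at least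
    [ln 2], which absorbs the additive constants. *)
Lemma log_depth (A : R) : 0 < A -> exists2 C : R, 0 < C & forall eps : R,
  0 < eps < 1 / 2 -> exists2 n : nat, A / 4 ^+ n <= eps & n%:R <= C * ln (1 / eps).
Proof.
move=> A0; have l4 : 0 < ln 4 :> R by rewrite ln_gt0// ltr1n.
have l2 : 0 < ln 2 :> R by rewrite ln_gt0// ltr1n.
exists ((`|ln A| / ln 2 + 1) / ln 4 + (ln 2)^-1).
  by rewrite ltr_wpDl ?invr_gt0// divr_ge0 ?addr_ge0 ?divr_ge0// ltW.
move=> eps /andP[e0 e2].
have le : ln 2 <= ln (1 / eps).
  by rewrite ler_ln ?posrE ?divr_gt0// ler_pdivlMr//; lra.
have le0 : 0 < ln (1 / eps) by exact: lt_le_trans le.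
pose y := (`|ln A| + ln (1 / eps)) / ln 4.
have y0 : 0 <= y by rewrite divr_ge0 ?addr_ge0// ltW.
have := truncn_itv y0; set m := Num.truncn y => /andP[my ym].
exists m.+1.
  rewrite ler_pdivrMr ?exprn_gt0// -ler_pdivrMl// -ler_ln ?posrE ?mulr_gt0 ?invr_gt0 ?exprn_gt0//.
  rewrite lnXn// -[leRHS]mulr_natl -ler_pdivrMr//.
  apply: le_trans (ltW ym); rewrite /y ler_pM2r ?invr_gt0//.
  by rewrite mulrC lnM ?posrE ?invr_gt0// -[in leLHS]div1r lerD2r ler_norm.
rewrite -natr1 mulrDl; apply: lerD.
  apply: (le_trans my); rewrite /y [leRHS]mulrAC ler_pM2r ?invr_gt0//.
  rewrite [leRHS]mulrDl [1 * ln _]mul1r lerD2r mulrAC ler_pdivlMr//.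
  by rewrite ler_wpM2l.
by rewrite [leRHS]mulrC ler_pdivlMr// [1 * ln 2]mul1r.
Qed.

End Hats.

Section LocalApproximation.
Context {R : realType} (p d : nat).
Notation V := 'cV[R]_p.
Notation J := ({ffun 'I_d -> option 'I_p} * {ffun 'I_d -> bool})%type.

Definition grid_coord (B eta : R) (i : 'I_p) (x : 'I_p -> R) (m : nat) : R :=
  (x i + B) / eta - m%:R.

(** The first [p] factors are hats, given by two affine functions that differ by 1; the last [d] are
    clipped signed coordinates relative to the centre [xm] of the cell, the lower function being
    0. *)
Definition factor (B eta : R) K (xm : {ffun 'I_p -> 'I_K} -> V)
    (i : {ffun 'I_p -> 'I_K} * J) (j : 'I_(p + d)) (b : bool) (x : 'I_p -> R) : R :=
  match fintype.split j with
  | inl k => grid_coord B eta k x (i.1 k) + b%:R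
  | inr k => if b then signed_coord (2 * eta) (\col_l x l - xm i.1) (i.2.1 k) (i.2.2 k)
             else 0
  end.

Lemma affine1_factor B eta K xm (i : {ffun 'I_p -> 'I_K} * J) j b :
  affine1 (factor B eta xm i j b).
Proof.
rewrite /factor /grid_coord; case: (fintype.split j) => k.
  apply: affine1D; last exact: affine1_cst.
  apply: affine1D; last exact: affine1_cst.
  apply: affine1Zr; apply: affine1D; last exact: affine1_cst.
  exact: affine1_proj.
case: b; last exact: affine1_cst.
rewrite /signed_coord; case: (i.2.1 k) => [l|]; last exact: affine1_cst.
apply: affine1Z; apply: affine1Zr.
have [a [b ab]] := affine1D (affine1_proj l) (affine1_cst 'I_p (- xm i.1 l 0)).
by exists a, b => st; rewrite -ab !mxE.
Qed.

Lemma clip_factor_le B eta K xm (i : {ffun 'I_p -> 'I_K} * J) j x :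
  clip (factor B eta xm i j false x) <= clip (factor B eta xm i j true x).
Proof.
rewrite /factor; case: (fintype.split j) => k.
  by apply: clip_homo; rewrite lerD2l ler0n.
by rewrite clip0//; have /andP[] := clip_itv (signed_coord (2 * eta)
  (\col_l x l - xm i.1) (i.2.1 k) (i.2.2 k)).
Qed.

Definition factor_value B eta K xm (i : {ffun 'I_p -> 'I_K} * J) (x : V) j : R :=
  clip (factor B eta xm i j true (fun k => x k 0)) -
  clip (factor B eta xm i j false (fun k => x k 0)).

Lemma factor_value_hat B eta K xm (i : {ffun 'I_p -> 'I_K} * J) x k :
  factor_value B eta xm i x (lshift d k) =
  hat (grid_coord B eta k (fun k => x k 0) (i.1 k)).
Proof. by rewrite /factor_value /factor (unsplitK (inl k)) addr0. Qed.

Lemma factor_value_coord B eta K xm (i : {ffun 'I_p -> 'I_K} * J) x k :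
  factor_value B eta xm i x (rshift p k) =
  clip (signed_coord (2 * eta) (x - xm i.1) (i.2.1 k) (i.2.2 k)).
Proof.
rewrite /factor_value /factor (unsplitK (inr k)) [clip 0]clip0// subr0.
by congr (clip (signed_coord _ (_ - _) _ _)); apply/matrixP => l l'; rewrite mxE ord1.
Qed.

Lemma factor_value_itv B eta K xm (i : {ffun 'I_p -> 'I_K} * J) x j :
  0 <= factor_value B eta xm i x j <= 1.
Proof.
have := clip_factor_le B eta xm i j (fun k => x k 0); rewrite /factor_value.
have := clip_itv (factor B eta xm i j true (fun k => x k 0)).
by have := clip_itv (factor B eta xm i j false (fun k => x k 0)); lra.
Qed.

Lemma prod_factor_value B eta K xm (i : {ffun 'I_p -> 'I_K} * J) x :
  \prod_(j <- enum 'I_(p + d)) factor_value B eta xm i x j =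
  (\prod_k hat (grid_coord B eta k (fun k => x k 0) (i.1 k))) *
  \prod_k clip (signed_coord (2 * eta) (x - xm i.1) (i.2.1 k) (i.2.2 k)).
Proof.
rewrite big_enum /= big_split_ord /=; congr (_ * _); apply: eq_bigr => k _.
  exact: factor_value_hat.
exact: factor_value_coord.
Qed.

Definition active B eta K (m : {ffun 'I_p -> 'I_K}) (x : V) : bool :=
  [forall k, hat (grid_coord B eta k (fun k => x k 0) (m k)) != 0].

Lemma active_near B eta K (m : {ffun 'I_p -> 'I_K}) x y : 0 < eta ->
  active B eta m x -> active B eta m y -> `|x - y| <= 2 * eta.
Proof.
move=> eta0 /forallP ax /forallP ay.
rewrite [leLHS]/Num.Def.normr /= mx_normrE; apply/bigmax_leP; split => [|[k l] _].
  by rewrite mulr_ge0// ltW.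
rewrite !mxE /= (ord1 l).
have := hat_support (ax k); have := hat_support (ay k); rewrite /grid_coord.
move: (x k 0) (y k 0) (m k : nat)%:R => a b c.
have -> : a - b = ((a + B) / eta - c - ((b + B) / eta - c)) * eta.
  by field; rewrite gt_eqF.
move=> h1 h2; rewrite normrM (gtr0_norm eta0) ler_pM2r//.
by apply: le_trans (ler_normB _ _) _; lra.
Qed.

Lemma sum_active B eta K (x : V) :
  \sum_(m : {ffun 'I_p -> 'I_K}) (active B eta m x)%:R <= 3 ^+ p :> R.
Proof.
rewrite (eq_bigr (fun m : {ffun 'I_p -> 'I_K} => \prod_k
    (hat (grid_coord B eta k (fun k => x k 0) (m k)) != 0)%:R)); last first.
  move=> m _; rewrite -natr_prod; congr (_%:R).
  have [/forallP H|/forallPn[k Hk]] := boolP (active B eta m x).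
    by rewrite big1// => k _; rewrite H.
  by rewrite (bigD1 k)//= (negbTE Hk) mul0n.
rewrite -(bigA_distr_bigA (fun k (m : 'I_K) =>
  (hat (grid_coord B eta k (fun k => x k 0) m) != 0)%:R)).
apply: (@le_trans _ _ (\prod_(k < p) 3)); last by rewrite prodr_const card_ord.
apply: ler_prod => k _; rewrite sumr_ge0 ?ler0n//=; exact: sum_hat_neq0.
Qed.

Lemma sum_hats B eta K (x : V) : 0 < eta -> `|x| <= B -> 2 * B / eta <= K%:R ->
  \sum_(m : {ffun 'I_p -> 'I_K.+1})
    \prod_k hat (grid_coord B eta k (fun k => x k 0) (m k)) = 1.
Proof.
move=> eta0 xB KB.
rewrite -(bigA_distr_bigA (fun k (m : 'I_K.+1) =>
  hat (grid_coord B eta k (fun k => x k 0) m))).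
apply: big1 => k _; have := le_trans (ler_coord x k) xB; rewrite ler_norml => /andP[xB1 xB2].
apply: sum_hat; first by rewrite divr_ge0 ?(ltW eta0)//; lra.
by apply: le_trans KB; rewrite ler_pM2r ?invr_gt0//; lra.
Qed.

Ltac nonneg := repeat first [done | assumption | exact: ler0n | apply: ltW; assumption |
  exact: normr_ge0 | rewrite invr_ge0 | apply: exprn_ge0 | apply: mulr_ge0 | apply: addr_ge0].

(* The approximate product is exactly 0 when a factor is 0, so at most 3^p cells
   of the grid contribute at each point. Hence the depth depends on eps only and
   not on the width eta of the cells, which matters when r = 0. *)
Theorem local_approximation_network (B M : R) : 0 < B -> 0 < M ->
  exists2 C : R, 0 < C &
  forall (Theta : set V) q (f : V -> 'I_q -> R) (eta eps : R),
  (forall x, Theta x -> `|x| <= B) -> 0 < eta <= 1 -> 0 < eps < 1 / 2 ->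
  (forall a x0, Theta x0 -> exists c : seq 'I_p -> R, (forall al, `|c al| <= M) /\
    forall x, Theta x -> `|x - x0| <= 2 * eta ->
      `|f x a - mpol d.+1 c (x - x0)| <= eps / 2) ->
  exists phi : network R p 1 q 1,
    [/\ relu_fully_connected phi,
        (num_dense phi)%:R <= C * ln (1 / eps),
        (active_weights phi)%:R <= C * eta ^- p * (ln (1 / eps) + q%:R) &
        forall x a, Theta x -> `|net_eval phi x a 0 - f x a| <= eps].
Proof.
move=> B0 M0.
(* In one cell, [#|J|] products with coefficients at most M 2^d are each off by at most (p + d) /
   4^n. *)
pose D : R := #|{: J}|%:R * (M * 2 ^+ d) * (p + d)%:R.
have D0 : 0 <= D by rewrite /D; nonneg.
(* With at most 3^p active cells, the product errors amount to 3^p D / 4^n, which must not exceed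
   eps / 2; the final 1 ensures positivity. *)
have A0 : 0 < 2 * 3 ^+ p * D + 1 by rewrite ltr_wpDl// mulr_ge0// mulr_ge0// exprn_ge0.
have [C1 C10 HC1] := log_depth A0.
have [c Hc] := @product_network R (p + d) p.
have l2 : 0 < ln 2 :> R by rewrite ln_gt0// ltr1n.
pose Cd := (p + d)%:R * (C1 + 3 / ln 2) + 3 / ln 2.
pose Cw := #|{: J}|%:R * (2 * B + 2) ^+ p * (c%:R * (C1 + (ln 2)^-1) + 1).
have Cd0 : 0 <= Cd by rewrite /Cd; nonneg.
have Cw0 : 0 <= Cw.
  by rewrite /Cw; nonneg.
exists (Cd + Cw + 1); first by apply: ltr_wpDl => //; exact: addr_ge0.
move=> Theta q f eta eps TB /andP[eta0 eta1] e01 Hloc.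
have /andP[e0 e2] := e01.
have [n An nC] := HC1 _ e01.
have lL : ln 2 <= ln (1 / eps).
  by rewrite ler_ln ?posrE ?divr_gt0// ler_pdivlMr//; lra.
have L0 : 0 < ln (1 / eps) by exact: lt_le_trans lL.
have L1 : 1 <= ln (1 / eps) / ln 2 by rewrite ler_pdivlMr// [1 * ln 2]mul1r.
move: L0 L1 nC lL; set L := ln (1 / eps) => L0 L1 nC lL.
pose K := (Num.truncn (2 * B / eta)).+1.
have Be0 : 0 <= 2 * B / eta by nonneg.
have /andP[Kle Kgt] := truncn_itv Be0.
(* Expansions are available only at points of [Theta], so the centre is some point of [Theta] where
   the cell is active; other cells get the junk value 0. *)
have /boolp.choice[xm Hxm] (m : {ffun 'I_p -> 'I_K.+1}) : exists x0 : V,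
    (exists x, Theta x /\ active B eta m x) -> Theta x0 /\ active B eta m x0.
  have [[x Hx]|nH] := pselect (exists x, Theta x /\ active B eta m x); first by exists x.
  by exists 0.
have /boolp.choice[cf Hcf] (am : 'I_q * {ffun 'I_p -> 'I_K.+1}) :
    exists c' : {ffun 'I_d -> option 'I_p} -> R, Theta (xm am.2) ->
    (forall al, `|c' al| <= M) /\ forall x, Theta x -> `|x - xm am.2| <= 2 * eta ->
    `|f x am.1 - \sum_al c' al * \prod_j coord1 (x - xm am.2) (al j)| <= eps / 2.
  have [Tx|nT] := pselect (Theta (xm am.2)); last by exists (fun=> 0).
  have [c' [c'M c'E]] := Hloc am.1 _ Tx.
  have [c'' [c''M c''E]] := mpol_ffun d c'M.
  by exists c'' => _; split=> // x Tx' xx; rewrite -c''E; exact: c'E.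
pose Cf a (i : {ffun 'I_p -> 'I_K.+1} * J) : R :=
  cf (a, i.1) i.2.1 * \prod_k sign_weight (2 * eta) (i.2.1 k) (i.2.2 k).
have [phi [phi1 phi2 phi3 phi4]] := Hc q _ n (factor B eta xm) Cf
  (@affine1_factor B eta _ xm) (@clip_factor_le B eta _ xm).
exists phi; split => //.
- rewrite phi2 natrD natrM (natrD _ n 3).
  apply: (@le_trans _ _ (Cd * L)); last first.
    by rewrite ler_pM2r// -addrA lerDl; exact: addr_ge0.
  have h3 : 3 <= 3 / ln 2 * L by rewrite mulrAC -mulrA ler_peMr.
  have : (p + d)%:R * (n%:R + 3) <= (p + d)%:R * ((C1 + 3 / ln 2) * L).
    by rewrite ler_wpM2l// mulrDl lerD.
  by move=> h4; rewrite /Cd [leRHS]mulrDl -[X in _ <= X + _]mulrA; lra.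
- have cI : #|{: {ffun 'I_p -> 'I_K.+1} * J}|%:R <=
            #|{: J}|%:R * (2 * B + 2) ^+ p * eta ^- p.
    rewrite card_prod mulnC natrM -mulrA ler_wpM2l// card_ffun !card_ord natrX.
    rewrite -exprVn -exprMn lerXn2r ?nnegrE//.
      by nonneg.
    have -> : K.+1%:R = (Num.truncn (2 * B / eta))%:R + 2 :> R by rewrite /K -addn2 natrD.
    by rewrite (mulrDl (2 * B) 2) lerD// ler_peMr// invf_ge1.
  apply: (@le_trans _ _ (Cw * eta ^- p * (L + q%:R))); last first.
    rewrite ler_wpM2r//; first by nonneg.
    rewrite ler_wpM2r//; first by nonneg.
    by rewrite addrAC lerDr addr_ge0.
  apply: (@le_trans _ _ (c * (#|{: {ffun 'I_p -> 'I_K.+1} * J}| * n.+1) +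
     q * #|{: {ffun 'I_p -> 'I_K.+1} * J}|)%:R); first by rewrite ler_nat.
  rewrite natrD !natrM.
  move: cI; set I := #|_|%:R; set E := eta ^- p => cI.
  have -> : c%:R * (I * n.+1%:R) + q%:R * I = I * (c%:R * n.+1%:R + q%:R) by ring.
  apply: le_trans (ler_wpM2r _ cI) _; first by nonneg.
  rewrite /Cw [leRHS](_ : _ = #|{: J}|%:R * (2 * B + 2) ^+ p * E *
    ((c%:R * (C1 + (ln 2)^-1) + 1) * (L + q%:R))); last by ring.
  rewrite ler_wpM2l//.
    by nonneg.
  have cn : c%:R * n.+1%:R <= c%:R * (C1 + (ln 2)^-1) * L.
    rewrite -mulrA ler_wpM2l// -natr1 mulrDl; apply: lerD => //.
    by rewrite mulrC.
  have h1 : 0 <= c%:R * (C1 + (ln 2)^-1) * q%:R.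
    by nonneg.
  by move: cn h1; set X := c%:R * (_ + _); lra.
- move=> x a Tx; rewrite phi4.
  pose F (i : {ffun 'I_p -> 'I_K.+1} * J) :=
    prodapp n (factor_value B eta xm i x) (enum 'I_(p + d)) 1.
  pose h (m : {ffun 'I_p -> 'I_K.+1}) :=
    \prod_k hat (grid_coord B eta k (fun k => x k 0) (m k)).
  have h0 m : 0 <= h m by apply: prodr_ge0 => k _; exact: hat_ge0.
  (* The local error is weighted by the hat product [h m]. As these weights sum to 1, the local
     errors average to at most eps / 2. *)
  have key m : `|\sum_j Cf a (m, j) * F (m, j) - h m * f x a| <=
      (active B eta m x)%:R * (D / 4 ^+ n) + h m * (eps / 2).
    have [ax|/forallPn[k]] := boolP (active B eta m x); last first.
      rewrite negbK => /eqP hk.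
      have hm0 : h m = 0 by rewrite /h (bigD1 k)//= hk mul0r.
      rewrite hm0 !mul0r subr0 add0r big1 ?normr0// => j _.
      rewrite /F (@prodapp_eq0 _ _ _ _ (factor_value_itv B eta xm (m, j) x) _ _ (lshift d k)).
      - by rewrite mulr0.
      - by rewrite ler01 lexx.
      - by rewrite mem_enum.
      - by rewrite factor_value_hat.
    have [|Txm axm] := Hxm m; first by exists x.
    have [cM cE] := Hcf (a, m) Txm.
    have near := active_near eta0 ax axm.
    rewrite mul1r.
    pose y j := \prod_(k <- enum 'I_(p + d)) factor_value B eta xm (m, j) x k.
    apply: le_trans (ler_distD (\sum_j Cf a (m, j) * y j) _ _) _.
    apply: lerD.
      rewrite -sumrB; apply: le_trans (ler_norm_sum _ _ _) _.
      apply: (@le_trans _ _ (\sum_(j : J) M * 2 ^+ d * ((p + d)%:R / 4 ^+ n))).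
        apply: ler_sum => j _; rewrite -mulrBr normrM; apply: ler_pM => //.
          rewrite normrM; apply: ler_pM => //.
          apply: sign_weight_prod_le; first by rewrite mulr_gt0.
          by rewrite ger_pMr.
        have := @prodapp_err R n _ _ (factor_value_itv B eta xm (m, j) x)
          (enum 'I_(p + d)) 1.
        by rewrite size_enum_ord mul1r; apply; rewrite ler01 lexx.
      rewrite (_ : \sum_j _ = D / 4 ^+ n)// sumr_const -[LHS]mulr_natl /D.
      by rewrite !mulrA.
    have -> : \sum_j Cf a (m, j) * y j =
        h m * \sum_al cf (a, m) al * \prod_j coord1 (x - xm m) (al j).
      under [in RHS]eq_bigr => al _ do
        rewrite (prod_coord1_clip (w := 2 * eta)) ?mulr_gt0// big_distrr /=.
      rewrite pair_bigA big_distrr /=; apply: eq_bigr => -[al b] _.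
      by rewrite /y prod_factor_value /Cf /= -/(h m); ring.
    rewrite -mulrBr normrM (ger0_norm (h0 m)) ler_wpM2l// distrC.
    exact: cE.
  have -> : f x a = \sum_m h m * f x a.
    rewrite -big_distrl /= sum_hats ?mul1r//; first exact: TB.
    exact: ltW.
  have -> : \sum_i Cf a i * prodapp n (fun j =>
      clip (factor B eta xm i j true (fun k => x k 0)) -
      clip (factor B eta xm i j false (fun k => x k 0))) (enum 'I_(p + d)) 1 =
      \sum_m \sum_j Cf a (m, j) * F (m, j).
    by rewrite pair_bigA; apply: eq_bigr => -[m j] _.
  rewrite -sumrB; apply: le_trans (ler_norm_sum _ _ _) _.
  apply: le_trans (ler_sum _ (fun m _ => key m)) _.
  rewrite big_split /= -!big_distrl /= sum_hats ?(ltW Kgt)//; last exact: TB.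
  rewrite mul1r [leRHS]splitr lerD2r.
  apply: (@le_trans _ _ (3 ^+ p * (D / 4 ^+ n))).
    by rewrite ler_wpM2r ?sum_active// divr_ge0// exprn_ge0.
  have -> : 3 ^+ p * (D / 4 ^+ n) = 2 * 3 ^+ p * D / 4 ^+ n / 2.
    by field; rewrite expf_neq0.
  rewrite ler_pM2r ?invr_gt0//; apply: le_trans An.
  by rewrite ler_pM2r ?invr_gt0 ?exprn_gt0//; lra.
Qed.

End LocalApproximation.

(** * Smooth functions *)

Section SmoothFunctions.
Context {R : realType}.

(** The functions P(1/x) exp(-1/x), extended by 0: differentiation stays in the family and replaces
    P by X^2 (P - P'). *)
Definition flat (P : {poly R}) (x : R) : R :=
  if 0 < x then P.[x^-1] * expR (- x^-1) else 0.

(** From exp u >= u^(i+2) / (i+2)! with u = 1/x. A quadratic bound is what gives differentiability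
    at 0, with derivative 0. *)
Lemma flat_le_sqr P : exists2 C : R, 0 <= C & forall x, `|flat P x| <= C * x ^+ 2.
Proof.
exists (\sum_(i < size P) `|P`_i| * (i.+2)`!%:R).
  by apply: sumr_ge0 => i _; rewrite mulr_ge0.
move=> x; rewrite /flat; case: ifPn => [x0|_]; last first.
  by rewrite normr0 mulr_ge0 ?sqr_ge0//; apply: sumr_ge0 => i _; rewrite mulr_ge0.
rewrite horner_coef mulr_suml big_distrl /=.
apply: le_trans (ler_norm_sum _ _ _) _; apply: ler_sum => i _.
rewrite !normrM -!mulrA ler_wpM2l//.
have u0 : 0 < x^-1 by rewrite invr_gt0.
rewrite (gtr0_norm (exprn_gt0 _ u0)) (gtr0_norm (expR_gt0 _)) expRN.
rewrite ler_pdivrMr ?expR_gt0// mulrAC.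
have := expR_ge1Dxn i.+1 (ltW u0); set e := expR _; set f := _%:R => h.
have f0 : 0 < f by rewrite ltr0n fact_gt0.
have : x^-1 ^+ i.+2 <= e * f by rewrite -ler_pdivrMr//; lra.
rewrite -(ler_pM2r (exprn_gt0 2 x0)) => h2.
have -> : f * e * x ^+ 2 = e * f * x ^+ 2 by ring.
apply: le_trans h2; rewrite -addn2 exprD -mulrA -exprMn mulVf ?gt_eqF//.
by rewrite expr1n mulr1.
Qed.

Lemma is_derive_of_sqr_bound (f : R -> R) C :
  (forall x, `|f x| <= C * x ^+ 2) -> is_derive (0 : R) (1 : R) f 0.
Proof.
move=> fC; have f0 : f 0 = 0.
  by apply/eqP; rewrite -normr_le0; apply: le_trans (fC 0) _; rewrite expr0n mulr0.
have C0 : 0 <= C by have := fC 1; rewrite expr1n mulr1; apply: le_trans.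
have lim0 : h^-1 *: ((f \o shift 0) (h *: 1) - f 0) @[h --> 0^'] --> (0 : R).
  apply/cvgrPdist_le => e e0; near=> h.
  rewrite f0 !subr0 sub0r normrN /= addr0 /GRing.scale /= mulr1 normrM normfV.
  have h0 : h != 0 by near: h; exact: nbhs_dnbhs_neq.
  rewrite ler_pdivrMl ?normr_gt0//; apply: le_trans (fC h) _.
  rewrite -real_normK ?num_real// expr2 mulrA mulrC ler_wpM2l//.
  have he : `|h| <= e / (C + 1).
    near: h; apply: dnbhs0_le; rewrite divr_gt0//; lra.
  apply: le_trans (ler_wpM2l C0 he) _.
  by rewrite mulrCA ger_pMr// ler_pdivrMr; lra.
apply: DeriveDef; first by apply/cvg_ex; exists 0.
exact: cvg_lim lim0.
Unshelve. all: by end_near. Qed.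

Lemma is_derive_flat P (x : R) : is_derive x 1 (flat P) (flat ('X^2 * (P - P^`())) x).
Proof.
have [x0|x0|->] := ltgtP x 0.
- rewrite [flat _ x]/flat ltNge (ltW x0) /=.
  apply: (@near_eq_is_derive _ _ _ (cst 0)).
  near=> y; rewrite /flat ltNge ltW//; near: y; exact: lt_nbhsl.
- rewrite [flat _ x]/flat x0.
  have xn0 : x != 0 by rewrite gt_eqF.
  have D1 : is_derive x 1 (fun y : R => y^-1) (- x ^- 2).
    have := is_deriveV xn0 (is_derive_id x 1).
    by move/is_derive_eq; apply; rewrite /GRing.scale /= mulr1.
  have D2 := is_derive1_comp (is_derive_poly P x^-1) D1.
  have D3 := is_derive1_comp (is_derive_expR _) (is_deriveN D1).
  have D4 : is_derive x 1 (fun y : R => P.[y^-1] * expR (- y^-1))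
      (P.[x^-1] * (expR (- x^-1) * - (- x ^- 2)) +
       expR (- x^-1) * (P^`().[x^-1] * - x ^- 2)) := is_deriveM D2 D3.
  have D5 : is_derive x 1 (fun y : R => P.[y^-1] * expR (- y^-1))
      (('X^2 * (P - P^`())).[x^-1] * expR (- x^-1)).
    by apply: (is_derive_eq D4); rewrite hornerM hornerXn hornerD hornerN -exprVn; ring.
  apply: (near_eq_is_derive _ D5).
  by near=> y; rewrite /flat ifT//; near: y; exact: lt_nbhsr.
- rewrite [flat _ 0]/flat ltxx.
  by have [C _ HC] := flat_le_sqr P; exact: (is_derive_of_sqr_bound HC).
Unshelve. all: by end_near. Qed.

(* A class closed under differentiation: one induction on its generators then
   gives the smoothness of all its members. *)
Inductive elementary : (R -> R) -> Prop :=
| elementary_flat P : elementary (flat P)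
| elementary_cst c : elementary (fun=> c)
| elementary_affine f a b : elementary f -> elementary (fun x => f (a * x + b))
| elementary_id : elementary (fun x => x)
| elementary_add f g : elementary f -> elementary g ->
    elementary (fun x => f x + g x)
| elementary_mul f g : elementary f -> elementary g ->
    elementary (fun x => f x * g x)
| elementary_inv f : (forall x, f x != 0) -> elementary f ->
    elementary (fun x => (f x)^-1).

Lemma elementary_derive f : elementary f ->
  exists2 g, elementary g & forall x : R, is_derive x 1 f (g x).
Proof.
elim=> {f} [P|c|f a b _ [g eg fg]||f1 f2 e1 [g1 eg1 fg1] e2 [g2 eg2 fg2]
  |f1 f2 e1 [g1 eg1 fg1] e2 [g2 eg2 fg2]|f f0 ef [g eg fg]].
- by exists (flat ('X^2 * (P - P^`()))); [exact: elementary_flat|exact: is_derive_flat].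
- by exists (fun=> 0); [exact: elementary_cst|move=> x; exact: is_derive_cst].
- exists (fun x => g (a * x + b) * a).
    by apply: elementary_mul; [exact: elementary_affine|exact: elementary_cst].
  move=> x; have D1 : is_derive x 1 (fun x => a * x + b) a.
    have := is_deriveD (is_deriveZ a (is_derive_id x 1)) (is_derive_cst b x 1).
    by move/is_derive_eq; apply; rewrite addr0 /GRing.scale /= mulr1.
  exact: (is_derive1_comp (fg _) D1).
- by exists (fun=> 1); [exact: elementary_cst|move=> x; exact: is_derive_id].
- by exists (fun x => g1 x + g2 x); [exact: elementary_add|move=> x; exact: is_deriveD].
- exists (fun x => f1 x * g2 x + f2 x * g1 x).
    by apply: elementary_add; apply: elementary_mul.
  by move=> x; exact: (is_deriveM (fg1 x) (fg2 x)).
- exists (fun x => (-1) * ((f x)^-1 * (f x)^-1) * g x).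
    apply: elementary_mul => //; apply: elementary_mul; first exact: elementary_cst.
    by apply: elementary_mul; exact: elementary_inv.
  move=> x; have D := is_deriveV (f0 x) (fg x).
  apply: (is_derive_eq D); rewrite /GRing.scale /= -exprVn; ring.
Qed.

Lemma elementary_derive1n f n : elementary f -> elementary (derive1n n f).
Proof.
elim: n f => [|n IHn] f ef //; rewrite /derive1n iterSr -/(derive1n n (derive1 f)).
have [g eg fg] := elementary_derive ef.
rewrite (_ : derive1 f = g); first exact: IHn.
by apply/funext => x; rewrite derive1E; have [_ ->] := fg x.
Qed.

Lemma elementary_smooth f : elementary f -> smooth f.
Proof.
move=> ef n x; have [g _ /(_ x)[]] := elementary_derive (elementary_derive1n n ef).
by [].
Qed.

Lemma elementary_exp f n : elementary f -> elementary (fun x => f x ^+ n).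
Proof.
move=> ef; elim: n => [|n IHn].
  rewrite (_ : (fun _ => _) = fun=> 1); first exact: elementary_cst.
  by apply/funext => x; rewrite expr0.
rewrite (_ : (fun _ => _) = fun x => f x * f x ^+ n); first exact: elementary_mul.
by apply/funext => x; rewrite exprS.
Qed.

Lemma elementary_sum n (F : 'I_n -> R -> R) : (forall i, elementary (F i)) ->
  elementary (fun x => \sum_i F i x).
Proof.
elim: n F => [|n IHn] F eF.
  rewrite (_ : (fun _ => _) = fun=> 0); first exact: elementary_cst.
  by apply/funext => x; rewrite big_ord0.
rewrite (_ : (fun _ => _) = fun x => F ord0 x + \sum_i F (lift ord0 i) x).
  by apply: elementary_add => //; apply: IHn.
by apply/funext => x; rewrite big_ord_recl.
Qed.

Definition step (x : R) : R := flat 1 x / (flat 1 x + flat 1 (1 - x)).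

Lemma flat1_gt0 x : 0 < x -> 0 < flat 1 x.
Proof. by move=> x0; rewrite /flat x0 hornerC mul1r expR_gt0. Qed.

Lemma flat_le0 P x : x <= 0 -> flat P x = 0.
Proof. by move=> x0; rewrite /flat ltNge x0. Qed.

Lemma flat1_ge0 x : 0 <= flat 1 x.
Proof. by have [/flat_le0->|/flat1_gt0/ltW] := leP x 0. Qed.

Lemma step_den_gt0 x : 0 < flat 1 x + flat 1 (1 - x).
Proof.
have [x0|x0] := ltP 0 x; first by rewrite ltr_pwDl ?flat1_gt0 ?flat1_ge0.
by rewrite ltr_wpDl ?flat1_ge0 ?flat1_gt0//; lra.
Qed.

Lemma elementary_step : elementary step.
Proof.
have e1 : elementary (flat 1) by exact: elementary_flat.
have e2 : elementary (fun x => flat 1 (1 - x)).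
  rewrite (_ : (fun _ => _) = fun x => flat 1 (-1 * x + 1)).
    exact: elementary_affine.
  by apply/funext => x; rewrite mulN1r addrC.
apply: elementary_mul => //; apply: elementary_inv; last exact: elementary_add.
by move=> x; rewrite gt_eqF// step_den_gt0.
Qed.

Lemma step_le0 x : x <= 0 -> step x = 0.
Proof. by move=> x0; rewrite /step flat_le0// mul0r. Qed.

Lemma step_ge1 x : 1 <= x -> step x = 1.
Proof.
move=> x1; rewrite /step (@flat_le0 _ (1 - x)) ?addr0; last by lra.
by rewrite divff// gt_eqF// flat1_gt0//; lra.
Qed.

Lemma step_itv x : 0 <= step x <= 1.
Proof.
rewrite /step divr_ge0 ?flat1_ge0 ?(ltW (step_den_gt0 _))//=.
by rewrite ler_pdivrMr ?step_den_gt0// mul1r lerDl flat1_ge0.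
Qed.

End SmoothFunctions.

(** * Peano kernels *)

Section Kernels.
Context {R : realType}.
Notation mu := (@lebesgue_measure R).
Notation Omega := (`]0, 1[%classic : set R).

Lemma elementary_continuous (f : R -> R) : elementary f -> continuous f.
Proof.
move=> ef x; apply/differentiable_continuous/derivable1_diffP.
by have [g _ /(_ x)[]] := elementary_derive ef.
Qed.

Lemma elementary_square_integrable (f : R -> R) : elementary f -> square_integrable f.
Proof.
move=> ef; apply: continuous_square_integrable; apply: continuous_subspaceT.
exact: elementary_continuous.
Qed.

Lemma derive1n_lincomb (f : R -> R) m (c b : 'I_m -> R) (a : R) n : elementary f ->
  derive1n n (fun t => \sum_i c i * f (a * t + b i)) =
  (fun t => \sum_i c i * a ^+ n * derive1n n f (a * t + b i)).
Proof.
move=> ef; elim: n => [|n IHn].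
  by apply/funext => t; apply: eq_bigr => i _; rewrite expr0 mulr1.
rewrite derive1nS IHn; apply/funext => t; rewrite derive1E.
have [g eg fg] := elementary_derive (elementary_derive1n n ef).
have gE u : derive1n n.+1 f u = g u.
  by rewrite derive1nS derive1E; have [_ ->] := fg u.
have D1 i : is_derive t 1 (fun t => a * t + b i) a.
  have := is_deriveD (is_deriveZ a (is_derive_id t 1)) (is_derive_cst (b i) t 1).
  by move/is_derive_eq; apply; rewrite addr0 /GRing.scale /= mulr1.
have D2 i := is_deriveZ (c i * a ^+ n) (@is_derive1_comp _ (derive1n n f)
  (fun t => a * t + b i) t _ _ (fg (a * t + b i)) (D1 i)).
have [_ D3] := is_derive_sumr D2.
rewrite [LHS]D3; apply: eq_bigr => i _; rewrite gE exprSr /GRing.scale /=.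
by rewrite -!mulrA; congr (_ * (_ * _)); exact: mulrC.
Qed.

Lemma derive1n_near n (f g : R -> R) (U : set R) : open U ->
  (forall t, U t -> f t = g t) -> forall t, U t -> derive1n n f t = derive1n n g t.
Proof.
move=> oU; elim: n f g => [|n IHn] f g fg t Ut; first exact: fg.
rewrite /derive1n !iterSr; apply: (IHn _ _ _ t Ut) => u Uu.
rewrite !derive1E; apply: near_eq_derive.
have : \forall y \near u, U y by exact: open_nbhs_nbhs.
by apply: filterS => y /fg.
Qed.

Lemma derive1n_exp m k (t : R) :
  derive1n k (fun t : R => t ^+ m) t = (m ^_ k)%:R * t ^+ (m - k).
Proof.
elim: k t => [|k IHk] t; first by rewrite ffactn0 mul1r subn0.
rewrite derive1nS (_ : derive1n k _ = fun t => (m ^_ k)%:R * t ^+ (m - k)); last exact/funext.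
rewrite derive1E.
have [_ D] : is_derive t 1 (fun t : R => (m ^_ k)%:R * t ^+ (m - k))
    ((m ^_ k)%:R * ((m - k)%:R * t ^+ (m - k).-1)).
  have := is_deriveZ (m ^_ k)%:R (is_deriveX (m - k) (is_derive_id t 1)).
  rewrite (_ : _ \*: _ = fun t : R => (m ^_ k)%:R * t ^+ (m - k)); last first.
    by apply/funext => u; rewrite /= exprfctE.
  by move/is_derive_eq; apply; rewrite /GRing.scale /= mulr1.
by rewrite D mulrA -natrM -ffactnSr subnS.
Qed.

(** Common form of two later estimates: with [q] a multiple of g^2 it yields a Cauchy-Schwarz bound,
    and with [q] = 0 the error of a concentrated kernel. *)
Lemma Rintegral_le_indic (h q : R -> R) (K c e : R) : 0 <= K -> c <= e ->
  mu.-integrable Omega (EFin \o h) -> mu.-integrable Omega (EFin \o q) ->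
  (forall t, Omega t -> `|h t| <= q t + K * (t \in `[c, e])%:R) ->
  `|\int[mu]_(t in Omega) h t| <= \int[mu]_(t in Omega) q t + K * (e - c).
Proof.
move=> K0 ce hi qi hq; apply: le_trans (le_normr_Rintegral _ _) _ => //.
pose J := (`[c, e]%classic : set R).
have JE t : (t \in `[c, e])%:R = \1_J t :> R.
  by rewrite indicE; congr (_%:R); rewrite mem_setE.
have Ji : mu.-integrable Omega (EFin \o (fun t => K * \1_J t)).
  have -> : EFin \o (fun t => K * \1_J t) = (fun t => K%:E * (EFin \o \1_J) t)%E by [].
  apply: integrableZl => //.
  exact: integrableS (integrable_indic_itv c e true false).
have JK : \int[mu]_(t in Omega) (K * \1_J t) <= K * (e - c).
  rewrite RintegralZl//; last exact: integrableS (integrable_indic_itv c e true false).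
  rewrite ler_wpM2l// /Rintegral integral_indic//; last exact: (measurable_itv `[c, e]).
  have muJ : mu J = (e - c)%:E.
    rewrite /J lebesgue_measure_itv/= lte_fin EFinB.
    have [->|ce'] := eqVneq c e; first by rewrite ltxx subee.
    by rewrite lt_neqAle ce' ce.
  have le : (mu (J `&` Omega) <= (e - c)%:E)%E.
    rewrite -muJ; apply: le_measure; last exact: subIsetl.
      by rewrite inE; apply: measurableI; exact: measurable_itv.
    by rewrite inE; exact: measurable_itv.
  have fin : mu (J `&` Omega) \is a fin_num.
    by rewrite ge0_fin_numE//; apply: le_lt_trans le _; rewrite ltry.
  by rewrite -lee_fin fineK.
apply: le_trans (lerD (lexx _) JK); rewrite -RintegralD//.
apply: le_Rintegral => //.
- exact: integrable_norm.
- by rewrite (_ : EFin \o _ = (EFin \o q) \+ (EFin \o (fun t => K * \1_J t))) //; exact: integrableD.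
- by move=> t Ot; rewrite -JE; exact: hq.
Qed.

End Kernels.

Section Ramp.
Context {R : realType} (n : nat).
Notation mu := (@lebesgue_measure R).
Notation Omega := (`]0, 1[%classic : set R).
Implicit Types (d t x : R).

(** A smoothing of the truncated power max(t, 0)^n. Its derivative of order n + 1, [kern d], tends
    to n! times the Dirac mass at 0 when d -> 0+. *)
Definition ramp d t : R := step (d^-1 * t) * t ^+ n.

Definition kern d : R -> R := derive1n n.+1 (ramp d).

Lemma elementary_ramp d : elementary (ramp d).
Proof.
apply: elementary_mul; last by apply: elementary_exp; exact: elementary_id.
rewrite (_ : (fun _ => _) = fun x : R => step (d^-1 * x + 0)).
  by apply: elementary_affine; exact: elementary_step.
by apply/funext => x; rewrite addr0.
Qed.

Lemma elementary_kern d : elementary (kern d).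
Proof. by apply: elementary_derive1n; exact: elementary_ramp. Qed.

Lemma ramp_le0 d t : 0 < d -> t <= 0 -> ramp d t = 0.
Proof. by move=> d0 t0; rewrite /ramp step_le0 ?mul0r// pmulr_rle0// invr_gt0. Qed.

Lemma ramp_ge d t : 0 < d -> d <= t -> ramp d t = t ^+ n.
Proof. by move=> d0 dt; rewrite /ramp step_ge1 ?mul1r// ler_pdivlMl// mulr1. Qed.

Lemma ramp_le d t e : 0 < d -> 0 <= e -> t <= e -> `|ramp d t| <= e ^+ n.
Proof.
move=> d0 e0 te; have [t0|t0] := leP t 0.
  by rewrite ramp_le0// normr0 exprn_ge0.
rewrite /ramp normrM (gtr0_norm (exprn_gt0 _ t0)).
have /andP[s0 s1] := step_itv (d^-1 * t).
rewrite (ger0_norm s0); apply: le_trans (_ : t ^+ n <= _).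
  by rewrite ler_piMl// exprn_ge0// ltW.
by rewrite lerXn2r ?nnegrE// ltW.
Qed.

Lemma derive1n_ramp_lt0 d k t : 0 < d -> t < 0 -> derive1n k (ramp d) t = 0.
Proof.
move=> d0 t0; rewrite (@derive1n_near _ _ _ (fun=> 0) [set u | u < 0])//.
- have E : derive1n k (fun _ : R => 0 : R) = fun=> 0.
    elim: k => // k IHk; rewrite derive1nS IHk; apply/funext => u.
    by rewrite derive1E derive_cst.
  by rewrite E.
- by move=> u /= u0; rewrite ramp_le0// ltW.
Qed.

Lemma derive1n_ramp_gt d k t : 0 < d -> d < t ->
  derive1n k (ramp d) t = (n ^_ k)%:R * t ^+ (n - k).
Proof.
move=> d0 dt; rewrite -derive1n_exp (@derive1n_near _ _ _ (fun t => t ^+ n) [set u | d < u])//.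
- by move=> u /= u0; rewrite ramp_ge// ltW.
Qed.

Lemma kern_support d t : 0 < d -> t \notin `[0, d] -> kern d t = 0.
Proof.
move=> d0; rewrite in_itv/= negb_and -!ltNge => /orP[t0|dt].
  exact: derive1n_ramp_lt0.
by rewrite /kern derive1n_ramp_gt// ffact_small// mul0r.
Qed.

Lemma kern_scale d t : 0 < d -> kern d t = d^-1 * kern 1 (d^-1 * t).
Proof.
move=> d0; rewrite /kern.
have -> : ramp d = fun t => \sum_(i < 1) d ^+ n * ramp 1 (d^-1 * t + 0).
  apply/funext => u; rewrite big_ord1 addr0 /ramp invr1 mul1r mulrCA -exprMn.
  by rewrite mulrA divff ?gt_eqF// mul1r.
have := @derive1n_lincomb R (ramp 1) 1 (fun=> d ^+ n) (fun=> 0) d^-1 n.+1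
  (elementary_ramp 1).
move=> /(congr1 (fun f => f t)) ->; rewrite big_ord1 addr0; congr (_ * _).
by rewrite exprS mulrCA -exprMn divff ?gt_eqF// expr1n mulr1.
Qed.

(** By scaling, the kernel of width [d] is the one of width 1 contracted and multiplied by 1/d.
    Hence the integral of its absolute value is at most [L], uniformly in [d]. *)
Lemma kern_bound : exists2 L : R, 0 <= L & forall d t, 0 < d ->
  `|kern d t| <= L / d * (t \in `[0, d])%:R.
Proof.
have ck : continuous (kern 1) by exact: elementary_continuous (elementary_kern 1).
have [c _ cmax] : exists2 c, c \in `[(0 : R), 1] & forall t, t \in `[(0 : R), 1] ->
    `|kern 1 t| <= `|kern 1 c|.
  apply: (@EVT_max _ (fun t => `|kern 1 t|)); first exact: ler01.
  by apply: continuous_subspaceT => t; apply: cvg_norm; exact: ck.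
exists `|kern 1 c| => // d t d0.
have [td|td] := boolP (t \in `[0, d]); last by rewrite kern_support// normr0 mulr0.
rewrite mulr1 kern_scale// normrM gtr0_norm ?invr_gt0// mulrC ler_pM2r ?invr_gt0//.
apply: cmax; move: td; rewrite !in_itv/= => /andP[t0 td].
by rewrite mulr_ge0 ?invr_ge0 ?(ltW d0)//= ler_pdivrMl// mulr1.
Qed.

(** The kernel is the derivative of the n-th derivative of [ramp d], which goes from 0 before 0 to
    n! after [d]. *)
Lemma Rintegral_kern d x : 0 < d -> 0 < x -> x + d < 1 ->
  \int[mu]_(t in Omega) kern d (t - x) = n`!%:R.
Proof.
move=> d0 x0 x1.
have shift_elem (f : R -> R) : elementary f -> elementary (fun t => f (t - x)).
  move=> ef; rewrite (_ : (fun _ => _) = fun t => f (1 * t + - x)).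
    exact: elementary_affine.
  by apply/funext => t; rewrite mul1r.
pose F t := derive1n n (ramp d) (t - x).
have eF : elementary F by apply: shift_elem; apply: elementary_derive1n; exact: elementary_ramp.
have ek : elementary (fun t => kern d (t - x)) by apply: shift_elem; exact: elementary_kern.
have F'E : derive1 F = fun t => kern d (t - x).
  have := @derive1n_lincomb R (derive1n n (ramp d)) 1 (fun=> 1) (fun=> - x) 1 1
    (elementary_derive1n n (elementary_ramp d)).
  have -> : (fun t => \sum_(i < 1) 1 * derive1n n (ramp d) (1 * t + - x)) = F.
    by apply/funext => t; rewrite big_ord1 !mul1r.
  rewrite derive1n1 => ->; apply/funext => t.
  by rewrite big_ord1 expr1 !mul1r derive1n1 -derive1nS.
have cF : continuous F by exact: elementary_continuous.
have ck : continuous (fun t => kern d (t - x)) by exact: elementary_continuous.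
have ik : mu.-integrable Omega (EFin \o (fun t => kern d (t - x))).
  have -> : EFin \o (fun t => kern d (t - x)) = EFin \o (fun t => 1 * kern d (t - x)).
    by apply/funext => t; rewrite /= mul1r.
  apply: square_integrableM (elementary_square_integrable ek).
  exact: elementary_square_integrable (elementary_cst 1).
have ftc : (\int[mu]_(t in `[0%R, 1%R]) (kern d (t - x))%:E = (F 1%R)%:E - (F 0%R)%:E)%E.
  have c1 : {within `[(0 : R), 1], continuous (fun t => kern d (t - x))}.
    exact: continuous_subspaceT.
  have c2 : derivable_oo_LRcontinuous F 0 1.
    split.
    + by move=> t _; have [g _ /(_ t)[]] := elementary_derive eF.
    + by apply: cvg_at_right_filter; exact: cF.
    + by apply: cvg_at_left_filter; exact: cF.
  have c3 : {in `](0 : R), 1[, derive1 F =1 fun t => kern d (t - x)}.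
    by move=> t _; rewrite F'E.
  exact: (continuous_FTC2 ltr01 c1 c2 c3).
rewrite integral_itv_bndoo in ftc; last exact: measurable_int ik.
have dx1 : d < 1 - x by rewrite ltrBrDl.
have x_lt0 : 0 - x < 0 by rewrite sub0r oppr_lt0.
have F1 : F 1 = n`!%:R.
  by rewrite /F (derive1n_ramp_gt n d0 dx1) subnn expr0 mulr1 ffactnn.
have F0 : F 0 = 0 by exact: derive1n_ramp_lt0 d0 x_lt0.
by rewrite /Rintegral ftc F1 F0 sube0.
Qed.

End Ramp.

Section PeanoKernel.
Context {R : realType}.
Notation mu := (@lebesgue_measure R).
Notation Omega := (`]0, 1[%classic : set R).

Lemma Rintegral_sum m (F : 'I_m -> R -> R) :
  (forall i, mu.-integrable Omega (EFin \o F i)) ->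
  mu.-integrable Omega (EFin \o (fun t => \sum_i F i t)) /\
  \int[mu]_(t in Omega) (\sum_i F i t) = \sum_i \int[mu]_(t in Omega) F i t.
Proof.
elim: m F => [|m IHm] F iF.
  rewrite big_ord0 (_ : (fun t => \sum_i F i t) = fun=> 0); last first.
    by apply/funext => t; rewrite big_ord0.
  by split; [exact: integrable0|rewrite Rintegral_cst ?mul0r//; exact: mOmega].
have [i1 e1] := IHm (fun i => F (lift ord0 i)) (fun i => iF _).
rewrite (_ : (fun t => \sum_i F i t) = fun t => F ord0 t + \sum_i F (lift ord0 i) t).
  rewrite (OintD (iF ord0) i1) e1 big_ord_recl; split => //.
  rewrite (_ : EFin \o _ = (EFin \o F ord0) \+
    (EFin \o (fun t => \sum_i F (lift ord0 i) t)))//.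
  by apply: integrableD => //; exact: mOmega.
by apply/funext => t; rewrite big_ord_recl.
Qed.

(** Polynomials of degree at most [n] are stable under affine substitution. *)
Lemma moment_affine n m (w x : 'I_m -> R) (c k : R) :
  (forall j, (j <= n)%N -> \sum_i w i * x i ^+ j = 0) ->
  \sum_i w i * (c + k * x i) ^+ n = 0.
Proof.
move=> mom; under eq_bigr do rewrite exprDn big_distrr /=.
rewrite exchange_big /= big1// => j _.
rewrite (eq_bigr (fun i => (c ^+ (n - j) * k ^+ j) *+ 'C(n, j) * (w i * x i ^+ j))).
  by rewrite -big_distrr /= mom ?mulr0// -ltnS.
by move=> i _; rewrite exprMn mulrnAr mulrnAl; congr (_ *+ _); ring.
Qed.

Lemma finite_common_radius m (P : 'I_m -> R -> Prop) :
  (forall i, exists2 d : R, 0 < d & forall d', 0 < d' <= d -> P i d') ->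
  exists2 d : R, 0 < d & forall i d', 0 < d' <= d -> P i d'.
Proof.
elim: m P => [|m IHm] P HP; first by exists 1 => // -[].
have [d1 d10 H1] := HP ord0.
have [d2 d20 H2] := IHm (fun i => P (lift ord0 i)) (fun i => HP _).
exists (Num.min d1 d2); first by rewrite lt_min d10.
move=> i d'; rewrite le_min => /and3P[d'0 dd1 dd2].
have [j ->|->] := unliftP ord0 i; first by apply: H2; rewrite d'0.
by apply: H1; rewrite d'0.
Qed.

Variables (n m : nat) (f g : R -> R) (E : R) (x w : 'I_m -> R) (a b W : R).
Hypotheses (cf : {within `[0, 1], continuous f})
  (fg : is_weak_derivative n.+1 f g) (ig : square_integrable g)
  (gE : \int[mu]_(t in Omega) (g t ^+ 2) <= E)
  (a0 : 0 <= a) (ab : a < b) (b1 : b <= 1) (xab : forall i, a <= x i <= b)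
  (wW : \sum_i `|w i| <= W) (W0 : 0 < W)
  (mom : forall j, (j <= n)%N -> \sum_i w i * x i ^+ j = 0).

(* Moving the nodes inwards keeps the mollified functional supported in ]0, 1[. *)
Let node (d : R) (i : 'I_m) : R := 2 * d + (1 - 4 * d) * x i.

(* psi is compactly supported because the weights annihilate the polynomials of
   degree <= n, and its derivative of order n + 1 approximates
   n! * \sum_i w i * (Dirac mass at x i). *)
Let psi (d t : R) : R := \sum_i w i * ramp n d (1 * t + - node d i).

Let elementary_psi (d : R) : elementary (psi d).
Proof.
apply: elementary_sum => i; apply: elementary_mul; first exact: elementary_cst.
by apply: elementary_affine; exact: elementary_ramp.
Qed.

Let psiE (d t : R) : (forall i, d <= t - node d i) -> 0 < d -> psi d t = 0.
Proof.
move=> dt d0; rewrite -(moment_affine (t - 2 * d) (- (1 - 4 * d)) mom).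
apply: eq_bigr => i _; rewrite ramp_ge//; last by rewrite mul1r; exact: dt.
by congr (_ * _ ^+ _); rewrite /node; ring.
Qed.

Let psi0 (d t : R) : (forall i, t - node d i <= 0) -> 0 < d -> psi d t = 0.
Proof.
move=> dt d0; rewrite /psi big1// => i _.
by rewrite ramp_le0 ?mulr0// mul1r; exact: dt.
Qed.

Let node_itv (d : R) i : 0 < d <= 1 / 8 -> 2 * d <= node d i <= 1 - 2 * d.
Proof.
move=> /andP[d0 d1]; have /andP[xa xb] := xab i.
have k1 : 0 <= 1 - 4 * d by lra.
have k2 : 0 <= x i by exact: le_trans a0 xa.
have k3 : 0 <= 1 - x i by rewrite subr_ge0; exact: le_trans xb b1.
have h1 := mulr_ge0 k1 k2; have h2 := mulr_ge0 k1 k3.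
by rewrite /node; apply/andP; split; lra.
Qed.

Let psi_test (d : R) : 0 < d <= 1 / 8 -> test_function (psi d).
Proof.
move=> d01; have /andP[d0 d1] := d01; split; first exact: elementary_smooth.
exists (2 * d), (1 - d); split; [lra|lra|move=> t].
rewrite in_itv/= negb_and -!ltNge => /orP[td|td].
  by apply: psi0 => // i; have := node_itv i d01; lra.
by apply: psiE => // i; have := node_itv i d01; lra.
Qed.

(** Cauchy-Schwarz in the form |g| B <= lam/2 g^2 + B^2/(2 lam), integrated over the support of
    [psi]. The choice lam = B sqrt l balances the two terms and produces E + 1 where sqrt E would be
    expected. *)
Let psi_integral (d : R) : 0 < d <= 1 / 8 -> d <= b - a ->
  `|\int[mu]_(t in Omega) (g t * psi d t)| <=
  W * (2 * (b - a)) ^+ n * Num.sqrt (2 * (b - a)) * (E + 1).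
Proof.
move=> d01 dba; have /andP[d0 d1] := d01.
(* Mollification enlarges the support by [d] <= b - a, whence twice the length. *)
set l := 2 * (b - a); set B := W * l ^+ n.
have l0 : 0 < l by rewrite /l; lra.
have B0 : 0 < B by rewrite mulr_gt0// exprn_gt0.
set sl := Num.sqrt l; have sl0 : 0 < sl by rewrite sqrtr_gt0.
have slE : sl ^+ 2 = l by rewrite sqr_sqrtr// ltW.
pose A := 2 * d + (1 - 4 * d) * a; pose D := 2 * d + (1 - 4 * d) * b + d.
have AD : A <= D by rewrite /A /D; nra.
have DA : D - A <= l by rewrite /A /D /l; nra.
pose lam := B * sl; have lam0 : 0 < lam by rewrite mulr_gt0.
have ipsi := elementary_square_integrable (elementary_psi d).
have K0 : 0 <= B ^+ 2 / (2 * lam) by rewrite divr_ge0 ?sqr_ge0// mulr_ge0// ltW.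
have iq : mu.-integrable Omega (EFin \o (fun t => lam / 2 * g t ^+ 2)).
  have -> : EFin \o (fun t => lam / 2 * g t ^+ 2) =
    (fun t => (lam / 2)%:E * (EFin \o (fun t => g t ^+ 2)%R) t)%E by [].
  exact: integrableZl ig.2.
apply: le_trans (Rintegral_le_indic K0 AD (square_integrableM ig ipsi) iq _) _.
  move=> t _; have nodeA i : A <= node d i by rewrite /A /node; have := xab i; nra.
  have nodeD i : node d i + d <= D by rewrite /D /node; have := xab i; nra.
  have q0 : 0 <= lam / 2 * g t ^+ 2 by rewrite mulr_ge0 ?sqr_ge0// divr_ge0// ltW.
  have [tAD|] := boolP (t \in `[A, D]); last first.
    rewrite in_itv/= negb_and -!ltNge mulr0 addr0 => /orP[tA|tD].
      by rewrite psi0 ?mulr0 ?normr0// => i; have := nodeA i; lra.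
    by rewrite psiE ?mulr0 ?normr0// => i; have := nodeD i; lra.
  have psiB : `|psi d t| <= B.
    apply: le_trans (ler_norm_sum _ _ _) _.
    apply: (@le_trans _ _ (\sum_i `|w i| * l ^+ n)); last first.
      by rewrite -big_distrl /= ler_wpM2r// exprn_ge0// ltW.
    apply: ler_sum => i _; rewrite normrM ler_wpM2l// ramp_le// ?(ltW l0)//.
    move: tAD; rewrite in_itv/= => /andP[_ tD]; have := nodeA i; lra.
  rewrite mulr1 normrM; apply: le_trans (ler_wpM2l (normr_ge0 _) psiB) _.
  have -> : lam / 2 * g t ^+ 2 + B ^+ 2 / (2 * lam) =
    `|g t| * B + (lam * `|g t| - B) ^+ 2 / (2 * lam).
    by rewrite -(real_normK (num_real (g t))); field; rewrite gt_eqF.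
  by rewrite lerDl divr_ge0 ?sqr_ge0// mulr_ge0// ltW.
rewrite (OintZ _ ig.2).
apply: (@le_trans _ _ (lam / 2 * E + B ^+ 2 / (2 * lam) * l)).
  by apply: lerD; [rewrite ler_wpM2l// divr_ge0// ltW|rewrite ler_wpM2l].
have -> : lam / 2 * E + B ^+ 2 / (2 * lam) * l = B * sl * (E + 1) / 2.
  by rewrite -slE /lam; field; rewrite !gt_eqF.
have E0 : 0 <= E by apply: le_trans gE; apply: Rintegral_ge0 => t _; exact: sqr_ge0.
by rewrite ler_pdivrMr// ler_peMr// ?ler1n// mulr_ge0 ?addr_ge0// mulr_ge0// ltW.
Qed.

(** The kernel has mass n!, so the difference is the integral of f (x i) - f t against it. There [t]
    is within 3 d of [x i]: 2 d for the displacement of the node, [d] for the width of the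
    kernel. *)
Let kern_integral (d : R) i (L e : R) : 0 < d <= 1 / 8 -> 0 <= e ->
  (forall d t : R, 0 < d -> `|kern n d t| <= L / d * (t \in `[0, d])%:R) -> 0 <= L ->
  (forall t : R, t \in `[0, 1] -> `|t - x i| <= 3 * d -> `|f (x i) - f t| <= e) ->
  mu.-integrable Omega (EFin \o (fun t => f t * kern n d (t - node d i))) /\
  `|n`!%:R * f (x i) - \int[mu]_(t in Omega) (f t * kern n d (t - node d i))| <= e * L.
Proof.
move=> d01 e0 kL L0 fe; have /andP[d0 d1] := d01.
have /andP[n1 n2] := node_itv i d01.
have ek : elementary (fun t => kern n d (t - node d i)).
  rewrite (_ : (fun _ => _) = fun t => kern n d (1 * t + - node d i)).
    by apply: elementary_affine; exact: elementary_kern.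
  by apply/funext => t; rewrite mul1r.
have sk := elementary_square_integrable ek.
have ifk := square_integrableM (continuous_square_integrable cf) sk.
have ick := square_integrableM
  (elementary_square_integrable (elementary_cst (f (x i)))) sk.
split; first exact: ifk.
have ik : mu.-integrable Omega (EFin \o (fun t => kern n d (t - node d i))).
  have -> : EFin \o (fun t => kern n d (t - node d i)) =
            EFin \o (fun t => 1 * kern n d (t - node d i)).
    by apply/funext => t; rewrite /= mul1r.
  exact: square_integrableM (elementary_square_integrable (elementary_cst 1)) sk.
rewrite -(@Rintegral_kern R n d (node d i)) ?(mulrC (\int[mu]_(t in _) _))//; try lra.
rewrite -(OintZ _ ik) -RintegralB//.
have K0 : 0 <= e * (L / d) by rewrite mulr_ge0// divr_ge0// ltW.
have le_end : node d i <= node d i + d by rewrite lerDl ltW.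
have i0 : mu.-integrable Omega (EFin \o (fun=> 0 : R)) by exact: integrable0.
have ih : mu.-integrable Omega (EFin \o (fun t => f (x i) * kern n d (t - node d i) -
    f t * kern n d (t - node d i))).
  rewrite (_ : EFin \o _ = ((EFin \o (fun t => f (x i) * kern n d (t - node d i))%R) \-
    (EFin \o (fun t => f t * kern n d (t - node d i))%R))%E)//.
  by apply: integrableB => //; exact: mOmega.
apply: le_trans (Rintegral_le_indic K0 le_end ih i0 _) _.
  move=> t /= t01; rewrite add0r -mulrBl normrM -mulrA.
  have -> : (t \in `[node d i, node d i + d]) = (t - node d i \in `[0, d]).
    by rewrite !in_itv/= subr_ge0 lerBlDl.
  have [td|td] := boolP (t - node d i \in `[0, d]); last first.
    by rewrite kern_support// normr0 !mulr0.
  apply: ler_pM => //; last by have := kL d (t - node d i) d0; rewrite td.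
  apply: fe; first by move: t01; rewrite !in_itv/= => /andP[/ltW -> /ltW ->].
  move: td; rewrite in_itv/= => /andP[t1 t2].
  have nx : `|node d i - x i| <= 2 * d.
    have /andP[xa xb] := xab i.
    have k2 : 0 <= x i by exact: le_trans a0 xa.
    have k3 : x i <= 1 by exact: le_trans xb b1.
    rewrite (_ : node d i - x i = 2 * d * (1 - 2 * x i)); last by rewrite /node; ring.
    rewrite normrM gtr0_norm ?mulr_gt0// ger_pMr ?mulr_gt0// ler_norml.
    by apply/andP; split; lra.
  rewrite (_ : t - x i = (t - node d i) + (node d i - x i)); last by ring.
  apply: le_trans (ler_normD _ _) _; rewrite (ger0_norm t1); lra.
rewrite (_ : \int[mu]_(t in _) _ = 0); last first.
  by rewrite Rintegral_cst ?mul0r//; exact: mOmega.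
by rewrite add0r [_ + d]addrC addrK -mulrA divfK// gt_eqF.
Qed.

(** n! times the functional is the limit, for d -> 0, of the integral of [f] against the derivative
    of order n + 1 of [psi d]. Up to sign this is the integral of [g * psi d], whose bound does not
    depend on [d]. *)
Theorem peano_kernel_bound :
  `|\sum_i w i * f (x i)| <=
    W * (2 * (b - a)) ^+ n * Num.sqrt (2 * (b - a)) * (E + 1).
Proof.
have [L L0 kL] := @kern_bound R n.
apply: (@le_trans _ _ (n`!%:R * `|\sum_i w i * f (x i)|)).
  by rewrite ler_peMl// ler1n fact_gt0.
apply/ler_addgt0Pr => e e0.
(* Allowed oscillation of [f] near the nodes: the errors then add up to at most W e' L <= e. *)
pose e' := e / (W * (L + 1)).
have L10 : 0 < L + 1 by rewrite ltr_wpDl.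
have e'0 : 0 < e' by rewrite divr_gt0// mulr_gt0.
have [i|d0 d00 Hd] := @finite_common_radius m (fun i d => forall t : R, t \in `[0, 1] ->
    `|t - x i| <= 3 * d -> `|f (x i) - f t| <= e').
  have xi : x i \in `[0, 1].
    have /andP[xa xb] := xab i.
    by rewrite in_itv/= (le_trans a0 xa) (le_trans xb b1).
  have /subspace_continuousP/(_ _ xi)/cvgrPdist_lt/(_ _ e'0) := cf.
  rewrite near_withinE => /nbhs_ballP[d /= d0 xd].
  exists (d / 4) => [|d' /andP[d'0 d'd] t t01 tx]; first by rewrite divr_gt0.
  by rewrite ltW//; apply: xd => //; rewrite -ball_normE /= distrC; lra.
pose d := Num.min d0 (Num.min (1 / 8) (b - a)).
have d_gt0 : 0 < d by rewrite !lt_min d00 subr_gt0 ab andbT /=; lra.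
have dd0 : d <= d0 by rewrite ge_min lexx.
have d8 : d <= 1 / 8 by rewrite /d !ge_min lexx orbT.
have dba : d <= b - a by rewrite /d !ge_min lexx !orbT.
have d01 : 0 < d <= 1 / 8 by rewrite d_gt0.
have ki i := kern_integral d01 (ltW e'0) kL L0 (Hd i d (introT andP (conj d_gt0 dd0))).
have iw i : mu.-integrable Omega (EFin \o (fun t => w i * (f t * kern n d (t - node d i)))).
  have -> : EFin \o (fun t => w i * (f t * kern n d (t - node d i))) =
    (fun t => (w i)%:E * (EFin \o (fun t => f t * kern n d (t - node d i))%R) t)%E by [].
  exact: integrableZl (ki i).1.
have [_ sumI] := Rintegral_sum iw.
have dpsi : derive1n n.+1 (psi d) = fun t => \sum_i w i * kern n d (t - node d i).
  rewrite (@derive1n_lincomb R (ramp n d) m w (fun i => - node d i) 1 n.+1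
    (elementary_ramp n d)).
  by apply/funext => t; apply: eq_bigr => i _; rewrite expr1n mulr1 mul1r.
have wk := fg (psi_test d01).
have I1 : \int[mu]_(t in Omega) (f t * derive1n n.+1 (psi d) t) =
    \sum_i w i * \int[mu]_(t in Omega) (f t * kern n d (t - node d i)).
  rewrite dpsi -(eq_bigr _ (fun i _ => OintZ (w i) (ki i).1)) -sumI.
  apply: eq_Rintegral => t _; rewrite big_distrr /=; apply: eq_bigr => i _.
  by rewrite mulrCA.
rewrite -(ger0_norm (ler0n R n`!)) -normrM.
rewrite -[X in `|X|](subrK (\sum_i w i * \int[mu]_(t in Omega) (f t * kern n d (t - node d i)))).
apply: le_trans (ler_normD _ _) _; rewrite addrC; apply: lerD.
  rewrite -I1 wk normrM normrX normrN1 expr1n mul1r.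
  exact: psi_integral.
rewrite big_distrr /= -sumrB; apply: le_trans (ler_norm_sum _ _ _) _.
apply: (@le_trans _ _ (\sum_i `|w i| * (e' * L))).
  apply: ler_sum => i _; rewrite mulrCA -mulrBr normrM ler_wpM2l//.
  exact: (ki i).2.
rewrite -big_distrl /=.
apply: (@le_trans _ _ (W * (e' * L))); first by rewrite ler_wpM2r// mulr_ge0// ltW.
have -> : e = W * (e' * (L + 1)).
  by rewrite /e'; field; rewrite !gt_eqF.
by rewrite !ler_pM2l// lerDl.
Qed.

End PeanoKernel.

(** * Interpolation in Sobolev spaces *)

Section SobolevFunctionals.
Context {R : realType} (s : nat) (hs : (1 <= s)%N).
Notation mu := (@lebesgue_measure R).
Notation Omega := (`]0, 1[%classic : set R).

Lemma energy_ge k (g : nat -> R -> R) : (k <= s)%N ->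
  \int[mu]_(x in Omega) (g k x ^+ 2) <= energy s g.
Proof.
move=> ks; rewrite /energy (bigD1 (Ordinal (ks : (k < s.+1)%N)))//= lerDl.
by apply: sumr_ge0 => i _; apply: Rintegral_ge0 => x _; exact: sqr_ge0.
Qed.

Lemma weak_derivatives_energy (f : sobolev R s) (K : R) : `|f| <= K ->
  exists2 g, weak_derivatives s f g & energy s g <= (K + 1) ^+ 2.
Proof.
move=> fK; have [g fg gn] := sobolev_norm_adherent f ltr01.
exists g => //; have K0 : 0 <= K + 1 by rewrite addr_ge0// (le_trans _ fK).
rewrite -[leLHS]sqr_sqrtr ?energy_ge0// lerXn2r ?nnegrE ?sqrtr_ge0//.
by apply: le_trans (ltW gn) _; rewrite lerD2r.
Qed.

Lemma sobolev_continuous (f : sobolev R s) : {within `[0, 1], continuous f}.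
Proof. by have /asboolP[] := sobolev_funP f. Qed.

(** The kernel bound for the difference of two values gives |f x - f y| <= 2 sqrt 2 (4 + 1) <= 20.
    If |f x| > 23, then |f| >= 3 on the whole interval, against the bound 4 = (1 + 1)^2 on the
    integral of f^2. *)
Let eval_bound_ball (f : sobolev R s) (x : R) : `|f| <= 1 -> x \in `[0, 1] -> `|f x| <= 23.
Proof.
move=> /weak_derivatives_energy[g [g0f gf] gE] x01.
have gE4 k : (k <= s)%N -> \int[mu]_(t in Omega) (g k t ^+ 2) <= 4.
  by move=> ks; apply: le_trans (energy_ge g ks) _; apply: le_trans gE _; lra.
rewrite leNgt; apply/negP => fx.
have near_x y : Omega y -> 3 <= `|f y|.
  move=> y01; have [ig1 wg1] := gf 1%N hs.
  pose w (i : 'I_2) : R := if i == ord0 then 1 else -1.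
  pose z (i : 'I_2) : R := if i == ord0 then x else y.
  have z01 i : 0 <= z i <= 1.
    rewrite /z; case: ifP => _; first by move: x01; rewrite in_itv.
    by move: y01; rewrite /= in_itv/= => /andP[/ltW -> /ltW ->].
  have wW : \sum_i `|w i| <= 2.
    by rewrite big_ord_recl big_ord1 /w /= normrN normr1; lra.
  have mom j : (j <= 0)%N -> \sum_i w i * z i ^+ j = 0.
    by rewrite leqn0 => /eqP ->; rewrite big_ord_recl big_ord1 /w /= !expr0; lra.
  have := @peano_kernel_bound R 0 2 f (g 1%N) 4 z w 0 1 2
    (@sobolev_continuous f) wg1 ig1 (gE4 _ hs) (lexx _) ltr01 (lexx _) z01 wW
    (ltr0n _ 2) mom.
  rewrite big_ord_recl big_ord1 /w /z /= mul1r mulN1r expr0 mulr1 subr0 mulr1 => h.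
  have sq2 : Num.sqrt 2 <= 2 :> R.
    by rewrite -[leRHS]ger0_norm// -sqrtr_sqr ler_wsqrtr//; lra.
  have := lerB_dist (f x) (f y).
  by lra.
have : 9 <= \int[mu]_(t in Omega) (f t ^+ 2).
  have -> : 9 = \int[mu]_(t in Omega) (9 : R).
    rewrite Rintegral_cst; last exact: mOmega.
    have muO : mu Omega = 1%E.
      by rewrite lebesgue_measure_itv/= lte_fin ltr01 -EFinB subr0.
    by rewrite (congr1 fine muO) mulr1.
  apply: le_Rintegral => //.
  - have -> : EFin \o (fun _ : R => 9 : R) = EFin \o (fun _ : R => 3 ^+ 2 : R).
      by apply/funext => t /=; congr (_%:E); ring.
    exact: (elementary_square_integrable (elementary_cst 3)).2.
  - by have [] := continuous_square_integrable (@sobolev_continuous f).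
  - by move=> t /near_x ft; rewrite -(real_normK (num_real (f t))); nra.
have := gE4 0%N isT.
have -> : \int[mu]_(t in Omega) (g 0%N t ^+ 2) = \int[mu]_(t in Omega) (f t ^+ 2).
  by apply: eq_Rintegral => t; rewrite inE => tO; rewrite g0f.
by move: (\int[mu]_(t in Omega) _) => I; lra.
Qed.

Lemma sobolev_eval_bound (f : sobolev R s) (x : R) : `|f x| <= 23 * `|f|.
Proof.
have [x01|x01] := boolP (x \in `[(0 : R), 1]); last first.
  have /asboolP[f0 _ _] := sobolev_funP f.
  by rewrite f0// normr0 mulr_ge0.
have [->|fn0] := eqVneq f 0; first by rewrite !normr0 mulr0.
have fp : 0 < `|f| by rewrite normr_gt0.
have := @eval_bound_ball (`|f|^-1 *: f) x _ x01.
rewrite normrZ normfV normr_id mulVf ?gt_eqF// => /(_ (lexx _)).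
rewrite -[X in `|X|]/(`|f|^-1 * f x) normrM normfV normr_id.
by rewrite ler_pdivrMl// mulrC.
Qed.

(* V is the inverse of the Vandermonde matrix of the nodes l / s. *)
Lemma interpolation_weights : exists V : 'I_s -> 'I_s -> R,
  (forall k j : 'I_s, \sum_l V k l * (l%:R / s%:R) ^+ j = (k == j)%:R) /\
  forall l, V (Ordinal hs) l = (Ordinal hs == l)%:R.
Proof.
pose a : 'rV[R]_s := \row_(l < s) (l%:R / s%:R).
pose T := trmx (Vandermonde s a).
have uT : T \in unitmx.
  rewrite unitmxE det_tr det_Vandermonde unitfE.
  apply/prodf_neq0 => i _; apply/prodf_neq0 => j ij; rewrite !mxE -mulrBl mulf_neq0//.
    by rewrite subr_eq0 eqr_nat gtn_eqF.
  by rewrite invr_eq0 pnatr_eq0 -lt0n.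
exists (fun k l => invmx T k l); split=> [k j|l].
  have := congr1 (fun M : 'M[R]_s => M k j) (mulVmx uT).
  by rewrite !mxE => <-; apply: eq_bigr => l _; rewrite !mxE.
have := congr1 (fun M : 'M[R]_s => M (Ordinal hs) l) (mulmxV uT).
rewrite !mxE (bigD1 (Ordinal hs))//= !mxE expr0 mul1r big1 ?addr0// => k k0.
rewrite !mxE /= mul0r expr0n; case: eqP => [k0'|_]; last by rewrite mul0r.
by case/eqP: k0; exact: val_inj.
Qed.

End SobolevFunctionals.

Section CellInterpolation.
Context {R : realType} (s : nat) (hs : (1 <= s)%N).
Variables (V : 'I_s -> 'I_s -> R).
Hypothesis VE : forall k j : 'I_s, \sum_l V k l * (l%:R / s%:R) ^+ j = (k == j)%:R.

(* Cell number 2^l is a fictitious one that only carries the value at 1. *)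
Definition cell_node (l i : nat) (j : 'I_s) : R :=
  Num.min 1 ((i%:R + j%:R / s%:R) / 2 ^+ l).

Definition cell_coef (l i : nat) (k : 'I_s) (f : R -> R) : R :=
  \sum_j V k j * f (cell_node l i j).

(** The leading 1 is the weight of the evaluation point in the error functional; the sum bounds the
    weights of the nodes for every [th] in [0, 1]. *)
Definition interpolation_norm : R := 1 + \sum_k \sum_j `|V k j|.

Lemma interpolation_norm_gt0 : 0 < interpolation_norm.
Proof. by rewrite ltr_pwDl// sumr_ge0// => k _; rewrite sumr_ge0. Qed.

Lemma cell_coef_linear l i k a (f g : R -> R) :
  cell_coef l i k (fun t => a * f t + g t) = a * cell_coef l i k f + cell_coef l i k g.
Proof.
rewrite /cell_coef big_distrr -big_split; apply: eq_bigr => j _ /=; ring.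
Qed.

Lemma cell_coef_le l i k (f : R -> R) K : (forall t, `|f t| <= K) ->
  `|cell_coef l i k f| <= interpolation_norm * K.
Proof.
move=> fK; have K0 : 0 <= K := le_trans (normr_ge0 _) (fK 0).
apply: le_trans (ler_norm_sum _ _ _) _.
apply: (@le_trans _ _ (\sum_j `|V k j| * K)).
  by apply: ler_sum => j _; rewrite normrM ler_wpM2l.
rewrite -big_distrl ler_wpM2r//; apply: ler_wpDl => //.
by rewrite [leRHS](bigD1 k)//= lerDl sumr_ge0// => k' _; rewrite sumr_ge0.
Qed.

(** The error combines s + 1 values of [f]: the evaluation point with weight 1, node j with weight -
    \sum_k V k j * th^k. Inverting the Vandermonde matrix means that polynomials of degree < s are
    killed, so [peano_kernel_bound] applies with n = s - 1 on a cell of length 2^-l. *)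
Lemma cell_error (f : sobolev R s) (K : R) l i (th : R) : `|f| <= K ->
  (i <= 2 ^ l)%N -> 0 <= th <= 1 -> (i%:R + th) / 2 ^+ l <= 1 ->
  `|f ((i%:R + th) / 2 ^+ l) - \sum_k cell_coef l i k f * th ^+ k| <=
  interpolation_norm * (2 * 2 ^- l) ^+ s.-1 * Num.sqrt (2 * 2 ^- l) *
  ((K + 1) ^+ 2 + 1).
Proof.
move=> fK il /andP[th0 th1] t1.
have l0 : 0 < 2 ^+ l :> R by rewrite exprn_gt0.
have W0 := interpolation_norm_gt0.
have s0 : 0 < s%:R :> R by rewrite ltr0n.
have [il'|] := ltnP i (2 ^ l); last first.
  move=> il'; have {il il'} ii : i = (2 ^ l)%N by apply/eqP; rewrite eqn_leq il.
  have i2 : i%:R = 2 ^+ l :> R by rewrite ii natrX.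
  (* On the fictitious cell [th] must be 0 and all nodes are truncated to 1, so both sides equal f
     1. *)
  have thE : th = 0.
    by move: t1; rewrite ler_pdivrMr// mul1r i2 => t1; apply/le_anti; rewrite th0 andbT; lra.
  have nodeE j : cell_node l i j = 1.
    apply/min_idPl; rewrite ler_pdivlMr// mul1r i2 lerDl divr_ge0//.
  rewrite thE addr0 i2 divff ?gt_eqF//.
  have -> : \sum_k cell_coef l i k f * 0 ^+ k = f 1.
    rewrite (bigD1 (Ordinal hs))//= expr0 mulr1 [X in _ + X]big1 ?addr0; last first.
      move=> k k0; rewrite expr0n; case: eqP => [k0'|_]; last by rewrite mulr0.
      by case/eqP: k0; exact: val_inj.
    rewrite /cell_coef; under eq_bigr do rewrite nodeE.
    rewrite -big_distrl /=; have := VE (Ordinal hs) (Ordinal hs).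
    by rewrite eqxx /=; under eq_bigr do rewrite expr0 mulr1; move=> ->; rewrite mul1r.
  have h0 : 0 <= 2 * 2 ^- l :> R by rewrite mulr_ge0// invr_ge0 ltW.
  rewrite subrr normr0 mulr_ge0 ?addr_ge0 ?sqr_ge0// mulr_ge0 ?sqrtr_ge0//.
  by rewrite mulr_ge0 ?exprn_ge0// ltW.
pose x (j : 'I_s.+1) : R := if unlift ord0 j is Some j'
  then (i%:R + j'%:R / s%:R) / 2 ^+ l else (i%:R + th) / 2 ^+ l.
pose th' (j : 'I_s.+1) : R := if unlift ord0 j is Some j' then j'%:R / s%:R else th.
pose w (j : 'I_s.+1) : R := if unlift ord0 j is Some j'
  then - \sum_k V k j' * th ^+ k else 1.
have xE j : x j = i%:R / 2 ^+ l + (2 ^+ l)^-1 * th' j.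
  by rewrite /x /th'; case: unliftP => [j' _|_]; rewrite mulrDl; congr (_ + _); exact: mulrC.
have th'01 j : 0 <= th' j <= 1.
  rewrite /th'; case: unliftP => [j' _|_]; last by rewrite th0.
  by rewrite divr_ge0//= ler_pdivrMr// mul1r ler_nat ltnW.
have momth j : (j <= s.-1)%N -> \sum_k w k * th' k ^+ j = 0.
  move=> js; have js' : (j < s)%N by rewrite -(prednK hs) ltnS.
  rewrite big_ord_recl /w /th' unlift_none mul1r.
  under eq_bigr do rewrite liftK mulNr big_distrl /=.
  rewrite sumrN exchange_big /=.
  rewrite (eq_bigr (fun k : 'I_s => th ^+ k * (k == Ordinal js')%:R)); last first.
    move=> k _; rewrite -VE big_distrr /=; apply: eq_bigr => j' _; ring.
  rewrite (bigD1 (Ordinal js'))//= eqxx mulr1 [X in _ - (_ + X)]big1 ?addr0 ?subrr//.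
  by move=> k /negbTE ->; rewrite mulr0.
have mom j : (j <= s.-1)%N -> \sum_k w k * x k ^+ j = 0.
  move=> js; under eq_bigr do rewrite xE.
  by apply: moment_affine => j' j'j; apply: momth; exact: leq_trans j'j js.
have [g fg gE] := weak_derivatives_energy fK.
have [ig wg] := fg.2 s (leqnn s).
have wg' : is_weak_derivative s.-1.+1 f (g s) by rewrite prednK.
pose a : R := i%:R / 2 ^+ l; pose b : R := i.+1%:R / 2 ^+ l.
have ba : b - a = 2 ^- l by rewrite /a /b -mulrBl -natrB// subSnn mul1r.
have ab : a < b by rewrite -subr_gt0 ba invr_gt0.
have a0 : 0 <= a by rewrite divr_ge0// ltW.
have b1 : b <= 1.
  by rewrite /b ler_pdivrMr// mul1r -natrX ler_nat.
have xab j : a <= x j <= b.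
  have /andP[u0 u1] := th'01 j; rewrite xE -/a lerDl mulr_ge0 ?invr_ge0 ?(ltW l0)//=.
  by rewrite -lerBrDl ba ler_piMr ?invr_ge0 ?(ltW l0).
have wW : \sum_j `|w j| <= interpolation_norm.
  rewrite big_ord_recl /w unlift_none normr1 lerD2l.
  under eq_bigr do rewrite liftK normrN.
  rewrite exchange_big /=; apply: ler_sum => j _.
  apply: le_trans (ler_norm_sum _ _ _) _; apply: ler_sum => k _.
  by rewrite normrM ler_piMr// ger0_norm ?exprn_ge0// exprn_ile1.
have := @peano_kernel_bound R s.-1 s.+1 f (g s) ((K + 1) ^+ 2) x w a b interpolation_norm
  (@sobolev_continuous R s f) wg' ig (le_trans (energy_ge g (leqnn s)) gE)
  a0 ab b1 xab wW W0 mom.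
rewrite ba; apply: le_trans; rewrite big_ord_recl {1}/w {1}/x !unlift_none mul1r.
rewrite le_eqVlt; apply/orP; left; apply/eqP; congr (`|_ + _|).
rewrite -sumrN [LHS](eq_bigr (fun k => \sum_j - (V k j * f (cell_node l i j) * th ^+ k))).
  rewrite exchange_big /=; apply: eq_bigr => j _; rewrite /w /x liftK.
  have -> : cell_node l i j = (i%:R + j%:R / s%:R) / 2 ^+ l.
    have := xab (lift ord0 j); rewrite /x liftK => /andP[_ xb].
    by apply/min_idPr; exact: le_trans xb b1.
  rewrite mulNr big_distrl /= sumrN; congr (- _); apply: eq_bigr => k _; ring.
by move=> k _; rewrite /cell_coef big_distrl /= sumrN.
Qed.

End CellInterpolation.

(** * The convolutional decoder *)

Section Decoder.
Context {R : realType} (s : nat).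

Lemma pointwise_paramsP m m' :
  [&& 0 < 1, 1 %| m, 1 %| m', 0 < 1, 0 < 1 & 0 < 1]%N.
Proof. by rewrite !dvd1n. Qed.

Definition pointwise_params m m' : conv_params m m' :=
  ConvParams (pointwise_paramsP m m').

Notation cp := (pointwise_params s (s + s)).

Lemma conv_size_pointwise n m m' : conv_size n (pointwise_params m m') = n.
Proof. by rewrite /conv_size /= muln0 divn1 addn1 subn1. Qed.

(* On the half [b / 2, (b + 1) / 2] of a cell the monomial x^k becomes
   ((b + x) / 2)^k. *)
Definition half_poly (b : bool) : {poly R} := 2^-1 *: ('X + b%:R%:P).

Lemma size_half_poly_exp b k : (size (half_poly b ^+ k) <= k.+1)%N.
Proof.
have sb : size (half_poly b) = 2%N by rewrite size_scale ?invr_eq0// size_XaddC.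
by apply: leq_trans (size_poly_exp_leq _ _) _; rewrite sb mul1n.
Qed.

Definition half_weight (k' : 'I_(s + s)) (k : nat) : R :=
  match fintype.split k' with
  | inl i => (half_poly false ^+ k)`_i
  | inr i => (half_poly true ^+ k)`_i
  end.

Definition refine_conv n : layer R s n (s + s) (conv_size n cp) :=
  @Conv R s (s + s) n cp id (fun k' l _ => half_weight k' l) 0.

Lemma half_column_proof n (j : 'I_n.*2) : (j./2 < conv_size n cp)%N.
Proof. by rewrite conv_size_pointwise; have := ltn_ord j; lia. Qed.

Definition interleave n : layer R (s + s) (conv_size n cp) s n.*2 :=
  Reshape R (fun (i : 'I_s) (j : 'I_n.*2) =>
    (if odd j then rshift s i else lshift s i, Ordinal (half_column_proof j))).

Lemma interleaveE n (Y : 'M[R]_(s + s, conv_size n cp)) i j :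
  layer_eval (interleave n) Y i j =
  Y (if odd j then rshift s i else lshift s i) (Ordinal (half_column_proof j)).
Proof. by rewrite mxE. Qed.

(** A recursion parallel to [refine], instead of n * 2^m, lets the type of the network be computed
    along with it. *)
Fixpoint refined_length m n := if m is m'.+1 then refined_length m' n.*2 else n.

Fixpoint refine m n : network R s n s (refined_length m n) :=
  match m return network R s n s (refined_length m n) with
  | 0%N => NNil R s n
  | m'.+1 => NCons (refine_conv n) (NCons (interleave n) (refine m' n.*2))
  end.

Lemma refined_lengthE m n : refined_length m n = (n * 2 ^ m)%N.
Proof. by elim: m n => [|m IHm] n /=; [rewrite muln1|rewrite IHm -muln2 -mulnA -expnS]. Qed.

Lemma refine_convE n (X : 'M[R]_(s, n)) (k' : 'I_(s + s)) (j : 'I_(conv_size n cp))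
    (j0 : 'I_n) : j0 = j :> nat ->
  layer_eval (refine_conv n) X k' j = \sum_(k < s) half_weight k' k * X k j0.
Proof.
move=> jj; rewrite /= /conv mxE mxE addr0; apply: eq_bigr => k _.
have k1 : (k < s %/ 1)%N by rewrite divn1.
rewrite (big_pred1 (Ordinal k1)) => [|l /=]; last first.
  rewrite /in_group /= mul1n divn_small ?ltn_ord// mul0n add0n.
  by rewrite eq_sym -val_eqE.
rewrite big_ord1 (big_pred1 j0)// => i /=.
by rewrite muln1 mul0n addn0 -val_eqE /= jj.
Qed.

Definition column_poly n (X : 'M[R]_(s, n)) (j : 'I_n) : {poly R} :=
  \sum_(i < s) X i j *: 'X^i.

Lemma refine_step n (X : 'M[R]_(s, n)) (j : 'I_n.*2) (j0 : 'I_n) : j0 = j./2 :> nat ->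
  column_poly (layer_eval (interleave n) (layer_eval (refine_conv n) X)) j =
  column_poly X j0 \Po half_poly (odd j).
Proof.
move=> jj; rewrite /column_poly raddf_sum.
transitivity (\sum_(i < s) \sum_(k < s)
    (X k j0 * (half_poly (odd j) ^+ k)`_i) *: 'X^i : {poly R}).
  apply: eq_bigr => i _; rewrite -scaler_suml; congr (_ *: _).
  rewrite interleaveE (refine_convE _ _ (j0 := j0))//.
  apply: eq_bigr => k _; rewrite mulrC /half_weight; congr (_ * _).
  by case: (odd j); [rewrite (unsplitK (inr i))|rewrite (unsplitK (inl i))].
rewrite exchange_big /=; apply: eq_bigr => k _.
rewrite comp_polyZ comp_Xn_poly.
have sk : (size (half_poly (odd j) ^+ k) <= s)%N.
  exact: leq_trans (size_half_poly_exp _ _) (ltn_ord k).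
rewrite -[in RHS](take_poly_id sk) /take_poly poly_def scaler_sumr.
by apply: eq_bigr => i _; rewrite scalerA.
Qed.

(** Each level consumes one binary digit of [j], the most significant of the last m digits first, as
    the choice of a half. *)
Lemma refineE m n (X : 'M[R]_(s, n)) (j : 'I_(refined_length m n)) (j0 : 'I_n) t :
  j0 = (j %/ 2 ^ m)%N :> nat ->
  (column_poly (net_eval (refine m n) X) j).[t] =
  (column_poly X j0).[((j %% 2 ^ m)%N%:R + t) / 2 ^+ m].
Proof.
elim: m n X j j0 t => [|m IHm] n X j j0 t.
  rewrite divn1 => jj; rewrite modn1 add0r expr0 divr1 /=.
  by rewrite (_ : j = j0)//; exact: val_inj.
move=> jj; have jm : (j %/ 2 ^ m < n.*2)%N.
  rewrite ltn_divLR ?expn_gt0//; apply: leq_trans (ltn_ord j) _.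
  by rewrite refined_lengthE expnS mulnA muln2.
rewrite [net_eval _ _]/= (IHm _ _ j (Ordinal jm))//.
rewrite (@refine_step _ _ _ j0); last first.
  by rewrite jj /= -divn2 -divnMA -expnSr.
rewrite horner_comp; congr (_.[_]).
rewrite /half_poly hornerZ hornerD hornerX hornerC /=.
have -> : (j %% 2 ^ m.+1)%N = (odd (j %/ 2 ^ m) * 2 ^ m + j %% 2 ^ m)%N.
  have jE : j = ((j %/ 2 ^ m)./2 * 2 ^ m.+1 + (odd (j %/ 2 ^ m) * 2 ^ m + j %% 2 ^ m))%N
      :> nat.
    rewrite {1}(divn_eq j (2 ^ m)) -{1}(odd_double_half (j %/ 2 ^ m)) -muln2 expnS.
    by ring.
  rewrite {1}jE modnMDl modn_small// expnS mul2n -addnn -addSn.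
  have := ltn_pmod j (expn_gt0 2 m); case: odd; lia.
rewrite natrD natrM natrX exprS; field.
by rewrite expf_neq0.
Qed.

Lemma layer_weights_refine n : (layer_weights (refine_conv n) <= 2 * s * s)%N.
Proof.
rewrite /= [X in (_ + X)%N](nonzero_eq0 (F := fun i => (0 : 'M[R]__) i.1 i.2)) ?addn0.
  apply: leq_trans (max_card _) _.
  by rewrite !card_prod !card_ord divn1 muln1 addnn mul2n.
by move=> i; rewrite mxE.
Qed.

Lemma refine_bounds m n : [/\ is_cnn (refine m n), num_conv (refine m n) = m,
  (active_weights (refine m n) <= m * (2 * s * s))%N &
  (max_channels (refine m n) <= s + s)%N].
Proof.
elim: m n => [|m IHm] n //; have [i1 i2 i3 i4] := IHm n.*2; split.
- by split; [right; split => //; right|split; [left|]].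
- by rewrite /= i2.
- rewrite [active_weights _]/= mulSn; apply: leq_add; first exact: layer_weights_refine.
  exact: i3.
- by rewrite [max_channels _]/= !geq_max leqnn leq_addr i4.
Qed.

Lemma cell_count_ge l m : ((2 ^ (l + m)).+1 <= refined_length m (2 ^ l).+1)%N.
Proof. by rewrite refined_lengthE mulSn expnD -add1n leq_add2r expn_gt0. Qed.

(** Channel 0 holds the constant coefficient, the value at the left end of a cell of width h. Of the
    columns descending from the fictitious cell only the first is kept, for the grid point 1. *)
Definition read_cells (hs : (0 < s)%N) l m :
    layer R s (refined_length m (2 ^ l).+1) (2 ^ (l + m)).+1 1 :=
  Reshape R (fun (j : 'I_(2 ^ (l + m)).+1) (_ : 'I_1) =>
    (Ordinal hs, widen_ord (cell_count_ge l m) j)).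

Definition write_cells l : layer R #|{: 'I_(2 ^ l).+1 * 'I_s}| 1 s (2 ^ l).+1 :=
  Reshape R (fun (k : 'I_s) (i : 'I_(2 ^ l).+1) => (enum_rank (i, k), ord0)).

Fixpoint net_app m1 n1 m2 n2 (N : network R m1 n1 m2 n2) :
    forall m3 n3, network R m2 n2 m3 n3 -> network R m1 n1 m3 n3 :=
  match N with
  | NNil _ _ => fun _ _ N' => N'
  | NCons _ _ _ _ _ _ L N1 => fun _ _ N' => NCons L (net_app N1 N')
  end.

Lemma net_app_eval m1 n1 m2 n2 m3 n3 (N : network R m1 n1 m2 n2)
    (N' : network R m2 n2 m3 n3) :
  net_eval (net_app N N') = net_eval N' \o net_eval N.
Proof. by elim: N m3 n3 N' => //= m n m' n' m'' n'' L N1 IH m3 n3 N'; rewrite IH. Qed.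

Lemma net_app_all P m1 n1 m2 n2 m3 n3 (N : network R m1 n1 m2 n2)
    (N' : network R m2 n2 m3 n3) :
  all_layers P N -> all_layers P N' -> all_layers P (net_app N N').
Proof.
elim: N m3 n3 N' => //= m n m' n' m'' n'' L N1 IH m3 n3 N' [PL PN1] PN'.
by split=> //; exact: IH.
Qed.

Lemma net_app_counts m1 n1 m2 n2 m3 n3 (N : network R m1 n1 m2 n2)
    (N' : network R m2 n2 m3 n3) :
  [/\ num_conv (net_app N N') = (num_conv N + num_conv N')%N,
      active_weights (net_app N N') = (active_weights N + active_weights N')%N &
      max_channels (net_app N N') = maxn (max_channels N) (max_channels N')].
Proof.
elim: N m3 n3 N' => [m n|m n m' n' m'' n'' L N1 IH] m3 n3 N' /=.
  by rewrite max0n.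
by have [-> -> ->] := IH _ _ N'; rewrite !addnA maxnA.
Qed.

Lemma is_nil_all P m1 n1 m2 n2 (N : network R m1 n1 m2 n2) :
  is_nil N -> all_layers P N.
Proof. by case: N. Qed.

Lemma relu_fully_connected_dense m1 n1 m2 n2 (N : network R m1 n1 m2 n2) :
  relu_fully_connected N ->
  all_layers (fun _ _ _ _ L => is_dense L || is_reshape L) N.
Proof.
elim: N => //= m n m' n' m'' n'' L N1 IH [->].
by case: ifP => [/is_nil_all|_ [_ /IH]].
Qed.

Definition decoder (hs : (0 < s)%N) l m :
    network R #|{: 'I_(2 ^ l).+1 * 'I_s}| 1 (2 ^ (l + m)).+1 1 :=
  NCons (write_cells l) (net_app (refine m (2 ^ l).+1)
    (NCons (read_cells hs l m) (NNil R _ 1))).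

Lemma decoderE hs l m (y : 'cV[R]_#|{: 'I_(2 ^ l).+1 * 'I_s}|)
    (j : 'I_(2 ^ (l + m)).+1) (i : 'I_(2 ^ l).+1) : i = (j %/ 2 ^ m)%N :> nat ->
  net_eval (decoder hs l m) y j 0 =
  \sum_(k < s) y (enum_rank (i, k)) 0 * ((j %% 2 ^ m)%N%:R / 2 ^+ m) ^+ k.
Proof.
move=> ij; pose X := layer_eval (write_cells l) y.
pose j' := widen_ord (cell_count_ge l m) j.
have -> : net_eval (decoder hs l m) y j 0 =
  net_eval (refine m (2 ^ l).+1) X (Ordinal hs) j'.
  by rewrite [LHS]/= net_app_eval [LHS]/= mxE.
have := @refineE m _ X j' i 0 ij; rewrite addr0 /=.
set t := _ / _ => E.
have -> : net_eval (refine m (2 ^ l).+1) X (Ordinal hs) j' =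
  (column_poly (net_eval (refine m (2 ^ l).+1) X) j').[0].
  rewrite horner_coef0 /column_poly coef_sum (bigD1 (Ordinal hs))//= coefZ coefXn /=.
  rewrite mulr1 big1 ?addr0// => k k0; rewrite coefZ coefXn.
  case: eqP => [k0'|_]; last by rewrite mulr0.
  by case/eqP: k0; exact: val_inj.
rewrite E /column_poly horner_sum; apply: eq_bigr => k _.
by rewrite hornerZ hornerXn /X /= mxE.
Qed.

Lemma decoder_bounds hs l m : [/\ is_cnn (decoder hs l m),
  num_conv (decoder hs l m) = m,
  (active_weights (decoder hs l m) <= m * (2 * s * s))%N &
  (max_channels (decoder hs l m) <= s + s)%N].
Proof.
have [i1 i2 i3 i4] := refine_bounds m (2 ^ l).+1.
have [c1 c2 c3] := net_app_counts (refine m (2 ^ l).+1)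
  (NCons (read_cells hs l m) (NNil R (2 ^ (l + m)).+1 1)).
split.
- split; first by left.
  by apply: net_app_all => //; split=> //; left.
- by rewrite /= c1 /= i2 !addn0.
- by rewrite /= c2 /= !addn0.
- by rewrite /= c3 /= /layer_channels /= maxn0 max0n.
Qed.

(* As the decoder is linear, it is a single dense layer. *)
Lemma decoder_dense hs l m p (phi : network R p 1 #|{: 'I_(2 ^ l).+1 * 'I_s}| 1) :
  relu_fully_connected phi -> is_dnn (net_eval (decoder hs l m) \o net_eval phi).
Proof.
move=> phir.
have cell_lt (j : 'I_(2 ^ (l + m)).+1) : (j %/ 2 ^ m < (2 ^ l).+1)%N.
  rewrite ltn_divLR ?expn_gt0// -refined_lengthE.
  exact: leq_trans (ltn_ord j) (cell_count_ge l m).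
pose coef (j : nat) (a : 'I_(2 ^ l).+1 * 'I_s) : R :=
  if a.1 == (j %/ 2 ^ m)%N :> nat then ((j %% 2 ^ m)%N%:R / 2 ^+ m) ^+ a.2 else 0.
pose W : 'M[R]_((2 ^ (l + m)).+1, #|{: 'I_(2 ^ l).+1 * 'I_s}|) :=
  \matrix_(j, a) coef j (enum_val a).
exists (net_app phi (NCons (Dense id W 0) (NNil R _ 1))); split.
  by apply: net_app_all; [exact: relu_fully_connected_dense|].
rewrite net_app_eval; apply/funext => x /=; set y := net_eval phi x.
apply/matrixP => j j'; rewrite ord1 (@decoderE hs l m y j (Ordinal (cell_lt j)))//.
rewrite !mxE addr0.
rewrite (reindex (@enum_rank ('I_(2 ^ l).+1 * 'I_s)%type)) /=; last first.
  by exists enum_val => a _; rewrite ?enum_rankK ?enum_valK.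
rewrite (eq_bigr (fun a : 'I_(2 ^ l).+1 * 'I_s =>
  coef j (a.1, a.2) * y (enum_rank (a.1, a.2)) 0)).
  rewrite -(pair_bigA _ (fun (i : 'I_(2 ^ l).+1) (k : 'I_s) =>
    coef j (i, k) * y (enum_rank (i, k)) 0)) /=.
  rewrite (bigD1 (Ordinal (cell_lt j)))//= [X in _ + X]big1.
    by rewrite addr0; apply: eq_bigr => k _; rewrite /coef /= eqxx mulrC.
  move=> i /negbTE; rewrite -val_eqE /= => ij; rewrite big1// => k _.
  by rewrite /coef /= ij mul0r.
by move=> [i k] _; rewrite mxE enum_rankK.
Qed.

End Decoder.

(** * Approximation of functionals, and conclusion *)

Section FunctionalNetwork.
Context {R : realType} (p : nat) (W : normedModType R).
Notation V := 'cV[R]_p.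
Variables (Theta : set V) (u : V -> W) (r : nat) (K : R).
Hypotheses (cT : compact Theta) (hu : Cr_on r Theta u) (K0 : 0 < K).

Lemma mpolZ n a (c : seq 'I_p -> R) (h : V) :
  mpol n (fun al => a * c al) h = a * mpol n c h.
Proof.
elim: n c => [|n IHn] c /=; first by rewrite mulr0.
rewrite mulrDr big_distrr /=; congr (_ + _); apply: eq_bigr => i _.
by rewrite (IHn (fun al => c (i :: al))) mulrCA.
Qed.

(** For r > 0 the remainder M (2 eta)^r must be at most e / 2, so the cell width [eta] is a multiple
    of e^(1/r) and eta^-p costs e^(-p/r). For r = 0 uniform continuity yields some [eta] without a
    rate, and the polynomials are constants; [r.-1.+1] covers both cases. *)
Lemma local_polynomials : exists2 C : R, 0 < C & exists2 M : R, 0 < M &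
  forall e : R, 0 < e < 1 / 2 -> exists eta : R, [/\ 0 < eta <= 1,
    (0 < r)%N -> eta ^- p <= C * e `^ (- (p%:R / r%:R)) &
    forall l : W -> R, linear (l : W -> R^o) -> (forall w, `|l w| <= K * `|w|) ->
    forall x0, Theta x0 -> exists c : seq 'I_p -> R, (forall al, `|c al| <= M) /\
      forall x, Theta x -> `|x - x0| <= 2 * eta ->
      `|l (u x) - mpol r.-1.+1 c (x - x0)| <= e / 2].
Proof.
have [U [F [oU TU Fu CF]]] := hu.
have [r0|r0] := posnP r.
  have cF := Cr_continuous CF.
  have [d d0 [M M0 HM]] := compact_locally_bounded cT oU TU cF.
  exists 1 => //; exists (K * M); first by rewrite mulr_gt0.
  move=> e /andP[e0 _]; have e'0 : 0 < e / (2 * K) by rewrite divr_gt0// mulr_gt0.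
  have [d1 d10 Hd] := compact_uniform_continuity cT TU e'0 cF.
  exists (Num.min 1 (d1 / 2)); split.
  - by rewrite lt_min ltr01 divr_gt0//= ge_min lexx.
  - by rewrite r0.
  move=> l ll lK x0 Tx0; exists (fun=> l (u x0)); split=> [_|x Tx xx0].
    apply: le_trans (lK _) _; rewrite ler_pM2l// -Fu//.
    by have [|_] := HM x0 x0 Tx0; rewrite // subrr normr0 ltW.
  rewrite r0 /= big1 ?addr0; last by move=> i _; rewrite mulr0.
  have -> : l (u x) - l (u x0) = l (u x - u x0).
    by rewrite [u x - _]addrC -(scaleN1r (u x0)) (ll (-1) (u x0) (u x)) /GRing.scale /= mulN1r addrC.
  apply: le_trans (lK _) _; rewrite -!Fu//.
  have xd : `|x - x0| <= d1.
    apply: le_trans xx0 _; rewrite -ler_pdivlMl// mulrC.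
    by rewrite ge_min lexx orbT.
  apply: (@le_trans _ _ (K * (e / (2 * K)))); first by rewrite ler_pM2l// Hd.
  by rewrite [leLHS](_ : _ = e / 2)//; field; rewrite gt_eqF.
have [d d0 [M0 M00 HM]] := taylor cT oU TU CF.
pose M := K * M0; have M_gt0 : 0 < M by rewrite mulr_gt0.
(* With eta = c0 e^(1/r), the constraints give in turn eta <= 1, 2 eta <= d, and M (2 eta)^r <= e /
   2. *)
pose c0 := Num.min (Num.min 1 (d / 2)) (2 * M * 2 ^+ r)^-1.
have Q0 : 0 < 2 * M * 2 ^+ r by rewrite !mulr_gt0// exprn_gt0.
have c00 : 0 < c0 by rewrite !lt_min ltr01 divr_gt0//= invr_gt0.
have c01 : c0 <= 1 by rewrite !ge_min lexx.
have c0d : c0 <= d / 2 by rewrite !ge_min lexx orbT.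
have c0Q : c0 <= (2 * M * 2 ^+ r)^-1 by rewrite !ge_min lexx orbT.
exists (c0 ^- p); first by rewrite invr_gt0 exprn_gt0.
exists M => // e /andP[e0 e2].
have rn0 : r%:R != 0 :> R by rewrite pnatr_eq0 -lt0n.
pose y := e `^ (r%:R^-1).
have y0 : 0 < y by exact: powR_gt0.
have yr : y ^+ r = e.
  by rewrite -powR_mulrn ?(ltW y0)// -powRrM mulVf// powRr1// ltW.
have y1 : y <= 1 by rewrite -(expr_le1 r0) ?(ltW y0)// yr; lra.
exists (c0 * y); split.
- by rewrite mulr_gt0//= mulr_ile1// ltW.
- move=> _; rewrite exprMn invfM ler_pM2l ?invr_gt0 ?exprn_gt0//.
  rewrite powRN; have -> : e `^ (p%:R / r%:R) = y ^+ p; last by [].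
  by rewrite mulrC powRrM powR_mulrn// ltW.
move=> l ll lK x0 Tx0.
pose l' w := K^-1 * l w.
have ll' : linear (l' : W -> R^o).
  by move=> a v w; rewrite /l' ll mulrDr /GRing.scale /= mulrCA.
have lb' w : `|l' w| <= `|w|.
  by rewrite normrM gtr0_norm ?invr_gt0// ler_pdivrMl.
have [c [cM cE]] := HM l' ll' lb' x0 Tx0.
exists (fun al => K * c al); split=> [al|x Tx xx0].
  by rewrite normrM gtr0_norm// ler_pM2l.
rewrite (prednK r0) mpolZ.
have -> : l (u x) = K * l' (F (x0 + (x - x0))).
  by rewrite addrC subrK Fu// /l' mulrA divff ?mul1r// gt_eqF.
rewrite -mulrBr normrM gtr0_norm//.
have hd : `|x - x0| <= d.
  apply: le_trans xx0 _; rewrite mulrA.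
  apply: (@le_trans _ _ (2 * c0)); last by lra.
  by rewrite ler_piMr// mulr_ge0// ltW.
apply: (@le_trans _ _ (K * (M0 * `|x - x0| ^+ r))); first by rewrite ler_pM2l// cE.
rewrite mulrA -/M.
apply: (@le_trans _ _ (M * (2 * (c0 * y)) ^+ r)).
  rewrite ler_pM2l// lerXn2r ?nnegrE//.
  by rewrite mulr_ge0// mulr_ge0// ltW.
rewrite !exprMn yr.
have c0r : c0 ^+ r <= c0 by rewrite -[leRHS]expr1 ler_wiXn2l// ltW.
have h1 : 2 * M * 2 ^+ r * c0 ^+ r <= 1.
  by rewrite -ler_pdivlMl// mulr1; exact: le_trans c0Q.
have -> : M * (2 ^+ r * (c0 ^+ r * e)) = (2 * M * 2 ^+ r * c0 ^+ r) * (e / 2).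
  by field.
by rewrite ler_piMl// divr_ge0// ltW.
Qed.

(** Precision [kap * eps] changes only constants: the logarithm grows by a factor at most [A],
    because [ln (1 / eps)] >= [ln 2], and the power of [eps] by the factor [P]. The functionals come
    after [C] since they will depend on [eps]. *)
Theorem functional_network (kap : R) : 0 < kap <= 1 ->
  exists2 C : R, 0 < C &
  forall (eps : R) q (l : 'I_q -> W -> R), 0 < eps < 1 / 2 ->
  (forall a, linear (l a : W -> R^o)) -> (forall a w, `|l a w| <= K * `|w|) ->
  exists phi : network R p 1 q 1,
    [/\ relu_fully_connected phi,
        (num_dense phi)%:R <= C * ln (1 / eps),
        (0 < r)%N -> (active_weights phi)%:R <=
          C * eps `^ (- (p%:R / r%:R)) * (ln (1 / eps) + q%:R) &
        forall x a, Theta x -> `|net_eval phi x a 0 - l a (u x)| <= kap * eps].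
Proof.
move=> /andP[k0 k1].
have [C1 C10 [M M0 HM]] := local_polynomials.
have [B0 B00 [B1 B10 HB]] := compact_locally_bounded cT openT (@subsetT _ _)
  (fun x _ => @cvg_id _ (nbhs x)).
have TB x : Theta x -> `|x| <= B1.
  by move=> Tx; have [|_] := HB x x Tx; rewrite // subrr normr0 ltW.
have [C2 C20 HC2] := @local_approximation_network R p r.-1 B1 M B10 M0.
have l2 : 0 < ln 2 :> R by rewrite ln_gt0// ltr1n.
pose A := ln (1 / kap) / ln 2 + 1.
have lk0 : 0 <= ln (1 / kap) by rewrite ln_ge0// ler_pdivlMr// mul1r.
have A1 : 1 <= A by rewrite lerDr divr_ge0// ltW.
have A0 : 0 < A by exact: lt_le_trans A1.
pose P : R := kap `^ (- (p%:R / r%:R)).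
have P0 : 0 < P by exact: powR_gt0.
exists (C2 * A + C2 * C1 * P * A); first by rewrite addr_gt0 ?mulr_gt0.
move=> eps q l e01 ll lK; have /andP[e0 e2] := e01.
pose e := kap * eps; have e'0 : 0 < e by rewrite mulr_gt0.
have ee : 0 < e < 1 / 2.
  by rewrite e'0; apply: le_lt_trans e2; rewrite ler_piMl// ltW.
have L2 : ln 2 <= ln (1 / eps).
  by rewrite ler_ln ?posrE ?divr_gt0// ler_pdivlMr//; lra.
have L0 : 0 < ln (1 / eps) by exact: lt_le_trans L2.
have Le : ln (1 / e) <= A * ln (1 / eps).
  have -> : 1 / e = 1 / kap * (1 / eps) by rewrite /e; field; rewrite !gt_eqF.
  rewrite lnM ?posrE ?divr_gt0// /A [leRHS]mulrDl [1 * ln _]mul1r lerD2r.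
  by rewrite mulrAC ler_pdivlMr// ler_wpM2l.
have [eta [eta01 etaC Heta]] := HM e ee.
have [phi [phi1 phi2 phi3 phi4]] := HC2 Theta q (fun x a => l a (u x)) eta e TB eta01 ee
  (fun a x0 Tx0 => Heta (l a) (ll a) (lK a) x0 Tx0).
exists phi; split => //.
- apply: le_trans phi2 _; apply: (@le_trans _ _ (C2 * (A * ln (1 / eps)))).
    by rewrite ler_pM2l.
  by rewrite mulrA ler_pM2r// lerDl !mulr_ge0// ltW.
- move=> r0; apply: le_trans phi3 _.
  have eP : e `^ (- (p%:R / r%:R)) = P * eps `^ (- (p%:R / r%:R)).
    by rewrite /e powRM// ltW.
  have E0 : 0 < eps `^ (- (p%:R / r%:R)) by exact: powR_gt0.
  have := etaC r0; rewrite eP; set E := eps `^ _ => h1.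
  apply: (@le_trans _ _ (C2 * (C1 * (P * E)) * (A * (ln (1 / eps) + q%:R)))).
    apply: ler_pM; last 2 first.
    + by rewrite ler_pM2l.
    + rewrite [leRHS]mulrDr; apply: lerD => //; by rewrite ler_peMl.
    + rewrite mulr_ge0 ?(ltW C20)// invr_ge0 exprn_ge0//; by case/andP: eta01 => /ltW.
    + rewrite addr_ge0// ln_ge0// ler_pdivlMr// mul1r; lra.
  have -> : C2 * (C1 * (P * E)) * (A * (ln (1 / eps) + q%:R)) =
    C2 * C1 * P * A * E * (ln (1 / eps) + q%:R) by ring.
  rewrite ler_wpM2r ?addr_ge0 ?(ltW L0)// ler_wpM2r ?(ltW E0)//.
  by rewrite lerDr mulr_ge0// ltW.
Qed.

End FunctionalNetwork.

Lemma dyadic_level (R : realType) (Y : R) : 0 <= Y ->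
  exists l : nat, Y <= 2 ^+ l /\ 2 ^+ l <= 2 * Y + 1.
Proof.
move=> Y0; have ex : exists l, Y <= 2 ^+ l.
  exists (Num.truncn Y).+1; apply: ltW; apply: lt_trans (_ : (Num.truncn Y).+1%:R < _).
    by have /andP[] := truncn_itv Y0.
  by rewrite -natrX ltr_nat ltn_expl.
exists (ex_minn ex); case: ex_minnP => [[|l] Yl lmin]; split => //.
  by rewrite expr0 lerDr mulr_ge0.
have : 2 ^+ l < Y.
  by rewrite ltNge; apply/negP => /lmin; rewrite ltnn.
by rewrite exprS; lra.
Qed.

(** The exponent is such that tau = eps^(2/(2s-1)) satisfies tau^(s-1/2) = eps. The constant enters
    as c^(s-1/2), which is at most sqrt c as c <= 1. *)
Lemma sqrt_level_bound (R : realType) s (eps c t : R) : (0 < s)%N -> 0 < eps ->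
  0 <= c <= 1 -> 0 <= t -> t <= c * eps `^ (2 / (2 * s%:R - 1)) ->
  t ^+ s.-1 * Num.sqrt t <= Num.sqrt c * eps.
Proof.
move=> s0 e0 /andP[c0 c1] t0 tle.
set tau := eps `^ _ in tle; have tau0 : 0 <= tau by exact: powR_ge0.
have sE : 2 * s%:R - 1 = s.-1.*2.+1%:R :> R.
  have -> : s%:R = s.-1%:R + 1 :> R by rewrite natr1 prednK.
  by rewrite -[s.-1.*2.+1]addn1 natrD -mul2n natrM; ring.
have tauE : tau ^+ s.-1.*2.+1 = eps ^+ 2.
  rewrite -powR_mulrn// /tau -powRrM -sE divfK; last by rewrite sE pnatr_eq0.
  by rewrite powR_mulrn// ltW.
have -> : t ^+ s.-1 * Num.sqrt t = Num.sqrt (t ^+ s.-1.*2.+1).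
  rewrite exprSr sqrtrM ?exprn_ge0// -muln2 exprM sqrtr_sqr.
  by rewrite ger0_norm// exprn_ge0.
have -> : Num.sqrt c * eps = Num.sqrt (c * eps ^+ 2).
  by rewrite sqrtrM// sqrtr_sqr gtr0_norm.
rewrite ler_wsqrtr// -tauE.
apply: (@le_trans _ _ ((c * tau) ^+ s.-1.*2.+1)).
  by rewrite lerXn2r ?nnegrE// mulr_ge0.
rewrite exprMn ler_wpM2r ?exprn_ge0//.
by rewrite -[leRHS]expr1 ler_wiXn2l.
Qed.

Theorem theorem2 (R : realType) (p s r : nat) (hs : (1 <= s)%N)
    (Theta : set 'cV[R]_p) (hTheta : compact Theta)
    (u : 'cV[R]_p -> sobolev R s) (hu : Cr_on r Theta u) :
  exists2 C : R, 0 < C & forall k : nat, (0 < k)%N ->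
    let h : R := 2 ^- k in
    let Nh : nat := (2 ^ k).+1 in
    forall eps : R, 0 < eps < 1 / 2 ->
    exists Phi : 'cV[R]_p -> 'cV[R]_Nh,
      [/\ is_dnn Phi,
          (forall mu, Theta mu -> forall j : 'I_Nh,
             `|u mu (j%:R * h) - Phi mu j 0| < eps) &
          exists (q : nat) (phi : network R p 1 q 1)
                 (Psi : network R q 1 Nh 1),
            [/\ relu_fully_connected phi, is_cnn Psi &
                Phi = net_eval Psi \o net_eval phi] /\
            [/\ (num_dense phi)%:R <= C * ln (1 / eps),
                (num_conv Psi)%:R <= C * ln (1 / h),
                ((0 < r)%N ->
                  (active_weights phi + active_weights Psi)%:R <=
                  C * eps `^ (- (2 / (2 * s%:R - 1))) *
                    (eps `^ (- (p%:R / r%:R)) * ln (1 / eps) + ln (1 / h))) &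
                (max_channels Psi)%:R <= C * eps `^ (- (2 / (2 * s%:R - 1)))]].
Proof.
have [V [VE V0]] := @interpolation_weights R s hs.
set W := interpolation_norm V; have W0 : 0 < W := interpolation_norm_gt0 V.
have s0 : 0 < s%:R :> R by rewrite ltr0n.
have s1 : 1 <= s%:R :> R by rewrite ler1n.
have l2 : 0 < ln 2 :> R by rewrite ln_gt0// ltr1n.
have K0 : 0 < W * 23 by rewrite mulr_gt0.
(* A cell has [s] coefficients, each multiplied by a power of [th] <= 1: the network error totals
   eps / 4. *)
have kap01 : 0 < (4 * s%:R : R)^-1 <= 1.
  by rewrite invr_gt0 mulr_gt0//= invf_le1 ?mulr_gt0//; lra.
have [C1 C10 Hnet] := @functional_network R p _ Theta u r _ hTheta hu K0 _ kap01.
have [U [F [oU TU Fu CF]]] := hu.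
have [d d0 [Ku Ku0 HKu]] := compact_locally_bounded hTheta oU TU (Cr_continuous CF).
have uK x : Theta x -> `|u x| <= Ku.
  move=> Tx; rewrite -Fu//; have [|_] := HKu x x Tx; last by [].
  by rewrite subrr normr0 ltW.
pose Q := W * ((Ku + 1) ^+ 2 + 1); have Q0 : 0 < Q.
  by rewrite mulr_gt0// ltr_wpDl ?sqr_ge0.
(* The interpolation error is at most Q sqrt c1 eps by [sqrt_level_bound], hence eps / 2 with this
   choice; that lemma asks for a constant at most 1. *)
pose c1 := Num.min 1 (((2 * Q)^-1) ^+ 2).
have Qi0 : 0 < (2 * Q)^-1 by rewrite invr_gt0 mulr_gt0.
have c10 : 0 < c1 by rewrite lt_min ltr01 exprn_gt0.
have c11 : c1 <= 1 by rewrite ge_min lexx.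
have sc1 : Num.sqrt c1 <= (2 * Q)^-1.
  rewrite -[leRHS](gtr0_norm Qi0) -sqrtr_sqr ler_wsqrtr//.
  by rewrite ge_min lexx orbT.
pose Cq : R := (4 / c1 + 2) * s%:R.
have Cq0 : 0 < Cq by rewrite mulr_gt0// addr_gt0// divr_gt0.
pose Ca : R := C1 * (1 + Cq / ln 2); pose Cc : R := 2 * s%:R ^+ 2 / ln 2.
have Ca0 : 0 < Ca by rewrite mulr_gt0// addr_gt0// divr_gt0.
have Cc0 : 0 < Cc by rewrite divr_gt0// mulr_gt0// exprn_gt0.
exists (C1 + (ln 2)^-1 + Ca + Cc + 2 * s%:R).
  by rewrite !addr_gt0 ?invr_gt0// mulr_gt0.
move=> k k0 h Nh eps e01; have /andP[e0 e2] := e01.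
rewrite /Nh /h {Nh h}.
set T := eps `^ (- (2 / _)).
have sm1 : 0 < 2 * s%:R - 1 :> R by lra.
have aT : 0 <= 2 / (2 * s%:R - 1) :> R by rewrite divr_ge0// ltW.
have tau0 : 0 < eps `^ (2 / (2 * s%:R - 1)) by exact: powR_gt0.
have TE : T = (eps `^ (2 / (2 * s%:R - 1)))^-1 by rewrite /T powRN.
have T1 : 1 <= T.
  by rewrite -(powRr0 eps) /T ger_powR ?e0 ?oppr_le0//=; lra.
have T0 : 0 < T by exact: lt_le_trans T1.
have L2 : ln 2 <= ln (1 / eps).
  by rewrite ler_ln ?posrE ?divr_gt0// ler_pdivlMr//; lra.
have L0 : 0 < ln (1 / eps) by exact: lt_le_trans L2.
(* 2^l0 >= 2 T / c1 means 2 * 2^-l0 <= c1 eps^(2/(2s-1)), the width required by [sqrt_level_bound];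
   the matching upper bound keeps the number of cells O(T). *)
have Y0 : 0 <= 2 / c1 * T by rewrite mulr_ge0 ?divr_ge0// ltW.
have [l0 [l0ge l0le]] := dyadic_level Y0.
have [l [m [kE ll0 ml]]] : exists l m, [/\ k = (l + m)%N, (l <= l0)%N & m = 0%N \/ l = l0].
  have [kl|lk] := leqP k l0.
    by exists k, 0%N; rewrite addn0; split => //; left.
  by exists l0, (k - l0)%N; rewrite subnKC ?(ltnW lk)//; split => //; right.
subst k.
pose q := #|{: 'I_(2 ^ l).+1 * 'I_s}|.
pose ell (a : 'I_q) (f : sobolev R s) : R :=
  cell_coef V l (enum_val a).1 (enum_val a).2 f.
have ell_lin a : linear (ell a : _ -> R^o).
  by move=> c f g; rewrite /ell -cell_coef_linear.
have ell_bound a f : `|ell a f| <= W * 23 * `|f|.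
  by rewrite -mulrA; apply: cell_coef_le => t; exact: sobolev_eval_bound.
have [phi [phi1 phi2 phi3 phi4]] := Hnet eps q ell e01 ell_lin ell_bound.
have [psi1 psi2 psi3 psi4] := @decoder_bounds R s hs l m.
exists (net_eval (@decoder R s hs l m) \o net_eval phi); split.
- exact: decoder_dense.
- move=> mu Tmu j.
  have im : (j %/ 2 ^ m < (2 ^ l).+1)%N.
    rewrite ltn_divLR ?expn_gt0// -refined_lengthE.
    exact: leq_trans (ltn_ord j) (cell_count_ge l m).
  rewrite /= (@decoderE R s hs l m _ j (Ordinal im))//.
  set y := net_eval phi mu; set th : R := (j %% 2 ^ m)%N%:R / 2 ^+ m.
  have p2 n : 0 < 2 ^+ n :> R by rewrite exprn_gt0.
  have th0 : 0 <= th by rewrite divr_ge0// ltW.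
  have th1 : th <= 1.
    by rewrite ler_pdivrMr// mul1r -natrX ler_nat ltnW// ltn_pmod// expn_gt0.
  have xE : j%:R * 2 ^- (l + m) = ((j %/ 2 ^ m)%N%:R + th) / 2 ^+ l :> R.
    rewrite {1}(divn_eq j (2 ^ m)) natrD natrM natrX exprD /th.
    by field; rewrite !expf_neq0.
  have x1 : ((j %/ 2 ^ m)%N%:R + th) / 2 ^+ l <= 1.
    rewrite -xE ler_pdivrMr// mul1r -natrX ler_nat; exact: ltn_ord j.
  rewrite xE.
  pose S : R := \sum_k cell_coef V l (j %/ 2 ^ m) k (u mu) * th ^+ k.
  have err1 : `|u mu (((j %/ 2 ^ m)%N%:R + th) / 2 ^+ l) - S| <= eps / 2.
    (* If m = 0, then [th] = 0 and only the constant coefficient remains; by [V0] it is exactly the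
       value at the left end, however wide the cell. *)
    have [m0|lE] := ml.
      have mod0 n : (n %% 2 ^ m)%N = 0%N by rewrite m0 modn1.
      have thE : th = 0 by rewrite /th mod0 mul0r.
      have -> : S = u mu (((j %/ 2 ^ m)%N%:R + th) / 2 ^+ l).
        rewrite /S (bigD1 (Ordinal hs))//= expr0 mulr1 [X in _ + X]big1 ?addr0; last first.
          move=> i i0; rewrite thE expr0n; case: eqP => [i0'|_]; last by rewrite mulr0.
          by case/eqP: i0; exact: val_inj.
        rewrite /cell_coef (bigD1 (Ordinal hs))//= V0 eqxx mul1r big1 ?addr0; last first.
          by move=> i; rewrite V0 eq_sym => /negbTE ->; rewrite mul0r.
        congr (u mu _); rewrite /cell_node /= mul0r addr0 thE addr0.
        by apply/min_idPr; move: x1; rewrite thE addr0.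
      by rewrite subrr normr0 divr_ge0// ltW.
    have il : (j %/ 2 ^ m <= 2 ^ l)%N by rewrite -ltnS.
    have th01 : 0 <= th <= 1 by rewrite th0.
    apply: le_trans (cell_error hs VE (uK _ Tmu) il th01 x1) _.
    have tle : 2 * 2 ^- l <= c1 * eps `^ (2 / (2 * s%:R - 1)).
      rewrite lE ler_pdivrMr//.
      have := l0ge; rewrite TE => l0ge'.
      apply: (@le_trans _ _ (c1 * eps `^ (2 / (2 * s%:R - 1)) *
          (2 / c1 * (eps `^ (2 / (2 * s%:R - 1)))^-1))).
        rewrite le_eqVlt; apply/orP; left; apply/eqP.
        by move: tau0; set tau := eps `^ _ => tau0; field; rewrite !gt_eqF.
      by rewrite ler_wpM2l// mulr_ge0// ltW.
    have t0 : 0 <= 2 * 2 ^- l :> R by rewrite mulr_ge0// invr_ge0 ltW.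
    have c01 : 0 <= c1 <= 1 by rewrite (ltW c10).
    have := sqrt_level_bound hs e0 c01 t0 tle.
    rewrite -/W; set t := 2 * 2 ^- l => ht.
    have -> : W * t ^+ s.-1 * Num.sqrt t * ((Ku + 1) ^+ 2 + 1) =
      Q * (t ^+ s.-1 * Num.sqrt t) by rewrite /Q; ring.
    apply: (@le_trans _ _ (Q * ((2 * Q)^-1 * eps))).
      rewrite ler_pM2l//; apply: le_trans ht _; by rewrite ler_pM2r.
    by rewrite (_ : Q * _ = eps / 2)//; field; rewrite gt_eqF.
  have err2 : `|S - \sum_(k < s) y (enum_rank (Ordinal im, k)) 0 * th ^+ k| <= eps / 4.
    rewrite /S -sumrB; apply: le_trans (ler_norm_sum _ _ _) _.
    apply: (@le_trans _ _ (\sum_(k < s) (4 * s%:R)^-1 * eps)).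
      apply: ler_sum => k _; rewrite -mulrBl normrM distrC.
      have := phi4 mu (enum_rank (Ordinal im, k)) Tmu.
      rewrite /ell enum_rankK /= -/y => hk; apply: le_trans hk.
      by rewrite ler_piMr// ger0_norm ?exprn_ge0// exprn_ile1.
    rewrite sumr_const card_ord -[leLHS]mulr_natl le_eqVlt; apply/orP; left.
    by apply/eqP; field; rewrite gt_eqF.
  (* The errors eps / 2 and eps / 4 leave room for the strict inequality. *)
  have := ler_distD S (u mu (((j %/ 2 ^ m)%N%:R + th) / 2 ^+ l))
    (\sum_(k < s) y (enum_rank (Ordinal im, k)) 0 * th ^+ k).
  by lra.
exists q, phi, (@decoder R s hs l m); split; first by split.
have hE : ln (1 / 2 ^- (l + m)) = (l + m)%:R * ln 2 :> R.
  by rewrite div1r invrK lnXn// mulr_natl.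
have lm0 : 0 <= (l + m)%:R :> R by [].
have mlm : m%:R <= (l + m)%:R :> R by rewrite ler_nat leq_addl.
set C := C1 + _ + _ + _ + _.
have l2i : 0 < (ln 2)^-1 :> R by rewrite invr_gt0.
have CE : C = C1 + (ln 2)^-1 + Ca + Cc + 2 * s%:R by [].
have CC1 : C1 <= C by lra.
have C0 : 0 < C by exact: lt_le_trans CC1.
have Cl2 : (ln 2)^-1 <= C by lra.
have Cac : Ca + Cc <= C by lra.
have C2s : 2 * s%:R <= C by lra.
split.
- by apply: le_trans phi2 _; rewrite ler_pM2r.
- rewrite psi2 hE; apply: le_trans mlm _.
  apply: (@le_trans _ _ ((ln 2)^-1 * ((l + m)%:R * ln 2))).
    by rewrite mulrC mulfK// gt_eqF.
  by rewrite ler_wpM2r// mulr_ge0// ltW.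
- move=> r0; rewrite natrD.
  set P := eps `^ (- (p%:R / r%:R)).
  have P1 : 1 <= P.
    have pr0 : 0 <= p%:R / r%:R :> R by rewrite divr_ge0.
    rewrite -(powRr0 eps) /P; apply: ger_powR; last by rewrite oppr_le0.
    by rewrite e0 /=; lra.
  have qT : q%:R <= Cq * T.
    rewrite /q card_prod !card_ord natrM -natr1 natrX /Cq mulrAC ler_pM2r//.
    apply: (@le_trans _ _ (2 ^+ l0 + 1)); first by rewrite lerD2r ler_weXn2l// ler1n.
    apply: (@le_trans _ _ (2 * (2 / c1 * T) + 1 + 1)); first by rewrite lerD2r.
    have -> : (4 / c1 + 2) * T = 2 * (2 / c1 * T) + 2 * T by ring.
    by lra.
  have h1 : (active_weights phi)%:R <= Ca * T * (P * ln (1 / eps)).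
    apply: le_trans (phi3 r0) _; rewrite -/P.
    have -> : Ca * T * (P * ln (1 / eps)) =
      C1 * P * (T * ln (1 / eps) + Cq * T * (ln (1 / eps) / ln 2)).
      by rewrite /Ca; field; rewrite gt_eqF.
    rewrite ler_wpM2l//; first by rewrite mulr_ge0// ltW// (lt_le_trans _ P1).
    apply: lerD; first by rewrite ler_peMl// ltW.
    apply: le_trans qT _; rewrite ler_peMr//; first by rewrite mulr_ge0// ltW.
    by rewrite ler_pdivlMr// [1 * ln 2]mul1r.
  have h2 : (active_weights (@decoder R s hs l m))%:R <= Cc * T * ln (1 / 2 ^- (l + m)).
    apply: (@le_trans _ _ (m * (2 * s * s))%:R); first by rewrite ler_nat.
    rewrite hE !natrM.
    have -> : Cc * T * ((l + m)%:R * ln 2) = (l + m)%:R * (2 * s%:R * s%:R) * T.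
      by rewrite /Cc; field; rewrite gt_eqF.
    apply: (@le_trans _ _ ((l + m)%:R * (2 * s%:R * s%:R))).
      by rewrite ler_wpM2r// !mulr_ge0.
    by rewrite ler_peMr// !mulr_ge0.
  apply: le_trans (lerD h1 h2) _.
  have X0 : 0 <= P * ln (1 / eps) by rewrite mulr_ge0// ?(ltW L0)//; exact: le_trans P1.
  have Z0 : 0 <= ln (1 / 2 ^- (l + m)) :> R by rewrite hE mulr_ge0// ltW.
  move: X0 Z0; set X := P * _; set Y := ln (1 / 2 ^- _) => X0 Z0.
  apply: (@le_trans _ _ ((Ca + Cc) * T * (X + Y))).
    have -> : (Ca + Cc) * T * (X + Y) =
      Ca * T * X + Cc * T * Y + (Ca * T * Y + Cc * T * X) by ring.
    have CaT : 0 <= Ca * T by rewrite mulr_ge0// ltW.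
    have CcT : 0 <= Cc * T by rewrite mulr_ge0// ltW.
    by rewrite lerDl addr_ge0// mulr_ge0.
  by rewrite ler_wpM2r ?addr_ge0// ler_pM2r.
- apply: (@le_trans _ _ (s + s)%:R); first by rewrite ler_nat.
  rewrite addnn -mul2n natrM; apply: le_trans C2s _.
  by rewrite ler_peMr// ltW.
Qed.
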